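(* Assume that $X\in\mathcal{CM}(+\infty,\rho)$ is a spectrally positive process having jumps of infinite variation and defined by the characteristic triple $(a,0,\pi)_{h\equiv x}$. Let $\psi(z)$ be its Laplace exponent. Fix $k\in\{1,2\}$. For $n\ge1$ let $\{x_i\}_{1\le i\le n}$ and $\{w_i\}_{1\le i\le n}$ be the nodes and the weights of the Gaussian quadrature of order $n$ with respect to the measure $v^{2+k}\mu^*(\mathrm{d}v)$ on $(0,1/\rho]$. (i) The $[n+k/n]$ Padé approximant of $\psi$ at $0$ is $$\psi^{[n+k/n]}(z)=\sum_{j=1}^k\psi^{(j)}(0)\frac{z^j}{j!}+z^{k+1}\sum_{i=1}^n\frac{w_i}{1-zx_i}.$$ (ii) The function $\psi^{[n+k/n]}(z)$ is the Laplace exponent of a hyperexponential process $X^{(n)}$. The process $X^{(n)}$ has a Lévy measure with density $$\pi_n(x):=\mathbf{1}_{\{x>0\}}\sum_{i=1}^nw_ix_i^{-2-k}e^{-x/x_i},$$ and is defined by the characteristic triple $$\begin{cases}(\psi'(0),\,0,\,\pi_n)_{h\equiv x}, & \text{if } k=1,\\[1mm] \left(\psi'(0),\,\psi''(0)-2\sum_{i=1}^nw_i/x_i,\,\pi_n\right)_{h\equiv x}, & \text{if } k=2.\end{cases}$$ (iii) The functions $\psi^{[n+k/n]}(z)$ converge to $\psi(z)$ exponentially fast on compact subsets of $\mathbb{C}\setminus[\rho,\infty)$ as $n\to\infty$; that is, for every compact $A\subset\mathbb{C}\setminus[\rho,\infty)$ there are $c_1,c_2>0$ such that $|\psi^{[n+k/n]}(z)-\psi(z)|<c_1e^{-c_2n}$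 for all $z\in A$ and all $n\ge1$.
   Context: Lévy processes and triples. For a (real-valued, unkilled) Lévy process $X$, the Laplace exponent is $\psi(z):=\ln\mathbb{E}[e^{zX_1}]$, initially defined for $\mathrm{Re}(z)=0$, and $$\psi(z)=\tfrac{\sigma^2}{2}z^2+az+\int_{\mathbb{R}}\left(e^{zx}-1-zh(x)\right)\Pi(\mathrm{d}x),$$ with $\sigma\ge0$, $a\in\mathbb{R}$, Lévy measure $\Pi$ and cutoff function $h$. Standing assumption: $\Pi(\mathrm{d}x)=\pi(x)\mathrm{d}x$ is absolutely continuous and $\pi(x)$ decreases exponentially fast as $x\to\pm\infty$. The characteristic triple $(a,\sigma^2,\pi)_{h\equiv x}$ means that this formula holds with $h(x)=x$. Jumps are of infinite variation if $\int_{\mathbb{R}}|x|\pi(x)\,\mathrm{d}x=\infty$. Spectrally positive means having no negative jumps. Completely monotone jumps. $X$ has completely monotone jumps if $\pi(x)$ and $\pi(-x)$ are completely monotone functions of $x\in(0,\infty)$; equivalently there is a positive Radon measure $\mu$ on $\mathbb{R}\setminus\{0\}$ with $$\pi(x)=\mathbf{1}_{\{x>0\}}\int_{(0,\infty)}e^{-ux}\mu(\mathrm{d}u)+\mathbf{1}_{\{x<0\}}\int_{(-\infty,0)}e^{-ux}\mu(\mathrm{d}u).$$ Put $\rho:=\sup\{u\ge0:\mu((0,u))=0\}$ and $\hat\rho:=\sup\{u\ge0:\mu((-u,0))=0\}$ (values in $(0,+\infty]$, positive by the standing assumption). $\mathcal{CM}(\hat\rho,\rho)$ is the class of Lévy processes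 with completely monotone jumps (satisfying the standing assumption) with these parameters; $\hat\rho=+\infty$ means there are no negative jumps, i.e. $\mu((-\infty,0))=0$. For $X\in\mathcal{CM}(+\infty,\rho)$, $\psi$ extends analytically to $\mathbb{C}\setminus[\rho,\infty)$, and the extension is also denoted $\psi$. The measure $\mu^*$ is defined by $\mu^*(A)=\mu(\{v\in\mathbb{R}:v^{-1}\in A\})$ for Borel $A\subset\mathbb{R}$; here it is carried by $(0,1/\rho]$, and $v^3\mu^*(\mathrm{d}v)$ is a finite measure. Hyperexponential process. A Lévy process with completely monotone jumps is hyperexponential if its measure $\mu$ has finite support, i.e. its Lévy density is $\mathbf{1}_{\{x>0\}}\sum_{i=1}^N\alpha_ie^{-\beta_ix}+\mathbf{1}_{\{x<0\}}\sum_{i=1}^{\hat N}\hat\alpha_ie^{-\hat\beta_ix}$ with $N,\hat N\ge0$, $\alpha_i,\hat\alpha_i>0$, $\beta_i>0$, $\hat\beta_i<0$ (arbitrary linear drift and Gaussian component are allowed). Gaussian quadrature. For a finite positive measure $\nu$ with infinite support on a bounded interval, the nodes $\{x_i\}_{1\le i\le n}$ (distinct points of the interval) and weights $\{w_i\}_{1\le i\le n}$ (positive) of the Gaussian quadrature of order $n$ are the unique ones satisfying $\int x^k\nu(\mathrm{d}x)=\sum_{i=1}^nx_i^kw_i$ for $k=0,1,\dots,2n-1$. Padé approximant. For a function $f$ with a power series at $0$, if there are polynomials $P_m,Q_n$ with $\deg P_m\le m$, $\deg Q_n\le n$, $Q_n(0)\ne0$ and $P_m(z)/Q_n(z)=f(z)+O(z^{m+n+1})$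 as $z\to0$, then $f^{[m/n]}(z):=P_m(z)/Q_n(z)$ is the $[m/n]$ Padé approximant of $f$ at $0$. *)

(* Defs.v *)
From HB Require Import structures.
From mathcomp Require Import all_boot all_order all_algebra.
From mathcomp Require Import all_classical all_reals all_analysis.
From mathcomp Require Import measurable_realfun.
From mathcomp.real_closed Require Export complex.

Set Implicit Arguments.
Unset Strict Implicit.
Unset Printing Implicit Defensive.

Import Order.TTheory GRing.Theory Num.Theory.
Import numFieldNormedType.Exports.

Local Open Scope classical_set_scope.
Local Open Scope ring_scope.
Local Open Scope complex_scope.

(* [R[i]] carries its topology and norm through the alias [R[i]^o]; the norm
   `|z| is an element of [R[i]], hence the comparisons with [r%:C]. *)

Definition cexp (R : realType) (z : R[i]) : R[i] :=
  let r := expR (complex.Re z) in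
  (r * cos (complex.Im z)) +i* (r * sin (complex.Im z)).

Definition cintegrable d (T : measurableType d) (R : realType)
    (m : {measure set T -> \bar R}) (f : T -> R[i]) : Prop :=
  m.-integrable setT (fun t => (complex.Re (f t))%:E) /\
  m.-integrable setT (fun t => (complex.Im (f t))%:E).

Definition cintegral d (T : measurableType d) (R : realType)
    (m : {measure set T -> \bar R}) (f : T -> R[i]) : R[i] :=
  Rintegral m setT (fun t => complex.Re (f t)) +i*
  Rintegral m setT (fun t => complex.Im (f t)).

Definition analytic_on (R : realType) (D : set R[i]) (f : R[i] -> R[i]) : Prop :=
  forall z0, D z0 -> exists (c : nat -> R[i]) (r : R), 0 < r /\
    forall z, `|z - z0| < r%:C ->
      (series (fun k => c k * (z - z0) ^+ k) : nat -> R[i]^o) @ \oo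
        --> (f z : R[i]^o).

(* [C \ [rho, +oo)] *)
Definition slit_plane (R : realType) (rho : \bar R) : set R[i] :=
  [set z | ~ (complex.Im z = 0 /\ (rho <= (complex.Re z)%:E)%E)].

(* A family indexed by [R] of which only the times [t >= 0] are relevant.
   The regularity requirement is stochastic continuity. *)
Definition levy_process d (Omega : measurableType d) (R : realType)
    (P : probability Omega R) (X : R -> {RV P >-> R}) : Prop :=
  [/\ {ae P, forall w, X 0 w = 0},
      (forall (m : nat) (t : nat -> R) (B : nat -> set R),
         0 <= t 0%N -> (forall i, t i <= t i.+1) ->
         (forall i, measurable (B i)) ->
         P [set w | forall i, (i < m)%N -> B i (X (t i.+1) w - X (t i) w)] =
         (\prod_(i < m) P [set w | B i (X (t i.+1) w - X (t i) w)%R])%E),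
      (forall s t : R, 0 <= s -> 0 <= t -> forall B : set R, measurable B ->
         P [set w | B (X (s + t) w - X s w)] = P [set w | B (X t w)]) &
      (forall s e : R, 0 <= s -> 0 < e ->
         (fun t => P [set w | e < `|X t w - X s w|])
           @ within [set t | 0 <= t] (nbhs s) --> 0%E)].

(* [psi (i u) = ln E[exp (i u X_1)]], where [ln] is the logarithm that is
   continuous in [u] and vanishes at [u = 0]. *)
Definition laplace_exponent d (Omega : measurableType d) (R : realType)
    (P : probability Omega R) (X : R -> {RV P >-> R}) (psi : R[i] -> R[i]) :
    Prop :=
  [/\ psi 0 = 0,
      continuous (fun u : R => psi (u *i) : R[i]^o) &
      forall u : R,
        cintegral P (fun w => cexp (u *i * (X 1 w)%:C)) = cexp (psi (u *i))].

Definition levy_density (R : realType) (pi : R -> R) : Prop :=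
  [/\ measurable_fun setT pi,
      (forall x, 0 <= pi x) &
      (\int[lebesgue_measure]_x (Num.min 1 (x ^+ 2) * pi x)%:E < +oo)%E].

Definition lk_integrand (R : realType) (pi h : R -> R) (z : R[i]) (x : R) :
    R[i] :=
  (cexp (z * x%:C) - 1 - z * (h x)%:C) * (pi x)%:C.

(* The characteristic triple [(a, s2, pi)_h]; [s2] is the Gaussian variance
   [sigma ^ 2]. *)
Definition characteristic_triple (R : realType) (psi : R[i] -> R[i])
    (a s2 : R) (pi h : R -> R) : Prop :=
  [/\ 0 <= s2, levy_density pi,
      (forall u : R, cintegrable lebesgue_measure (lk_integrand pi h (u *i))) &
      forall u : R, let z := u *i in
        psi z = (s2 / 2)%:C * z ^+ 2 + a%:C * z +
                cintegral lebesgue_measure (lk_integrand pi h z)].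

Definition exp_decay (R : realType) (pi : R -> R) : Prop :=
  exists c K M : R, 0 < c /\
    forall x, M <= `|x| -> pi x <= K * expR (- (c * `|x|)).

Definition infinite_variation (R : realType) (pi : R -> R) : Prop :=
  (\int[lebesgue_measure]_x (`|x| * pi x)%:E = +oo)%E.

Definition spectrally_positive (R : realType) (pi : R -> R) : Prop :=
  (\int[lebesgue_measure]_(x in `]-oo, 0%R[) (pi x)%:E = 0)%E.

(* A positive Radon measure on [R \ {0}] is represented by a measure on [R]
   that does not charge [0]. *)
Definition cm_jumps (R : realType) (pi : R -> R)
    (mu : {measure set R -> \bar R}) : Prop :=
  [/\ mu [set 0] = 0%E,
      (forall K : set R, compact K -> ~ K 0 -> (mu K < +oo)%E) &
      forall x : R, (pi x)%:E =
        ((\1_(`]0%R, +oo[%classic : set R) x)%:E *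
           \int[mu]_(u in `]0%R, +oo[) (expR (- (u * x)))%:E +
         (\1_(`]-oo, 0%R[%classic : set R) x)%:E *
           \int[mu]_(u in `]-oo, 0%R[) (expR (- (u * x)))%:E)%E].

Definition cm_rho (R : realType) (mu : set R -> \bar R) : \bar R :=
  ereal_sup [set u%:E | u in [set u : R | 0 <= u /\ mu `]0, u[%classic = 0%E]].

Definition cm_rho_hat (R : realType) (mu : set R -> \bar R) : \bar R :=
  ereal_sup
    [set u%:E | u in [set u : R | 0 <= u /\ mu `](- u), 0[%classic = 0%E]].

(* The conditions on the Levy density [pi], with representing measure [mu],
   for the process to be in [CM(rho_hat, rho)]. *)
Definition CM (R : realType) (pi : R -> R) (mu : {measure set R -> \bar R})
    (rho_hat rho : \bar R) : Prop :=
  [/\ exp_decay pi, cm_jumps pi mu, cm_rho_hat mu = rho_hat & cm_rho mu = rho].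

Definition hyperexponential_density (R : realType) (pi : R -> R) : Prop :=
  exists (N N' : nat) (al be : 'I_N -> R) (al' be' : 'I_N' -> R),
    [/\ (forall i, 0 < al i), (forall i, 0 < be i),
        (forall i, 0 < al' i), (forall i, be' i < 0) &
        forall x, pi x =
          \1_(`]0, +oo[%classic : set R) x *
            (\sum_(i < N) al i * expR (- (be i * x))) +
          \1_(`]-oo, 0[%classic : set R) x *
            (\sum_(i < N') al' i * expR (- (be' i * x)))].

Definition hyperexponential_process d (Omega : measurableType d)
    (R : realType) (P : probability Omega R) (X : R -> {RV P >-> R}) : Prop :=
  levy_process X /\
  exists (psi : R[i] -> R[i]) (a s2 : R) (pi : R -> R),
    [/\ laplace_exponent X psi, characteristic_triple psi a s2 pi (fun x => x) &
        hyperexponential_density pi].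

Lemma measurable_fun_invr (R : realType) :
  measurable_fun [set: R] (fun v : R => v^-1).
Proof.
rewrite -(setUv [set (0 : R)]).
apply/(measurable_funU _ (measurable_set1 0) (measurableC (measurable_set1 0))).
split; first exact: measurable_fun_set1.
apply: open_continuous_measurable_fun.
  by rewrite openC; exact: closed_eq.
move=> v; rewrite inE => /eqP v0; exact: inv_continuous.
Qed.

(* The convention [0^-1 = 0] is harmless when [mu] does not charge [0]. *)
Definition mu_star (R : realType) (mu : {measure set R -> \bar R}) :
  set R -> \bar R := pushforward mu (fun v : R => v^-1).

(* [(0, 1/rho]]; here [+oo^-1 = 0]. *)
Definition node_interval (R : realType) (rho : \bar R) : set R :=
  [set v | 0 < v /\ (v%:E <= rho^-1)%E].

Section mu_star_measure.
Context (R : realType) (mu : {measure set R -> \bar R}).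

Let mu_star0 : mu_star mu set0 = 0%E.
Proof. by rewrite /mu_star /pushforward preimage_set0 measure0. Qed.

Let mu_star_ge0 A : (0 <= mu_star mu A)%E.
Proof. exact: (measure_ge0 mu). Qed.

Let mu_star_sigma_additive : semi_sigma_additive (mu_star mu).
Proof.
move=> F mF tF mUF; rewrite /mu_star /pushforward preimage_bigcup.
have mf A : measurable A -> measurable ((fun v : R => v^-1) @^-1` A).
  by move=> mA; rewrite -[X in measurable X]setTI; exact: measurable_fun_invr.
apply: measure_semi_sigma_additive.
- by move=> n; exact: mf.
- apply/trivIsetP => /= i j _ _ ij; rewrite -preimage_setI.
  by move/trivIsetP : tF => /(_ _ _ _ _ ij) ->//; rewrite preimage_set0.
- by rewrite -preimage_bigcup; exact: mf.
Qed.

HB.instance Definition _ := isMeasure.Build _ _ _ (mu_star mu)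
  mu_star0 mu_star_ge0 mu_star_sigma_additive.

End mu_star_measure.

(* The measure [v^p mu^*(dv)] on [(0, 1/rho]]. *)
Definition weighted_mu_star (R : realType) (mu : {measure set R -> \bar R})
    (rho : \bar R) (p : nat) : set R -> \bar R :=
  fun A => (\int[mu_star mu]_(v in A) (v ^+ p * \1_(node_interval rho) v)%:E)%E.

Section weighted_mu_star_measure.
Context (R : realType) (mu : {measure set R -> \bar R}) (rho : \bar R).
Variable p : nat.

Let weight_ge0 (v : R) : 0 <= v ^+ p * \1_(node_interval rho) v.
Proof.
rewrite indicE; case: (boolP (v \in _)); last by rewrite mulr0.
by rewrite inE => -[/ltW v0 _]; rewrite mulr1 exprn_ge0.
Qed.

Let measurable_node_interval : measurable (node_interval rho).
Proof.
have -> : node_interval rho = `]0, +oo[%classic `&`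
    ((fun v : R => v%:E) @^-1` `]-oo, (rho^-1)%E]%classic).
  by apply/seteqP; split=> v; rewrite /node_interval /= !in_itv/= andbT.
apply: measurableI => //; rewrite -[X in measurable X]setTI.
by apply: EFin_measurable => //; exact: emeasurable_itv.
Qed.

Let measurable_weight :
  measurable_fun [set: R] (fun v => (v ^+ p * \1_(node_interval rho) v)%:E).
Proof.
apply/measurable_EFinP; apply: measurable_funM; first exact: exprn_measurable.
exact: measurable_indic.
Qed.

Let weighted0 : weighted_mu_star mu rho p set0 = 0%E.
Proof. by rewrite /weighted_mu_star integral_set0. Qed.

Let weighted_ge0 A : (0 <= weighted_mu_star mu rho p A)%E.
Proof. by apply: integral_ge0 => v _; rewrite lee_fin. Qed.

Let weighted_sigma_additive : semi_sigma_additive (weighted_mu_star mu rho p).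
Proof.
by apply: semi_sigma_additive_nng_induced => // v; rewrite lee_fin.
Qed.

HB.instance Definition _ := isMeasure.Build _ _ _ (weighted_mu_star mu rho p)
  weighted0 weighted_ge0 weighted_sigma_additive.

End weighted_mu_star_measure.

Definition gaussian_quadrature (R : realType) (nu : {measure set R -> \bar R})
    (D : set R) (n : nat) (x w : 'I_n -> R) : Prop :=
  [/\ (forall i, D (x i)), injective x, (forall i, 0 < w i) &
      forall j : nat, (j < 2 * n)%N ->
        (\int[nu]_(v in D) (v ^+ j)%:E)%E = (\sum_(i < n) x i ^+ j * w i)%:E].

(* The fraction is taken in lowest terms, so that its value at a point that is
   not a pole is [P.[z] / Q.[z]] in spite of the convention [x / 0 = 0]. *)
Definition is_pade (R : realType) (m n : nat) (f : R[i] -> R[i])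
    (PQ : {poly R[i]} * {poly R[i]}) : Prop :=
  let: (P, Q) := PQ in
  [/\ (size P <= m.+1)%N, (size Q <= n.+1)%N, Q.[0] != 0, coprimep P Q &
      exists K r : R, 0 < r /\ forall z : R[i], `|z| < r%:C ->
        `|P.[z] / Q.[z] - f z| <= K%:C * `|z| ^+ (m + n + 1)].

(* [f^[m/n]]; a junk value if there is no Pade approximant. *)
Definition pade (R : realType) (m n : nat) (f : R[i] -> R[i]) (z : R[i]) :
    R[i] :=
  let PQ := xget (0, 1) [set PQ | is_pade m n f PQ] in PQ.1.[z] / PQ.2.[z].

Definition pade_levy_density (R : realType) (k n : nat) (x w : 'I_n -> R)
    (y : R) : R :=
  \1_(`]0, +oo[%classic : set R) y *
    \sum_(i < n) w i * x i ^- (2 + k) * expR (- (y / x i)).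

(* Main.v *)
Require Import Defs.
From HB Require Import structures.
From mathcomp Require Import all_boot all_order all_algebra.
From mathcomp Require Import all_classical all_reals all_analysis.
From mathcomp Require Import measurable_realfun.
From mathcomp Require Import ring lra.
From mathcomp.real_closed Require Import complex.

Set Implicit Arguments.
Unset Strict Implicit.
Unset Printing Implicit Defensive.

Import Order.TTheory GRing.Theory Num.Theory.
Import numFieldNormedType.Exports.
Import Normc.

Local Open Scope classical_set_scope.
Local Open Scope ring_scope.
Local Open Scope complex_scope.

(** Let [F_p z] be the integral of [v^p mu^*(dv) / (1 - z v)] over [(0, 1/rho]]
    ([stieltjes] of [weighted_mu_star]). Tonelli's theorem for the mixture of
    exponentials [pi] gives [psi z = a z + z^2 F_3 z] on the upper imaginary axis, and
    analyticity gives it on the slit plane ([psi_stieltjes]). Since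
    [F_3 z = F_3 0 + z F_4 z] ([stieltjes_shift]), in both cases
    [psi z = g z + z^(k+1) F_(2+k) z], where [g] is the Taylor polynomial of
    degree [k] of [psi] at [0].

    The approximant in (i) is [g] plus [z^(k+1)] times the quadrature of the
    kernel [1 / (1 - z v)]. The quadrature error is estimated by expanding the
    kernel in powers of [v - c], where the truncation at degree [2 n - 1] is
    integrated exactly ([quadrature_error]). With [c = 0] the error is
    [O(z^(2n))], so that the approximant satisfies the defining property of the
    Pade approximant, which is unique ([pade_quadrature_is_pade],
    [is_pade_unique]). For [z] in the slit plane there is a complex [c] for which
    the expansion converges geometrically, uniformly in [v] in [[0, 1/rho]] and
    locally uniformly in [z] ([slit_kernel_geometry]); compactness then gives
    (iii) ([pade_quadrature_convergence]).

    For (ii), the Levy-Khintchine integral of an exponential density is a rational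
    function ([cintegral_lk_exponential]), and partial fractions identify the
    triple. When [k = 2], the Gaussian coefficient is nonnegative because the sum
    of the [w_i / x_i] is the integral, by exactness of the quadrature, of a
    polynomial below [1 / v] that touches it at the nodes ([reciprocal_minorant]).

    It remains to construct a Levy process with a hyperexponential exponent.
    Convolving a drift, a Gaussian and compound Poisson semigroups gives its
    marginals ([hyperexponential_levy_process]); their characteristic functions
    at time [1] follow from the expansions at time [1 / n] ([eq_cexp_of_roots]).
    A process with given marginals exists by [levy_process_existence]. On
    finitely many times it is built by adding independent increments. An
    increment is coded by the set of rationals below it, so that a process
    becomes a random family of bits; the laws of the bits for finite sets of
    times have a limit along an ultrafilter, which is countably additive because
    Cantor space is compact ([increment_bits_measure]). Decoding the bits gives
    increments with the right joint laws, almost surely additive. *)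

(** * Complex modulus and exponential *)

Section complex_norm.
Context (R : realType).
Implicit Types (z w a b : R[i]) (x y : R).

Lemma normcE_norm z : `|z| = (normc z)%:C. Proof. by []. Qed.

Lemma normc_ge0 z : 0 <= normc z.
Proof. by case: z => x y; exact: sqrtr_ge0. Qed.

Lemma normcD_le z w : normc (z + w) <= normc z + normc w.
Proof. by rewrite -lecR rmorphD /=; exact: (ler_normD z w). Qed.

Lemma normcNE z : normc (- z) = normc z.
Proof. by apply: (@complexI R); exact: (normrN z). Qed.

Lemma normcB_le z w : normc (z - w) <= normc z + normc w.
Proof. by rewrite -(normcNE w) normcD_le. Qed.

Lemma normcBC z w : normc (z - w) = normc (w - z).
Proof. by rewrite -normcNE opprB. Qed.

Lemma lerB_normc z w : normc z - normc w <= normc (z + w).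
Proof. by rewrite lerBlDr -(normcNE w); apply: le_trans (normcD_le _ _); rewrite addrK. Qed.

Lemma normcX z n : normc (z ^+ n) = normc z ^+ n.
Proof. by elim: n => [|n IH]; rewrite ?expr0 ?normc1// !exprS normcM IH. Qed.

Lemma normc_eq0 z : (normc z == 0) = (z == 0).
Proof. by apply/eqP/eqP => [/eq0_normc|->]; rewrite ?normc0. Qed.

Lemma normc_gt0 z : (0 < normc z) = (z != 0).
Proof. by rewrite lt0r normc_ge0 andbT normc_eq0. Qed.

Lemma normc_real x : normc x%:C = `|x|.
Proof. by rewrite /= expr0n /= addr0 sqrtr_sqr. Qed.

Lemma normc_nat n : normc (n%:R : R[i]) = n%:R.
Proof. by rewrite -(rmorph_nat (real_complex R)) normc_real normr_nat. Qed.

Lemma normc_sum_le (I : Type) (s : seq I) (P : pred I) (F : I -> R[i]) :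
  normc (\sum_(i <- s | P i) F i) <= \sum_(i <- s | P i) normc (F i).
Proof.
elim/big_ind2 : _ => [|z x w y zx wy|//]; first by rewrite normc0.
by apply: le_trans (normcD_le _ _) _; exact: lerD.
Qed.

Lemma Re_le_normc z : `|complex.Re z| <= normc z.
Proof. by case: z => x y /=; rewrite -sqrtr_sqr ler_wsqrtr// lerDl sqr_ge0. Qed.

Lemma Im_le_normc z : `|complex.Im z| <= normc z.
Proof. by case: z => x y /=; rewrite -sqrtr_sqr ler_wsqrtr// lerDr sqr_ge0. Qed.

Lemma normc_le_add z : normc z <= `|complex.Re z| + `|complex.Im z|.
Proof.
case: z => x y /=; rewrite -[leRHS]ger0_norm ?addr_ge0// -sqrtr_sqr ler_wsqrtr//.
by rewrite sqrrD !real_normK ?num_real// -addrA lerD2l lerDr mulrn_wge0// mulr_ge0.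
Qed.

Lemma normc_sqr z : normc z ^+ 2 = complex.Re z ^+ 2 + complex.Im z ^+ 2.
Proof. by case: z => x y; rewrite sqr_sqrtr ?addr_ge0 ?sqr_ge0. Qed.

(** Telescoping the difference of powers. *)
Lemma normc_sub_exp_le a b n : normc a <= 1 -> normc b <= 1 ->
  normc (a ^+ n - b ^+ n) <= n%:R * normc (a - b).
Proof.
move=> a1 b1; elim: n => [|n IH]; first by rewrite !expr0 subrr normc0 mul0r.
have -> : a ^+ n.+1 - b ^+ n.+1 = a * (a ^+ n - b ^+ n) + (a - b) * b ^+ n.
  by rewrite !exprS; ring.
apply: le_trans (normcD_le _ _) _; rewrite !normcM -addn1 natrD mulrDl mul1r lerD//.
- by rewrite -[leRHS]mul1r ler_pM ?normc_ge0.
- by rewrite -[leRHS]mulr1 ler_wpM2l ?normc_ge0// normcX exprn_ile1 ?normc_ge0.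
Qed.

Lemma normc_cexp z : normc (cexp z) = expR (complex.Re z).
Proof.
by rewrite /cexp /= !exprMn -mulrDr cos2Dsin2 mulr1 sqrtr_sqr ger0_norm ?expR_ge0.
Qed.

Lemma cexpD z w : cexp (z + w) = cexp z * cexp w.
Proof.
case: z w => [? ?] [? ?]; apply/eqP; rewrite eq_complex /= expRD cosD sinD.
by apply/andP; split; apply/eqP; ring.
Qed.

Lemma cexpMn z n : cexp (z *+ n) = cexp z ^+ n.
Proof.
elim: n => [|n IH]; last by rewrite mulrS cexpD IH exprS.
by rewrite mulr0n expr0 /cexp /= expR0 cos0 sin0 mulr1 mulr0.
Qed.

Lemma cexp_imaginary y : cexp (y *i) = cos y +i* sin y.
Proof. by rewrite /cexp /= expR0 !mul1r. Qed.

Lemma mul_imaginary_real y x : y *i * x%:C = (y * x) *i.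
Proof. by apply/eqP; rewrite eq_complex /= !mul0r !mulr0 subr0 add0r !eqxx. Qed.

End complex_norm.

(** * Power series and uniqueness from a half-axis *)

Section complex_limits.
Context (R : realType).
Implicit Types (f : R[i] -> R[i]) (c : nat -> R[i]) (D : set R[i]).

Lemma cvg_normcP (T : Type) (F : set_system T) (FF : Filter F) (g : T -> R[i]^o) (l : R[i]^o) :
  g @ F --> l <-> forall e : R, 0 < e -> \forall x \near F, normc (g x - l) < e.
Proof.
split=> [gl e e0|gl].
  have e0' : 0 < e%:C :> R[i] by rewrite ltcR.
  have /cvgrPdist_lt/(_ _ e0') := gl; apply: filterS => x.
  by rewrite normcE_norm ltcR normcBC.
apply/cvgrPdist_lt => e e0.
have /gl : 0 < complex.Re e by move: e0; rewrite ltcE => /andP[].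
apply: filterS => x; rewrite normcBC normcE_norm.
by move: e0; case: e => x1 x2; rewrite !ltcE /= => /andP[/eqP -> _] ->; rewrite eqxx.
Qed.

Lemma normc_limit_le (g : nat -> R[i]^o) (l : R[i]^o) (a : R[i]) (M : R) :
  g @ \oo --> l -> (\forall n \near \oo, normc (g n - a) <= M) -> normc (l - a) <= M.
Proof.
move=> /cvg_normcP gl gM; apply/ler_addgt0Pr => e e0.
have [n [gn gMn]] : exists n, normc (g n - l) < e /\ normc (g n - a) <= M.
  by apply: (@filter_ex _ \oo _); apply: filterI => //; exact: gl.
have -> : l - a = (g n - a) - (g n - l) by ring.
apply: le_trans (normcB_le _ _) _; exact: lerD (ltW gn).
Qed.

Lemma cvg_geometric_normc (g : nat -> R[i]^o) (l : R[i]^o) (C r : R) : 0 <= r < 1 ->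
  (forall n, normc (g n - l) <= C * r ^+ n) -> g @ \oo --> l.
Proof.
move=> /andP[r0 r1] gC; apply/cvg_normcP => e e0.
have : C * r ^+ n @[n --> \oo] --> (C * 0 : R).
  by apply: cvgM; [exact: cvg_cst|apply: cvg_expr; rewrite ger0_norm].
rewrite mulr0 => /cvgrPdist_lt/(_ _ e0); apply: filterS => n.
rewrite sub0r normrN => /(le_lt_trans (ler_norm _)); exact: le_lt_trans.
Qed.

Lemma seriesE_ord c (z : R[i]) n :
  series (fun k => c k * z ^+ k) n = \sum_(k < n) c k * z ^+ k.
Proof. by rewrite /series /= big_mkord. Qed.

(** Convergence at one point at distance [r / 2] bounds the coefficients, so that on
    a smaller disk the remainder is dominated by a geometric series. *)
Lemma taylor_remainder f c (z0 : R[i]) (r : R) : 0 < r ->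
  (forall z, `|z - z0| < r%:C ->
    (series (fun k => c k * (z - z0) ^+ k) : nat -> R[i]^o) @ \oo --> (f z : R[i]^o)) ->
  forall m, exists K s : R, [/\ 0 < s, 0 <= K & forall z, normc (z - z0) < s ->
    normc (f z - \sum_(k < m) c k * (z - z0) ^+ k) <= K * normc (z - z0) ^+ m].
Proof.
move=> r0 fc m; pose h1 : R[i] := (r / 2)%:C.
have r20 : 0 < r / 2 by rewrite divr_gt0.
have nh1 : normc h1 = r / 2 by rewrite normc_real gtr0_norm.
have [B [B0 cB]] : exists B : R, 0 <= B /\ forall k, normc (c k) * (r / 2) ^+ k <= B.
  have fz1 : `|(z0 + h1) - z0| < r%:C.
    by rewrite addrC addKr normcE_norm ltcR nh1 ltr_pdivrMr// mulr_natr mulr2n ltrDl.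
  have := fc _ fz1; rewrite addrC addKr => /cvg_normcP/(_ 1 ltr01).
  move=> [N _ HN].
  pose S n := series (fun k => c k * h1 ^+ k) n : R[i].
  have big k : (N <= k)%N -> normc (c k) * (r / 2) ^+ k <= 2.
    move=> Nk; rewrite -nh1 -normcX -normcM.
    have -> : c k * h1 ^+ k = (S k.+1 - f (z0 + h1)) - (S k - f (z0 + h1)).
      by rewrite /S !seriesE_ord big_ord_recr /=; ring.
    apply: le_trans (normcB_le _ _) _; rewrite -[2]/(1 + 1) lerD// ltW//.
      by apply: HN => /=; rewrite leqW.
    exact: HN.
  exists (2 + \sum_(k < N) normc (c k) * (r / 2) ^+ k).
  have s0 : 0 <= \sum_(k < N) normc (c k) * (r / 2) ^+ k.
    by apply: sumr_ge0 => k _; rewrite mulr_ge0 ?normc_ge0// exprn_ge0// ltW.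
  split=> [|k]; first by rewrite addr_ge0.
  have [Nk|kN] := leqP N k; first by rewrite (le_trans (big k Nk))// lerDl.
  rewrite (bigD1 (Ordinal kN))//= addrCA lerDl addr_ge0// sumr_ge0// => i _.
  by rewrite mulr_ge0 ?normc_ge0// exprn_ge0// ltW.
exists (2 * B * (2 / r) ^+ m), (r / 4); split; first by rewrite divr_gt0.
  by rewrite !mulr_ge0 ?exprn_ge0 ?divr_ge0// ltW.
move=> z zr; set h := z - z0; rewrite -/h in zr.
have hr : `|z - z0| < r%:C.
  rewrite normcE_norm ltcR (lt_trans zr)// ltr_pdivrMr// ltr_pMr//; by rewrite ltr1n.
pose q := normc h * (2 / r).
have q0 : 0 <= q by rewrite mulr_ge0 ?normc_ge0// divr_ge0// ltW.
have q2 : q <= 1 / 2.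
  by rewrite /q mulrA ler_pdivrMr// mulrC; move: zr; rewrite -/h => zr; lra.
have term k : normc (c k * h ^+ k) <= B * q ^+ k.
  rewrite normcM normcX /q exprMn mulrCA.
  have -> : normc (c k) * normc h ^+ k = normc h ^+ k * (normc (c k) * (r / 2) ^+ k * (2 / r) ^+ k).
    rewrite -!mulrA -exprMn (_ : r / 2 * (2 / r) = 1) ?expr1n ?mulr1 1?mulrC//.
    by field; rewrite gt_eqF.
  rewrite ler_wpM2l ?exprn_ge0 ?normc_ge0// ler_wpM2r//.
  by rewrite exprn_ge0// divr_ge0// ltW.
have -> : 2 * B * (2 / r) ^+ m * normc h ^+ m = 2 * B * q ^+ m.
  by rewrite /q [in RHS]exprMn [normc h ^+ m * _]mulrC [in RHS]mulrA.
apply: normc_limit_le (fc _ hr) _; exists m => // n /= mn.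
rewrite seriesE_ord -/h -(subnKC mn) big_split_ord /= addrAC subrr add0r.
have geo j : \sum_(i < j) q ^+ i <= 2 - 2 * q ^+ j.
  elim: j => [|j IH]; first by rewrite big_ord0 expr0; lra.
  rewrite big_ord_recr /= exprS; apply: le_trans (lerD IH (lexx _)) _.
  have : 0 <= q ^+ j by exact: exprn_ge0.
  by move: (q ^+ j) => p p0; nra.
apply: le_trans (normc_sum_le _ _ _) _.
apply: (@le_trans _ _ (\sum_(i < n - m) B * q ^+ m * q ^+ i)).
  by apply: ler_sum => i _; rewrite -mulrA -exprD; exact: term.
have Bq : 0 <= B * q ^+ m by rewrite mulr_ge0 ?exprn_ge0.
have -> : 2 * B * q ^+ m = B * q ^+ m * 2 by ring.
rewrite -mulr_sumr ler_wpM2l//.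
by apply: le_trans (geo _) _; rewrite gerBl mulr_ge0 ?exprn_ge0.
Qed.

(** The first nonzero term would dominate near [z0] and exclude zeros there. *)
Lemma power_series_zero f c (z0 : R[i]) (r : R) : 0 < r ->
  (forall z, `|z - z0| < r%:C ->
    (series (fun k => c k * (z - z0) ^+ k) : nat -> R[i]^o) @ \oo --> (f z : R[i]^o)) ->
  (forall e : R, 0 < e -> exists z, [/\ z != z0, normc (z - z0) < e & f z = 0]) ->
  forall z, normc (z - z0) < r -> f z = 0.
Proof.
move=> r0 fc zeros.
have c0 k : c k = 0.
  elim/ltn_ind: k => k IH.
  have [K [s [s0 K0 fK]]] := taylor_remainder r0 fc k.+1.
  apply/eqP; rewrite -normc_eq0 eq_le normc_ge0 andbT; apply/ler_addgt0Pr => e e0.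
  rewrite add0r.
  have e1 : 0 < Num.min s (e / (K + 1)) by rewrite lt_min s0 divr_gt0// ltr_wpDl.
  have [z [zz0 + fz]] := zeros _ e1; rewrite lt_min => /andP[zs ze].
  have := fK _ zs; rewrite fz sub0r normcNE big_ord_recr /= big1 ?add0r; last first.
    by move=> i _; rewrite IH// mul0r.
  have hp : 0 < normc (z - z0) by rewrite normc_gt0 subr_eq0.
  rewrite normcM normcX exprS [K * _]mulrA ler_pM2r ?exprn_gt0// => /le_trans; apply.
  move: ze; rewrite ltr_pdivlMr ?ltr_wpDl// => ze.
  apply: le_trans (ltW ze); rewrite mulrC ler_wpM2l ?normc_ge0//; by rewrite lerDl.
move=> z zr; have zr' : `|z - z0| < r%:C by rewrite normcE_norm ltcR.
apply/eqP; rewrite -normc_eq0 eq_le normc_ge0 andbT -[f z]subr0.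
apply: normc_limit_le (fc _ zr') _; near=> n.
by rewrite seriesE_ord big1 ?subrr ?normc0// => i _; rewrite c0 mul0r.
Unshelve. all: by end_near. Qed.

(** The zeros on the half-axis accumulate at the origin. From there vanishing
    propagates along each segment: the first point where it would stop is a limit
    of zeros, and [power_series_zero] carries it further. *)
Lemma identity_theorem (D : set R[i]) f : analytic_on D f ->
  (forall z (t : R), D z -> 0 <= t <= 1 -> D (t%:C * z)) ->
  (forall u : R, 0 <= u -> f (u *i) = 0) -> forall z, D z -> f z = 0.
Proof.
move=> fD star f0 z Dz.
have f00 : f 0 = 0 by exact: (f0 0 (lexx 0)).
have [->//|z0] := eqVneq z 0.
have nz0 : 0 < normc z by rewrite normc_gt0.
pose T := [set t : R | 0 <= t <= 1 /\ forall s, 0 <= s <= t -> f (s%:C * z) = 0].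
have ext t0 : 0 <= t0 <= 1 -> (forall s, 0 <= s < t0 -> f (s%:C * z) = 0) ->
    exists2 d : R, 0 < d & forall s, `|s - t0| < d -> f (s%:C * z) = 0.
  move=> t01 ft0; have [c [r [r0 fc]]] := fD _ (star _ _ Dz t01).
  (* zeros come from the half-axis if [t0 = 0], else from the segment before [t0] *)
  have zeros (e : R) : 0 < e ->
      exists w, [/\ w != t0%:C * z, normc (w - t0%:C * z) < e & f w = 0].
    move=> e0; have /andP[t00 _] := t01; have [t0E|t0N] := eqVneq t0 0.
      exists ((e / 2) *i); split; last by apply: f0; rewrite divr_ge0// ltW.
      - rewrite t0E mul0r eq_complex /= eqxx /= gt_eqF// divr_gt0//.
      - rewrite t0E mul0r subr0 /= expr0n /= add0r sqrtr_sqr gtr0_norm ?divr_gt0//.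
        by rewrite ltr_pdivrMr// mulr_natr mulr2n ltrDl.
    have t0p : 0 < t0 by rewrite lt0r t0N.
    pose d := Num.min (t0 / 2) (e / 2 / normc z).
    have d0 : 0 < d by rewrite lt_min !divr_gt0.
    have dt : d < t0.
      by rewrite gt_min ltr_pdivrMr// mulr_natr mulr2n ltrDl t0p.
    have E : (t0 - d)%:C * z - t0%:C * z = (- d)%:C * z by rewrite -mulrBl -rmorphB /= addrAC subrr add0r.
    exists ((t0 - d)%:C * z); split.
    - by rewrite -subr_eq0 E mulf_neq0// -(rmorph0 (real_complex R)) (inj_eq (@complexI R)) oppr_eq0 gt_eqF.
    - rewrite E normcM normc_real normrN gtr0_norm// -ltr_pdivlMr//.
      rewrite gt_min; apply/orP; right; rewrite ltr_pM2r ?invr_gt0//.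
      by rewrite ltr_pdivrMr// mulr_natr mulr2n ltrDl.
    - by apply: ft0; rewrite subr_ge0 ltW//= gtrBl.
  exists (r / normc z); first by rewrite divr_gt0.
  move=> s st; apply: (power_series_zero r0 fc zeros).
  by rewrite -mulrBl -rmorphB /= normcM normc_real -ltr_pdivlMr.
have T0 : T 0.
  split=> [|s]; first by rewrite lexx ler01.
  by rewrite -eq_le => /eqP <-; rewrite mul0r.
have supT : has_sup T by split; [exists 0|exists 1 => t [/andP[]]].
pose t0 := sup T.
have [_ ubT] := supT; have subT := ub_le_sup ubT.
have t00 : 0 <= t0 by exact: subT.
have t01 : t0 <= 1 by apply: ge_sup; [exists 0|move=> t [/andP[]]].
have below s : 0 <= s < t0 -> f (s%:C * z) = 0.
  move=> /andP[s0 st]; have st' : 0 < t0 - s by rewrite subr_gt0.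
  have [t [_ Tt]] := sup_adherent st' supT.
  by rewrite opprB addrC subrK => lt; apply: Tt; rewrite s0 ltW.
have [d d0 fd] := ext t0 (introT andP (conj t00 t01)) below.
have all1 t : 0 <= t -> t < t0 + d -> f (t%:C * z) = 0.
  move=> tp td; have [tt0|t0t] := ltP t t0; first by apply: below; rewrite tp.
  by apply: fd; rewrite ger0_norm ?subr_ge0// ltrBlDl.
suff t1 : 1 < t0 + d by rewrite -[z]mul1r -(rmorph1 (real_complex R)); apply: all1.
rewrite ltNge; apply/negP => td1.
have : T (t0 + d / 2).
  have dd : d / 2 < d by rewrite ltr_pdivrMr// mulr_natr mulr2n ltrDl.
  have t1 : t0 + d / 2 <= 1 by apply: le_trans td1; rewrite lerD2l ltW.
  have t2 : 0 <= t0 + d / 2 by rewrite addr_ge0// divr_ge0// ltW.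
  split; first by rewrite t1 t2.
  move=> s /andP[s0 st]; apply: all1 => //; apply: le_lt_trans st _.
  by rewrite ltrD2l.
move=> /subT; rewrite -/t0 gerDl leNgt divr_gt0//.
Qed.

End complex_limits.

(** * Integrals of complex-valued functions *)

Section complex_integral.
Context (R : realType) (M : {measure set R -> \bar R}).
Hypothesis Mfin : (M setT < +oo)%E.
Implicit Types (f g : R -> R[i]).

Definition cmeasurable f : Prop :=
  measurable_fun setT (fun v => complex.Re (f v)) /\
  measurable_fun setT (fun v => complex.Im (f v)).

Lemma cmeasurable_real (f : R -> R) : measurable_fun setT f ->
  cmeasurable (fun v => (f v)%:C).
Proof. by []. Qed.

Lemma cmeasurable_cst (z : R[i]) : cmeasurable (fun=> z).
Proof. by split; exact: measurable_cst. Qed.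

Lemma cmeasurableD f g : cmeasurable f -> cmeasurable g -> cmeasurable (fun v => f v + g v).
Proof.
move=> [fr fi] [gr gi]; split.
- rewrite (_ : (fun v => _) = (fun v => complex.Re (f v) + complex.Re (g v))).
    exact: measurable_funD.
  by apply/funext => v; case: (f v) (g v) => ? ? [? ?].
- rewrite (_ : (fun v => _) = (fun v => complex.Im (f v) + complex.Im (g v))).
    exact: measurable_funD.
  by apply/funext => v; case: (f v) (g v) => ? ? [? ?].
Qed.

Lemma cmeasurableM f g : cmeasurable f -> cmeasurable g -> cmeasurable (fun v => f v * g v).
Proof.
move=> [fr fi] [gr gi]; split.
- rewrite (_ : (fun v => _) = (fun v => complex.Re (f v) * complex.Re (g v)
      - complex.Im (f v) * complex.Im (g v))).
    by apply: measurable_funB; exact: measurable_funM.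
  by apply/funext => v; case: (f v) (g v) => ? ? [? ?].
- rewrite (_ : (fun v => _) = (fun v => complex.Re (f v) * complex.Im (g v)
      + complex.Im (f v) * complex.Re (g v))).
    by apply: measurable_funD; exact: measurable_funM.
  by apply/funext => v; case: (f v) (g v) => ? ? [? ?].
Qed.

Lemma cmeasurableV f : cmeasurable f -> cmeasurable (fun v => (f v)^-1).
Proof.
move=> [fr fi].
have mV : measurable_fun setT (fun v => (complex.Re (f v) ^+ 2 + complex.Im (f v) ^+ 2)^-1).
  apply: (measurableT_comp (@measurable_fun_invr R)).
  by apply: measurable_funD; apply: measurable_funX.
split.
- rewrite (_ : (fun v => _) = (fun v => complex.Re (f v) *
      (complex.Re (f v) ^+ 2 + complex.Im (f v) ^+ 2)^-1)); first exact: measurable_funM.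
  by apply/funext => v; case: (f v) => ? ?.
- rewrite (_ : (fun v => _) = (fun v => - (complex.Im (f v) *
      (complex.Re (f v) ^+ 2 + complex.Im (f v) ^+ 2)^-1))).
    by apply: measurable_funN; exact: measurable_funM.
  by apply/funext => v; case: (f v) => ? ?.
Qed.

Lemma cmeasurableX f n : cmeasurable f -> cmeasurable (fun v => f v ^+ n).
Proof.
move=> mf; elim: n => [|n IH]; first by under eq_fun do rewrite expr0; exact: cmeasurable_cst.
by under eq_fun do rewrite exprS; exact: cmeasurableM.
Qed.

Lemma bounded_cintegrable f (B : R) : cmeasurable f -> (forall v, normc (f v) <= B) ->
  cintegrable M f.
Proof.
move=> [fr fi] fB; split.
- apply: measurable_bounded_integrable => //; exists B; split; first exact: num_real.
  by move=> c Bc v _; apply: le_trans (Re_le_normc _) (le_trans (fB v) (ltW Bc)).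
- apply: measurable_bounded_integrable => //; exists B; split; first exact: num_real.
  by move=> c Bc v _; apply: le_trans (Im_le_normc _) (le_trans (fB v) (ltW Bc)).
Qed.

End complex_integral.

Section complex_integral_linearity.
Context d (T : measurableType d) (R : realType) (M : {measure set T -> \bar R}).
Implicit Types (f g : T -> R[i]).

Let iZ (h : T -> R) (r : R) : M.-integrable setT (EFin \o h) ->
  M.-integrable setT (EFin \o (fun x => r * h x)).
Proof.
move=> hi; rewrite (_ : _ \o _ = (fun x => r%:E * (h x)%:E)%E); first exact: integrableZl.
by apply/funext => x /=.
Qed.

Let iD (h k : T -> R) : M.-integrable setT (EFin \o h) -> M.-integrable setT (EFin \o k) ->
  M.-integrable setT (EFin \o (fun x => h x + k x)).
Proof. by move=> hi ki; rewrite (_ : _ \o _ = (EFin \o h) \+ (EFin \o k))%E //; exact: integrableD. Qed.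

Let iB (h k : T -> R) : M.-integrable setT (EFin \o h) -> M.-integrable setT (EFin \o k) ->
  M.-integrable setT (EFin \o (fun x => h x - k x)).
Proof. by move=> hi ki; rewrite (_ : _ \o _ = (EFin \o h) \- (EFin \o k))%E //; exact: integrableB. Qed.

Let ReD (z w : R[i]) : complex.Re (z + w) = complex.Re z + complex.Re w.
Proof. by case: z w => ? ? [? ?]. Qed.
Let ImD (z w : R[i]) : complex.Im (z + w) = complex.Im z + complex.Im w.
Proof. by case: z w => ? ? [? ?]. Qed.
Let ReM (z w : R[i]) : complex.Re (z * w) =
  complex.Re z * complex.Re w - complex.Im z * complex.Im w.
Proof. by case: z w => ? ? [? ?]. Qed.
Let ImM (z w : R[i]) : complex.Im (z * w) =
  complex.Re z * complex.Im w + complex.Im z * complex.Re w.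
Proof. by case: z w => ? ? [? ?]. Qed.

Lemma cintegrableD f g : cintegrable M f -> cintegrable M g -> cintegrable M (fun x => f x + g x).
Proof.
move=> [fr fi] [gr gi]; split.
- by under eq_fun do rewrite ReD; exact: iD.
- by under eq_fun do rewrite ImD; exact: iD.
Qed.

Lemma cintegralD f g : cintegrable M f -> cintegrable M g ->
  cintegral M (fun x => f x + g x) = cintegral M f + cintegral M g.
Proof.
move=> [fr fi] [gr gi]; rewrite /cintegral.
under eq_Rintegral do rewrite ReD.
under [X in _ +i* X = _]eq_Rintegral do rewrite ImD.
by rewrite !RintegralD.
Qed.

Lemma cintegrableZ (a : R[i]) f : cintegrable M f -> cintegrable M (fun x => a * f x).
Proof.
move=> [fr fi]; split.
- by under eq_fun do rewrite ReM; apply: iB; exact: iZ.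
- by under eq_fun do rewrite ImM; apply: iD; exact: iZ.
Qed.

Lemma cintegralZ (a : R[i]) f : cintegrable M f ->
  cintegral M (fun x => a * f x) = a * cintegral M f.
Proof.
move=> [fr fi]; rewrite /cintegral.
under eq_Rintegral do rewrite ReM.
under [X in _ +i* X = _]eq_Rintegral do rewrite ImM.
rewrite RintegralB ?RintegralD//; try exact: iZ.
by rewrite !RintegralZl//; case: a.
Qed.

Lemma cintegrable_sum (I : Type) (s : seq I) (F : I -> T -> R[i]) :
  (forall i, cintegrable M (F i)) -> cintegrable M (fun x => \sum_(i <- s) F i x).
Proof.
move=> Fi; elim: s => [|i s IH].
  under eq_fun do rewrite big_nil; by split; exact: integrable0.
by under eq_fun do rewrite big_cons; exact: cintegrableD.
Qed.

Lemma cintegral0 : cintegral M (fun=> 0) = 0.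
Proof.
rewrite /cintegral (_ : Rintegral _ _ _ = 0) //.
by rewrite /Rintegral integral0_eq.
Qed.

Lemma cintegral_sum (I : Type) (s : seq I) (F : I -> T -> R[i]) :
  (forall i, cintegrable M (F i)) ->
  cintegral M (fun x => \sum_(i <- s) F i x) = \sum_(i <- s) cintegral M (F i).
Proof.
move=> Fi; elim: s => [|i s IH].
  by under eq_fun do rewrite big_nil; rewrite big_nil cintegral0.
rewrite big_cons -IH; under eq_fun do rewrite big_cons.
by rewrite cintegralD//; exact: cintegrable_sum.
Qed.

Lemma eq_cintegral f g : f =1 g -> cintegral M f = cintegral M g.
Proof. by move=> /funext ->. Qed.

End complex_integral_linearity.

Section complex_integral_bound.
Context (R : realType) (M : {measure set R -> \bar R}).
Hypothesis Mfin : (M setT < +oo)%E.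
Implicit Types (f g : R -> R[i]).

Lemma normc_cintegral_le f (B : R) : cmeasurable f -> (forall v, normc (f v) <= B) ->
  normc (cintegral M f) <= 2 * B * fine (M setT).
Proof.
move=> mf fB; have [fr fi] := bounded_cintegrable Mfin mf fB.
have Mfin' : M setT \is a fin_num by rewrite ge0_fin_numE.
apply: le_trans (normc_le_add _) _; rewrite /= -mulrA mulr2n mulrDl !mul1r.
have H (h : R -> R) : M.-integrable setT (EFin \o h) -> (forall v, `|h v| <= B) ->
    `|(\int[M]_v h v)%R| <= B * fine (M setT).
  move=> hi hB; apply: le_trans (le_normr_Rintegral _ _) _ => //.
  rewrite -Rintegral_cst//; apply: le_Rintegral => //.
  - exact: integrable_norm hi.
  - apply: measurable_bounded_integrable => //; exists `|B|; split; first exact: num_real.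
    by move=> c Bc v _; exact: ltW.
by apply: lerD; apply: H => // v;
  [exact: le_trans (Re_le_normc _) (fB v)|exact: le_trans (Im_le_normc _) (fB v)].
Qed.

End complex_integral_bound.

(** * Stieltjes transforms on the slit plane *)

Section analytic_at.
Context (R : realType).
Implicit Types (f g : R[i] -> R[i]) (z a : R[i]).

(** The condition that [analytic_on] imposes at one point. *)
Definition analytic_at f z0 : Prop := exists (c : nat -> R[i]) (r : R), 0 < r /\
  forall z, `|z - z0| < r%:C ->
    (series (fun k => c k * (z - z0) ^+ k) : nat -> R[i]^o) @ \oo --> (f z : R[i]^o).

Lemma analytic_at_near f g z0 (s : R) : 0 < s ->
  (forall z, normc (z - z0) < s -> f z = g z) -> analytic_at f z0 -> analytic_at g z0.
Proof.
move=> s0 fg [c [r [r0 fc]]]; exists c, (Num.min r s); split; first by rewrite lt_min r0.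
move=> z; rewrite normcE_norm ltcR lt_min => /andP[zr zs].
by rewrite -fg//; apply: fc; rewrite normcE_norm ltcR.
Qed.

Lemma analytic_at_cst a z0 : analytic_at (fun=> a) z0.
Proof.
exists (fun k => if k == 0%N then a else 0), 1; split; [by []|move=> z _].
rewrite -(cvg_shiftS (series _)); apply: cvg_near_cst; near=> n.
rewrite -[LHS]/(series _ n.+1) seriesE_ord.
by rewrite big_ord_recl /= expr0 mulr1 big1 ?addr0// => i _; rewrite mul0r.
Unshelve. all: by end_near. Qed.

Lemma analytic_atD f g z0 : analytic_at f z0 -> analytic_at g z0 ->
  analytic_at (fun z => f z + g z) z0.
Proof.
move=> [c [r [r0 fc]]] [d [s [s0 gd]]].
exists (fun k => c k + d k), (Num.min r s); split; first by rewrite lt_min r0.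
move=> z; rewrite normcE_norm ltcR lt_min => /andP[zr zs].
rewrite [X in X @ _ --> _](_ : _ = fun n => (series (fun k => c k * (z - z0) ^+ k) n +
    series (fun k => d k * (z - z0) ^+ k) n : R[i]^o)).
  by apply: cvgD; [apply: fc|apply: gd]; rewrite normcE_norm ltcR.
apply/funext => n; rewrite !seriesE_ord -big_split; apply: eq_bigr => i _.
by rewrite mulrDl.
Qed.

Lemma analytic_atZ a f z0 : analytic_at f z0 -> analytic_at (fun z => a * f z) z0.
Proof.
move=> [c [r [r0 fc]]]; exists (fun k => a * c k), r; split; [by []|move=> z zr].
rewrite [X in X @ _ --> _](_ : _ = fun n =>
    (a * series (fun k => c k * (z - z0) ^+ k) n : R[i]^o)).
  by apply: cvgM; [exact: cvg_cst|exact: fc].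
by apply/funext => n; rewrite !seriesE_ord mulr_sumr; apply: eq_bigr => i _; rewrite mulrA.
Qed.

Lemma analytic_atX f z0 : analytic_at f z0 -> analytic_at (fun z => z * f z) z0.
Proof.
move=> [c [r [r0 fc]]].
exists (fun k => z0 * c k + (if k is k'.+1 then c k' else 0)), r; split; [by []|move=> z zr].
rewrite -(cvg_shiftS (series _)).
rewrite [X in X @ _ --> _](_ : _ = fun n =>
    (z0 * series (fun k => c k * (z - z0) ^+ k) n.+1 +
     (z - z0) * series (fun k => c k * (z - z0) ^+ k) n : R[i]^o)).
  have -> : z * f z = z0 * f z + (z - z0) * f z by ring.
  apply: cvgD; apply: cvgM; try exact: cvg_cst; last exact: fc.
  by rewrite (cvg_shiftS (series _)); exact: fc.
apply/funext => n; rewrite !seriesE_ord -[LHS]/(series _ n.+1) seriesE_ord.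
under eq_bigr do rewrite mulrDl.
rewrite big_split /= !mulr_sumr; congr (_ + _).
  by apply: eq_bigr => i _; rewrite mulrA.
rewrite big_ord_recl /= mul0r add0r; apply: eq_bigr => i _.
by rewrite /bump /= add1n exprS mulrCA mulrA.
Qed.

Lemma analytic_at_sum (I : Type) (s : seq I) (F : I -> R[i] -> R[i]) z0 :
  (forall i, analytic_at (F i) z0) -> analytic_at (fun z => \sum_(i <- s) F i z) z0.
Proof.
move=> FA; elim: s => [|i s IH].
  apply: (analytic_at_near ltr01 _ (analytic_at_cst 0 z0)) => z _; by rewrite big_nil.
apply: (analytic_at_near ltr01 _ (analytic_atD (FA i) IH)) => z _; by rewrite big_cons.
Qed.

End analytic_at.

Section stieltjes_transform.
Context (R : realType) (b : R) (b0 : 0 < b).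
Implicit Types (z : R[i]) (v : R).

(** The point of [[0, b]] that is farthest from [c] is still closer to [c] than the
    pole [1 / z] of the kernel, by a factor [r < 1] that is uniform for [z] near [z0].
    For [Re c = b / 2],
    [|1 - c z|^2 - |(v - c) z|^2 = 1 - b Re z + 2 Im c Im z + |z|^2 v (b - v)],
    and off the slit [Im c] can be chosen to make this positive at [z0]: the term
    [2 Im c Im z0] takes any value unless [Im z0 = 0], and then [b Re z0 < 1]. *)
Lemma slit_kernel_geometry z0 : slit_plane b^-1%:E z0 ->
  exists (c : R[i]) (r e s : R), [/\ 0 <= r < 1, 0 < e, 0 < s &
    forall z, normc (z - z0) < s -> forall v, 0 <= v <= b ->
      [/\ normc ((v%:C - c) * z) <= r * normc (1 - c * z),
          e <= normc (1 - z * v%:C) & e <= normc (1 - c * z)]].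
Proof.
move=> slit.
have [t kap0] : exists t, 0 < 1 - b * complex.Re z0 + 2 * t * complex.Im z0.
  have [im0|im0] := eqVneq (complex.Im z0) 0.
    exists 0; rewrite mulr0 mul0r addr0 subr_gt0 mulrC -ltr_pdivlMr// div1r ltNge.
    by apply/negP => h; apply: slit; rewrite /= lee_fin.
  exists ((1 + b * complex.Re z0) / (2 * complex.Im z0)).
  have -> : 2 * ((1 + b * complex.Re z0) / (2 * complex.Im z0)) * complex.Im z0 =
      1 + b * complex.Re z0 by field.
  have -> : 1 - b * complex.Re z0 + (1 + b * complex.Re z0) = 2 by ring.
  by [].
set kap := 1 - _ + _ in kap0.
pose c : R[i] := (b / 2) +i* t.
pose s := Num.min 1 (kap / (2 * (b + 2 * `|t|))).
have bt0 : 0 < b + 2 * `|t| by rewrite ltr_pwDl// mulr_ge0.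
have s0 : 0 < s by rewrite lt_min ltr01 divr_gt0// mulr_gt0.
pose L := 1 + normc c * (normc z0 + 1).
have L1 : 1 <= L by rewrite lerDl mulr_ge0 ?addr_ge0 ?normc_ge0.
have key z v : normc (z - z0) < s -> 0 <= v <= b ->
    [/\ kap / 2 <= normc (1 - c * z) ^+ 2, normc (1 - c * z) <= L &
        normc ((v%:C - c) * z) ^+ 2 <= normc (1 - c * z) ^+ 2 - kap / 2].
  move=> zs /andP[v0 vb].
  have ident : normc ((v%:C - c) * z) ^+ 2 = normc (1 - c * z) ^+ 2
     - ((1 - b * complex.Re z + 2 * t * complex.Im z) + normc z ^+ 2 * (v * (b - v))).
    by rewrite !normc_sqr /c; case: (z) => p q /=; field.
  have near : kap / 2 <= 1 - b * complex.Re z + 2 * t * complex.Im z.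
    have [zs1 zs2] : normc (z - z0) < 1 /\ normc (z - z0) < kap / (2 * (b + 2 * `|t|)).
      by move: zs; rewrite lt_min => /andP[].
    have re := Re_le_normc (z - z0); have im := Im_le_normc (z - z0).
    have : (b + 2 * `|t|) * normc (z - z0) <= kap / 2.
      move: (ltW zs2); rewrite invfM mulrA ler_pdivlMr// => h.
      by rewrite mulrC.
    have : b * (complex.Re z - complex.Re z0) <= b * normc (z - z0).
      rewrite (ler_wpM2l (ltW b0))//; apply: (le_trans _ re); apply: le_trans (ler_norm _).
      by case: (z) (z0) => ? ? [? ?].
    have : - (2 * t * (complex.Im z - complex.Im z0)) <= 2 * `|t| * normc (z - z0).
      apply: le_trans (ler_norm _) _; rewrite normrN !normrM [`|2|]ger0_norm//.
      rewrite ler_wpM2l ?mulr_ge0//; apply: (le_trans _ im).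
      by case: (z) (z0) => ? ? [? ?].
    rewrite /kap; move: (normc (z - z0)) => N; lra.
  have pos : 0 <= normc z ^+ 2 * (v * (b - v)).
    by rewrite mulr_ge0 ?sqr_ge0// mulr_ge0// subr_ge0.
  split.
  - have := sqr_ge0 (normc ((v%:C - c) * z)); rewrite ident; lra.
  - rewrite /L; apply: le_trans (normcB_le _ _) _; rewrite normc1 normcM lerD2l.
    rewrite ler_wpM2l ?normc_ge0//.
    have -> : z = z0 + (z - z0) by ring.
    apply: le_trans (normcD_le _ _) _; rewrite lerD2l ltW//.
    by move: zs; rewrite lt_min => /andP[].
  - rewrite ident; lra.
(* the gain [kap / 2], relative to the largest value [L^2] of [|1 - c z|^2] *)
pose w := kap / (2 * L ^+ 2).
have L0 : 0 < L by exact: lt_le_trans L1.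
have w0 : 0 < w by rewrite divr_gt0// mulr_gt0// exprn_gt0.
have wL : w * L ^+ 2 = kap / 2 by rewrite /w; field; rewrite gt_eqF.
have w1 : w <= 1.
  have z00 : normc (z0 - z0) < s by rewrite subrr normc0.
  have v00 : 0 <= (0 : R) <= b by rewrite lexx ltW.
  have [h1 h2 _] := key z0 0 z00 v00.
  rewrite -(@ler_pM2r _ (L ^+ 2)) ?exprn_gt0// wL mul1r (le_trans h1)//.
  by rewrite ler_pXn2r// nnegrE ?normc_ge0// ltW.
pose r := Num.sqrt (1 - w).
have r0 : 0 <= r by exact: sqrtr_ge0.
have r1 : r < 1 by rewrite -sqrtr1 ltr_sqrt// gtrBl.
have sk : 0 < Num.sqrt (kap / 2) by rewrite sqrtr_gt0 divr_gt0.
exists c, r, (Num.sqrt (kap / 2) * (1 - r)), s; split=> //; first by rewrite r0.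
  by rewrite mulr_gt0// subr_gt0.
move=> z zs v v0b; have [k1 k2 k3] := key z v zs v0b.
have n1 : Num.sqrt (kap / 2) <= normc (1 - c * z).
  by rewrite -[leRHS]ger0_norm ?normc_ge0// -sqrtr_sqr ler_wsqrtr.
have n2 : normc ((v%:C - c) * z) <= r * normc (1 - c * z).
  rewrite -(@ler_pXn2r _ 2)// ?nnegrE ?mulr_ge0 ?normc_ge0//.
  rewrite exprMn sqr_sqrtr ?subr_ge0// (le_trans k3)// mulrBl mul1r lerD2l lerN2.
  by rewrite -wL ler_wpM2l ?(ltW w0)// ler_pXn2r// nnegrE ?normc_ge0// ltW.
split=> //.
- have -> : 1 - z * v%:C = (1 - c * z) - (v%:C - c) * z by ring.
  apply: le_trans (_ : (1 - r) * normc (1 - c * z) <= _).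
    by rewrite mulrC ler_wpM2l// subr_ge0 ltW.
  rewrite mulrBl mul1r; apply: le_trans (lerB_normc _ _); rewrite normcNE.
  by rewrite lerD2l lerN2.
- by apply: le_trans n1; rewrite (ler_piMr (ltW sk))// gerBl.
Qed.

Lemma slit_kernel_lower z0 : slit_plane b^-1%:E z0 -> exists e s : R, [/\ 0 < e, 0 < s &
  forall z, normc (z - z0) < s -> forall v, 0 <= v <= b -> e <= normc (1 - z * v%:C)].
Proof.
move=> /slit_kernel_geometry[c [r [e [s [_ e0 s0 h]]]]]; exists e, s; split=> //.
by move=> z zs v vb; have [] := h z zs v vb.
Qed.

Lemma slit_kernel_neq0 z v : slit_plane b^-1%:E z -> 0 <= v <= b -> 1 - z * v%:C != 0.
Proof.
move=> /slit_kernel_lower[e [s [e0 s0 h]]] vb; rewrite -normc_gt0 (lt_le_trans e0)// h//.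
by rewrite subrr normc0.
Qed.

(** With [q = h v / (1 - z0 v)], which has modulus at most [1 / 2], the kernel at
    [z0 + h] is [(1 - z0 v)^-1 / (1 - q)]. *)
Lemma kernel_expansion z0 h (e : R) v n : 0 < e -> 0 <= v <= b ->
  e <= normc (1 - z0 * v%:C) -> normc h < e / (2 * b) ->
  normc ((1 - (z0 + h) * v%:C)^-1 -
    \sum_(k < n) v%:C ^+ k / (1 - z0 * v%:C) ^+ k.+1 * h ^+ k) <= 2 / e * (1 / 2) ^+ n.
Proof.
move=> e0 /andP[v0 vb] ez he; set w := 1 - z0 * v%:C.
have nw : 0 < normc w by exact: lt_le_trans ez.
have w0 : w != 0 by rewrite -normc_gt0.
pose q := h * v%:C / w.
have q2 : normc q <= 1 / 2.
  rewrite /q !normcM normcV normc_real ger0_norm// ler_pdivrMr//.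
  apply: (@le_trans _ _ (1 / 2 * e)); last by rewrite ler_wpM2l.
  apply: (@le_trans _ _ (e / (2 * b) * b)).
    by rewrite ler_pM ?normc_ge0// (ltW he).
  by rewrite le_eqVlt; apply/orP; left; apply/eqP; field; rewrite gt_eqF.
have q1 : 1 / 2 <= normc (1 - q).
  by apply: le_trans (lerB_normc _ _); rewrite normc1 normcNE; lra.
have q0 : 1 - q != 0 by rewrite -normc_gt0 (lt_le_trans _ q1).
have -> : 1 - (z0 + h) * v%:C = w * (1 - q) by rewrite /q /w; field.
have -> : \sum_(k < n) v%:C ^+ k / w ^+ k.+1 * h ^+ k = w^-1 * ((1 - q ^+ n) / (1 - q)).
  have term k : v%:C ^+ k / w ^+ k.+1 * h ^+ k = w^-1 * q ^+ k.
    by rewrite /q !exprMn exprVn exprS invfM; ring.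
  under eq_bigr do rewrite term.
  rewrite -mulr_sumr; congr (_ * _); apply: (mulIf q0); rewrite divfK// mulr_suml.
  elim: n {he} => [|n IH]; first by rewrite big_ord0 expr0 subrr.
  by rewrite big_ord_recr /= IH exprS; ring.
have -> : (w * (1 - q))^-1 - w^-1 * ((1 - q ^+ n) / (1 - q)) = w^-1 * (q ^+ n / (1 - q)).
  by field; rewrite w0 q0.
rewrite !normcM !normcV normcX.
rewrite [leLHS](_ : _ = (normc w)^-1 * (normc (1 - q))^-1 * normc q ^+ n); last by ring.
have -> : 2 / e = e^-1 * (1 / 2)^-1 by field; rewrite gt_eqF.
apply: ler_pM.
- by rewrite mulr_ge0// invr_ge0 normc_ge0.
- by rewrite exprn_ge0 ?normc_ge0.
- by apply: ler_pM; rewrite ?invr_ge0 ?normc_ge0// lef_pV2 ?posrE// (lt_le_trans _ q1).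
- by apply: lerXn2r; rewrite ?nnegrE ?normc_ge0.
Qed.

Lemma kernel_lower_near_zero z v : normc z < (2 * b)^-1 -> 0 <= v <= b ->
  1 / 2 <= normc (1 - z * v%:C).
Proof.
move=> zb /andP[v0 vb]; apply: le_trans (lerB_normc _ _).
rewrite normc1 normcNE normcM normc_real ger0_norm//.
have : normc z * b < 1 / 2 by move: zb; rewrite -div1r ltr_pdivlMr ?mulr_gt0//; lra.
have : normc z * v <= normc z * b by rewrite ler_wpM2l ?normc_ge0.
lra.
Qed.

Variable M : {measure set R -> \bar R}.
Hypothesis Mfin : (M setT < +oo)%E.

(** The indicator turns the integral over [(0, b]] into one over the whole line, the
    only domain of [cintegral]. *)
Definition node_integral (f : R -> R[i]) : R[i] :=
  cintegral M (fun v => (\1_(`]0, b]%classic : set R) v)%:C * f v).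

(** This is [w S(w)] for [w = 1 / z] and the usual Stieltjes transform
    [S(w) = int M(dv) / (w - v)]. *)
Definition stieltjes z : R[i] := node_integral (fun v => (1 - z * v%:C)^-1).

Let ind_cmeasurable : cmeasurable (fun v => (\1_(`]0, b]%classic : set R) v)%:C).
Proof. by apply: cmeasurable_real; exact: measurable_indic. Qed.

Let id_cmeasurable : cmeasurable (fun v : R => v%:C).
Proof. exact: cmeasurable_real. Qed.

Lemma node_bound (f : R -> R[i]) (B : R) : 0 <= B ->
  (forall v, 0 < v <= b -> normc (f v) <= B) ->
  forall v, normc ((\1_(`]0, b]%classic : set R) v)%:C * f v) <= B.
Proof.
move=> B0 fB v; rewrite indicE; case: (boolP (v \in _)) => [|_].
  by rewrite inE /= in_itv /= mul1r; exact: fB.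
by rewrite mul0r normc0.
Qed.

Lemma node_cintegrable (f : R -> R[i]) (B : R) : cmeasurable f -> 0 <= B ->
  (forall v, 0 < v <= b -> normc (f v) <= B) ->
  cintegrable M (fun v => (\1_(`]0, b]%classic : set R) v)%:C * f v).
Proof.
move=> mf B0 fB; apply: (bounded_cintegrable Mfin (B := B)); first exact: cmeasurableM.
exact: node_bound.
Qed.

Lemma normc_node_integral (f : R -> R[i]) (B : R) : cmeasurable f -> 0 <= B ->
  (forall v, 0 < v <= b -> normc (f v) <= B) ->
  normc (node_integral f) <= 2 * B * fine (M setT).
Proof.
move=> mf B0 fB; apply: normc_cintegral_le => //; first exact: cmeasurableM.
exact: node_bound.
Qed.

Lemma kernel_cmeasurable z : cmeasurable (fun v : R => 1 - z * v%:C).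
Proof.
under eq_fun do rewrite -mulNr; apply: cmeasurableD; first exact: cmeasurable_cst.
by apply: cmeasurableM => //; exact: cmeasurable_cst.
Qed.

Lemma node_integral_sum n (a : nat -> R[i]) (F : nat -> R -> R[i]) :
  (forall k, cintegrable M (fun v => (\1_(`]0, b]%classic : set R) v)%:C * F k v)) ->
  node_integral (fun v => \sum_(k < n) F k v * a k) = \sum_(k < n) a k * node_integral (F k).
Proof.
move=> Fi; rewrite /node_integral.
rewrite (eq_cintegral _ (g := fun v => \sum_(k < n) a k * ((\1_(`]0, b]%classic : set R) v)%:C * F k v)))//;
  last by move=> v; rewrite mulr_sumr; apply: eq_bigr => k _; ring.
rewrite cintegral_sum; last by move=> k; exact: cintegrableZ.
by apply: eq_bigr => k _; rewrite cintegralZ.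
Qed.

Lemma node_integralB (f g : R -> R[i]) :
  cintegrable M (fun v => (\1_(`]0, b]%classic : set R) v)%:C * f v) ->
  cintegrable M (fun v => (\1_(`]0, b]%classic : set R) v)%:C * g v) ->
  node_integral (fun v => f v - g v) = node_integral f - node_integral g.
Proof.
move=> fi gi; rewrite /node_integral -[X in _ - X]mul1r -mulNr -cintegralZ// -cintegralD//.
  by apply: eq_cintegral => v; ring.
exact: cintegrableZ.
Qed.

Lemma analytic_kernel v z0 : 0 <= v <= b -> slit_plane b^-1%:E z0 ->
  analytic_at (fun z => (1 - z * v%:C)^-1) z0.
Proof.
move=> vb /slit_kernel_lower[e [s [e0 s0 h]]].
have ez : e <= normc (1 - z0 * v%:C) by apply: h; rewrite ?subrr ?normc0.
exists (fun k => v%:C ^+ k / (1 - z0 * v%:C) ^+ k.+1), (e / (2 * b)); split.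
  by rewrite divr_gt0// mulr_gt0.
move=> z; rewrite normcE_norm ltcR => zr.
apply: (@cvg_geometric_normc _ _ _ (2 / e) (1 / 2)) => [|n].
  by apply/andP; split; lra.
rewrite seriesE_ord normcBC.
by have := kernel_expansion n e0 vb ez zr; rewrite [z0 + _]addrC subrK.
Qed.

(** The expansion of the kernel converges uniformly in [v], so it can be integrated
    term by term. *)
Lemma analytic_stieltjes z0 : slit_plane b^-1%:E z0 -> analytic_at stieltjes z0.
Proof.
move=> /slit_kernel_lower[e [s [e0 s0 h]]].
have ez v : 0 <= v <= b -> e <= normc (1 - z0 * v%:C).
  by apply: h; rewrite ?subrr ?normc0.
pose F k (v : R) := v%:C ^+ k / (1 - z0 * v%:C) ^+ k.+1.
have mF k : cmeasurable (F k).
  apply: cmeasurableM; first exact: cmeasurableX.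
  by apply/cmeasurableV/cmeasurableX; exact: kernel_cmeasurable.
have Fi k : cintegrable M (fun v => (\1_(`]0, b]%classic : set R) v)%:C * F k v).
  apply: (node_cintegrable (B := b ^+ k / e ^+ k.+1)) => //.
    by rewrite divr_ge0 ?exprn_ge0// ltW.
  move=> v /andP[v0 vb]; rewrite normcM normcV !normcX normc_real gtr0_norm//.
  have [v0' b0'] : 0 <= v /\ 0 <= b by split; exact: ltW.
  apply: ler_pM; rewrite ?invr_ge0 ?exprn_ge0 ?normc_ge0//.
    by apply: lerXn2r; rewrite ?nnegrE.
  have ez' : e <= normc (1 - z0 * v%:C) by apply: ez; rewrite vb ltW.
  rewrite lef_pV2 ?posrE ?exprn_gt0//; last exact: lt_le_trans ez'.
  by apply: lerXn2r; rewrite ?nnegrE ?normc_ge0// ltW.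
exists (fun k => node_integral (F k)), (Num.min s (e / (2 * b))); split.
  by rewrite lt_min s0 divr_gt0// mulr_gt0.
move=> z; rewrite normcE_norm ltcR lt_min => /andP[zs zr].
apply: (@cvg_geometric_normc _ _ _ (2 * (2 / e) * fine (M setT)) (1 / 2)) => [|n].
  by apply/andP; split; lra.
rewrite seriesE_ord normcBC.
under eq_bigr do rewrite mulrC.
rewrite -(node_integral_sum n (fun k => (z - z0) ^+ k))// /stieltjes.
have mS : cmeasurable (fun v => \sum_(k < n) F k v * (z - z0) ^+ k).
  elim: n => [|n IH]; first by under eq_fun do rewrite big_ord0; exact: cmeasurable_cst.
  under eq_fun do rewrite big_ord_recr /=; apply: cmeasurableD => //.
  by apply: cmeasurableM => //; exact: cmeasurable_cst.
have mK : cmeasurable (fun v : R => (1 - z * v%:C)^-1).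
  by apply: cmeasurableV; exact: kernel_cmeasurable.
have bK v : 0 < v <= b -> normc (1 - z * v%:C)^-1 <= e^-1.
  move=> /andP[v0 vb]; have vb' : 0 <= v <= b by rewrite vb ltW.
  by rewrite normcV lef_pV2 ?posrE ?h// (lt_le_trans e0)// h.
have bS v : 0 < v <= b -> normc ((1 - z * v%:C)^-1 - \sum_(k < n) F k v * (z - z0) ^+ k)
    <= 2 / e * (1 / 2) ^+ n.
  move=> /andP[v0 vb]; have vb' : 0 <= v <= b by rewrite vb ltW.
  by have := kernel_expansion n e0 vb' (ez _ vb') zr; rewrite [z0 + _]addrC subrK.
have B0 : 0 <= 2 / e * (1 / 2) ^+ n by rewrite mulr_ge0 ?exprn_ge0 ?divr_ge0// ltW.
have mKS : cmeasurable (fun v => (1 - z * v%:C)^-1 - \sum_(k < n) F k v * (z - z0) ^+ k).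
  apply: cmeasurableD => //; under eq_fun do rewrite -mulN1r.
  by apply: cmeasurableM => //; exact: cmeasurable_cst.
have iK : cintegrable M (fun v => (\1_(`]0, b]%classic : set R) v)%:C * (1 - z * v%:C)^-1).
  by apply: node_cintegrable bK => //; rewrite invr_ge0 ltW.
have iS : cintegrable M (fun v => (\1_(`]0, b]%classic : set R) v)%:C *
    \sum_(k < n) F k v * (z - z0) ^+ k).
  apply: (node_cintegrable (B := e^-1 + 2 / e * (1 / 2) ^+ n)) => //.
    by rewrite addr_ge0// invr_ge0 ltW.
  move=> v v0b; rewrite -[X in normc X](subKr (1 - z * v%:C)^-1).
  by apply: le_trans (normcB_le _ _) _; apply: lerD; [exact: bK|exact: bS].
rewrite -node_integralB//.
apply: le_trans (normc_node_integral mKS B0 bS) _.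
by have -> : 2 * (2 / e * (1 / 2) ^+ n) * fine (M setT) = 2 * (2 / e) * fine (M setT) * (1 / 2) ^+ n by ring.
Qed.

End stieltjes_transform.

(** * Derivatives at the origin *)

Section derivatives_at_zero.
Context (R : realType).
Implicit Types (f : R[i] -> R[i]) (z l : R[i]).

Lemma derive1_quadratic f z l (K s : R) : 0 < s ->
  (forall h, normc h < s -> normc (f (h + z) - f z - l * h) <= K * normc h ^+ 2) ->
  derive1 (f : R[i]^o -> R[i]^o) (z : R[i]^o) = l.
Proof.
move=> s0 fK; rewrite /derive1; apply: cvg_lim; first exact: norm_hausdorff.
apply/cvg_normcP => e e0.
have K0 : 0 < `|K| + 1 by rewrite ltr_wpDl.
have d0 : 0 < Num.min s (e / (`|K| + 1)) by rewrite lt_min s0 divr_gt0.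
have d0' : 0 < (Num.min s (e / (`|K| + 1)))%:C :> R[i] by rewrite ltcR.
near=> h.
have h0 : h != 0 by near: h; exact: nbhs_dnbhs_neq.
have hs : normc h < Num.min s (e / (`|K| + 1)).
  rewrite -ltcR -normcE_norm -[`|h|]/(`|h : R[i]^o|) -(normrN h) -[- h]sub0r.
  by near: h; apply: nbhs_dnbhs; apply: nbhsx_ballx.
move: hs; rewrite lt_min => /andP[hs he].
have hp : 0 < normc h by rewrite normc_gt0.
rewrite /GRing.scale /=.
have -> : h^-1 * (f (h + z) - f z) - l = h^-1 * (f (h + z) - f z - l * h) by field.
rewrite normcM normcV; apply: (@le_lt_trans _ _ ((normc h)^-1 * (`|K| * normc h ^+ 2))).
  rewrite ler_wpM2l ?invr_ge0 ?normc_ge0// (le_trans (fK _ hs))// ler_wpM2r ?sqr_ge0//.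
  exact: ler_norm.
have -> : (normc h)^-1 * (`|K| * normc h ^+ 2) = `|K| * normc h by field; rewrite gt_eqF.
apply: (@le_lt_trans _ _ ((`|K| + 1) * normc h)); first by rewrite ler_wpM2r ?normc_ge0// lerDl.
by rewrite mulrC -ltr_pdivlMr.
Unshelve. all: by end_near. Qed.

Lemma analytic_derive1 f z : analytic_at f z -> exists (D : R[i]) (K s : R),
  [/\ derive1 (f : R[i]^o -> R[i]^o) (z : R[i]^o) = D, 0 < s &
  forall h, normc h < s -> normc (f (h + z) - f z - D * h) <= K * normc h ^+ 2].
Proof.
move=> [c [r [r0 fc]]].
have [K [s [s0 K0 fK]]] := taylor_remainder r0 fc 2.
have fz : f z = c 0%N.
  have := fK z; rewrite subrr normc0 expr0n /= mulr0 => /(_ s0).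
  rewrite big_ord_recl expr0 mulr1 big1 ?addr0; last by move=> i _; rewrite /= expr0n /= mulr0.
  by rewrite le_eqVlt ltNge normc_ge0 orbF normc_eq0 subr_eq0 => /eqP.
have est h : normc h < s -> normc (f (h + z) - f z - c 1%N * h) <= K * normc h ^+ 2.
  have := fK (h + z); rewrite addrK => H /H.
  by rewrite !big_ord_recl big_ord0 /= fz expr0 mulr1 addr0 opprD addrA.
by exists (c 1%N), K, s; rewrite (derive1_quadratic s0 est).
Qed.

(** The value [f^`() z = a + 2 z F 0 + O(z^2)] is read off difference quotients whose
    step tends to [0]; the Lipschitz bound on [F] replaces its differentiability. *)
Lemma derivatives_of_quadratic_form f (F : R[i] -> R[i]) (a : R[i]) (L s : R) : 0 < s -> 0 <= L ->
  (forall z w, normc z < s -> normc w < s -> normc (F z - F w) <= L * normc (z - w)) ->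
  (forall z, normc z < s -> f z = a * z + z ^+ 2 * F z) ->
  (forall z, normc z < s -> analytic_at f z) ->
  derive1n 1 (f : R[i]^o -> R[i]^o) (0 : R[i]^o) = a /\
  derive1n 2 (f : R[i]^o -> R[i]^o) (0 : R[i]^o) = 2 * F 0.
Proof.
move=> s0 L0 FL fE fA; have n00 : normc (0 : R[i]) < s by rewrite normc0.
have f0 : f 0 = 0 by rewrite fE// mulr0 expr0n /= mul0r addr0.
have d1 : derive1 (f : R[i]^o -> R[i]^o) (0 : R[i]^o) = a.
  apply: (@derive1_quadratic _ _ _ (normc (F 0) + L * s) s) => // h hs.
  rewrite addr0 f0 subr0 fE//.
  have -> : a * h + h ^+ 2 * F h - a * h = h ^+ 2 * (F 0 + (F h - F 0)) by ring.
  rewrite normcM normcX mulrC ler_wpM2r ?sqr_ge0//; apply: le_trans (normcD_le _ _) _.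
  rewrite lerD2l (le_trans (FL _ _ hs n00))// subr0 ler_wpM2l// ltW//.
split=> //; pose d := derive1 (f : R[i]^o -> R[i]^o).
apply: (@derive1_quadratic d 0 _ (3 * L) (s / 2)) => [|z zs]; first by rewrite divr_gt0.
rewrite addr0 /d d1.
have s2 : s / 2 < s by rewrite ltr_pdivrMr// mulr_natr mulr2n ltrDl.
have zs' : normc z < s by exact: lt_trans s2.
have [D [K [t [dE t0 fK]]]] := analytic_derive1 (fA _ zs').
apply/ler_addgt0Pr => e e0.
(* a step [h] so small that the terms of order [h] stay below [e] *)
pose C := `|K| + 1 + 3 * L * s + L * s + normc (F 0).
have C0 : 0 < C.
  have Ls : 0 <= L * s by rewrite mulr_ge0// ltW.
  have := normr_ge0 K; have := normc_ge0 (F 0); rewrite /C; lra.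
pose m := Num.min (Num.min t (s / 2)) (e / C).
have m0 : 0 < m by rewrite !lt_min t0 !divr_gt0.
pose h : R[i] := (m / 2)%:C.
have nh : normc h = m / 2 by rewrite normc_real ger0_norm ?divr_ge0// ltW.
have mm : m / 2 < m by rewrite ltr_pdivrMr// mulr_natr mulr2n ltrDl.
have hm : normc h < m by rewrite nh.
have h0 : h != 0 by rewrite -normc_gt0 nh divr_gt0.
clearbody h.
have [ht [hs he]] : normc h < t /\ normc h < s / 2 /\ normc h < e / C.
  by move: hm; rewrite /m !lt_min => /andP[/andP[-> ->] ->].
have hzs : normc (h + z) < s.
  apply: le_lt_trans (normcD_le _ _) _; rewrite [s]splitr; exact: ltrD.
have := fK _ ht; rewrite !fE// dE => DK.
have -> : D - a - 2 * F 0 * z = - (h^-1 * (a * (h + z) + (h + z) ^+ 2 * F (h + z) -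
    (a * z + z ^+ 2 * F z) - D * h)) + ((2 * z + h) * (F (h + z) - F 0) + h * F 0
    + h^-1 * (z ^+ 2 * (F (h + z) - F z))).
  move: (F (h + z)) (F z) (F 0) => F1 F2 F3; by field.
apply: le_trans (normcD_le _ _) _; rewrite normcNE.
have b1 : normc (h^-1 * (a * (h + z) + (h + z) ^+ 2 * F (h + z) -
    (a * z + z ^+ 2 * F z) - D * h)) <= `|K| * normc h.
  rewrite normcM normcV mulrC ler_pdivrMr ?normc_gt0// (le_trans DK)//.
  by rewrite -mulrA -expr2 ler_wpM2r ?sqr_ge0// ler_norm.
have hz : normc (h + z) <= normc h + normc z by exact: normcD_le.
have b2 : normc ((2 * z + h) * (F (h + z) - F 0)) <= (2 * normc z + normc h) * (L * (normc h + normc z)).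
  rewrite normcM; apply: ler_pM; rewrite ?normc_ge0//.
    by apply: le_trans (normcD_le _ _) _; rewrite normcM normc_nat.
  by apply: le_trans (FL _ _ hzs n00) _; rewrite subr0 ler_wpM2l.
have b3 : normc (h^-1 * (z ^+ 2 * (F (h + z) - F z))) <= L * normc z ^+ 2.
  rewrite normcM normcV normcM normcX mulrC ler_pdivrMr ?normc_gt0//.
  rewrite [leRHS]mulrAC [leRHS]mulrC ler_wpM2l ?sqr_ge0//.
  by apply: le_trans (FL _ _ hzs zs') _; rewrite addrK.
have b4 : normc ((2 * z + h) * (F (h + z) - F 0) + h * F 0 + h^-1 * (z ^+ 2 * (F (h + z) - F z)))
   <= (2 * normc z + normc h) * (L * (normc h + normc z)) + normc h * normc (F 0) + L * normc z ^+ 2.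
  apply: le_trans (normcD_le _ _) _; apply: lerD => //.
  by apply: le_trans (normcD_le _ _) _; rewrite -[X in _ <= _ + X]normcM lerD2r.
apply: le_trans (lerD b1 b4) _.
have he' : C * normc h <= e by rewrite mulrC -ler_pdivlMr// ltW.
apply: le_trans (_ : 3 * L * normc z ^+ 2 + C * normc h <= _); last by rewrite lerD2l.
have hh : L * (normc h * normc h) <= L * s * normc h.
  by rewrite -mulrA ler_wpM2l// ler_wpM2r ?normc_ge0// ltW// (lt_trans hs).
have hz2 : L * (normc z * normc h) <= L * s * normc h.
  by rewrite -mulrA ler_wpM2l// ler_wpM2r ?normc_ge0// ltW.
have := normc_ge0 h; have := normc_ge0 z; rewrite /C.
move: hh hz2; move: (normc h) (normc z) (normc (F 0)) `|K| => p q u k; rewrite !expr2; nra.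
Qed.

End derivatives_at_zero.

(** * Error of the quadrature on the kernel *)

Section quadrature_error.
Context (R : realType) (b : R) (b0 : 0 < b).
Variable M : {measure set R -> \bar R}.
Hypothesis Mfin : (M setT < +oo)%E.
Variables (n : nat) (x w : 'I_n -> R).
Hypotheses (n0 : (0 < n)%N) (x0b : forall i, 0 < x i <= b) (w0 : forall i, 0 < w i).
Hypothesis quad : forall j, (j < 2 * n)%N ->
  (\int[M]_(v in `]0%R, b]) (v ^+ j)%:E)%E = (\sum_(i < n) x i ^+ j * w i)%:E.
Implicit Types (z c : R[i]) (v : R).

Lemma id_cmeasurable : cmeasurable (fun v : R => v%:C).
Proof. exact: cmeasurable_real. Qed.

Lemma node_integral_monomial j : (j < 2 * n)%N ->
  node_integral b M (fun v => v%:C ^+ j) = (\sum_(i < n) x i ^+ j * w i)%:C.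
Proof.
move=> j2; rewrite /node_integral /cintegral.
have E v : (\1_(`]0, b]%classic : set R) v)%:C * v%:C ^+ j =
    (v ^+ j * \1_(`]0, b]%classic : set R) v)%:C.
  by rewrite -rmorphXn -rmorphM mulrC.
have -> : (\int[M]_v complex.Re ((\1_(`]0, b]%classic : set R) v)%:C * v%:C ^+ j) =
    \sum_(i < n) x i ^+ j * w i)%R.
  under eq_Rintegral do rewrite E /=.
  rewrite /Rintegral -[RHS]/(fine (\sum_(i < n) x i ^+ j * w i)%:E) -quad//; congr fine.
  rewrite [RHS]integral_mkcond; apply: eq_integral => v _.
  by rewrite /patch indicE; case: ifPn; rewrite ?mulr1 ?mulr0.
have -> : (\int[M]_v complex.Im ((\1_(`]0, b]%classic : set R) v)%:C * v%:C ^+ j) = 0)%R.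
  by under eq_Rintegral do rewrite E /=; rewrite /Rintegral integral0_eq.
by [].
Qed.

Lemma sum_weights_le : \sum_(i < n) w i <= fine (M setT).
Proof.
have : (0 < 2 * n)%N by rewrite muln_gt0.
move=> /quad; under eq_bigr do rewrite expr0 mul1r.
under eq_integral do rewrite expr0.
rewrite integral_cst// mul1e => E.
rewrite -lee_fin -E fineK ?ge0_fin_numE//.
by apply: le_measure; rewrite ?inE.
Qed.

Lemma node_integral_poly (p : {poly R[i]}) : (size p <= 2 * n)%N ->
  node_integral b M (fun v => p.[v%:C]) = \sum_(i < n) (w i)%:C * p.[(x i)%:C].
Proof.
move=> sp; have mF k : cintegrable M (fun v => (\1_(`]0, b]%classic : set R) v)%:C * v%:C ^+ k).
  apply: (@node_cintegrable _ b M Mfin _ (b ^+ k)) => //.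
  - by apply: cmeasurableX; exact: id_cmeasurable.
  - by rewrite exprn_ge0// ltW.
  - move=> v /andP[v0 vb]; rewrite normcX normc_real gtr0_norm//.
    by apply: lerXn2r; rewrite ?nnegrE// ltW.
transitivity (node_integral b M (fun v => \sum_(k < 2 * n) v%:C ^+ k * p`_k)).
  apply: eq_cintegral => v; rewrite (horner_coef_wide _ sp); congr (_ * _).
  by apply: eq_bigr => k _; rewrite mulrC.
rewrite (node_integral_sum (2 * n) (fun k => p`_k) mF).
transitivity (\sum_(k < 2 * n) \sum_(i < n) (w i)%:C * (p`_k * (x i)%:C ^+ k)).
  apply: eq_bigr => k _; rewrite node_integral_monomial// rmorph_sum mulr_sumr /=.
  by apply: eq_bigr => i _; rewrite rmorphM rmorphXn /=; ring.
rewrite exchange_big; apply: eq_bigr => i _ /=.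
by rewrite (horner_coef_wide _ sp) mulr_sumr.
Qed.

(** In powers of [(v - c) z / (1 - c z)] the kernel is a geometric series. Its partial
    sum of [2 n] terms is a polynomial in [v] on which integral and quadrature agree,
    and the rest changes both by [O(r ^ (2 n))]. *)
Lemma quadrature_error z c (r e : R) : 0 <= r -> 0 < e ->
  e <= normc (1 - c * z) ->
  (forall v, 0 <= v <= b -> normc ((v%:C - c) * z) <= r * normc (1 - c * z)) ->
  (forall v, 0 <= v <= b -> e <= normc (1 - z * v%:C)) ->
  normc (stieltjes b M z - \sum_(i < n) (w i)%:C / (1 - z * (x i)%:C))
    <= 3 / e * fine (M setT) * r ^+ (2 * n).
Proof.
move=> r0 e0 ec hr he.
have nc : 1 - c * z != 0 by rewrite -normc_gt0 (lt_le_trans e0).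
pose q : R[i] := z / (1 - c * z).
pose p : {poly R[i]} := \sum_(m < 2 * n) (q ^+ m / (1 - c * z)) *: ('X - c%:P) ^+ m.
have sp : (size p <= 2 * n)%N.
  apply: (leq_trans (size_sum _ _ _)); apply/bigmax_leqP => m _; apply: leq_trans (size_scale_leq _ _) _.
  by rewrite size_exp_XsubC.
have pE v : p.[v%:C] = (1 - c * z)^-1 * \sum_(m < 2 * n) (q * (v%:C - c)) ^+ m.
  rewrite /p horner_sum mulr_sumr; apply: eq_bigr => m _.
  by rewrite hornerZ horner_exp hornerXsubC [(q * _) ^+ m]exprMn [in RHS]mulrA [(1 - c * z)^-1 * _]mulrC.
have geo (u : R[i]) k : (\sum_(m < k) u ^+ m) * (1 - u) = 1 - u ^+ k.
  elim: k => [|k IH]; first by rewrite big_ord0 expr0; ring.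
  by rewrite big_ord_recr /= mulrDl IH exprS; ring.
have kern v : 0 <= v <= b ->
    normc ((1 - z * v%:C)^-1 - p.[v%:C]) <= r ^+ (2 * n) / e.
  move=> vb; set u := q * (v%:C - c).
  have uE : 1 - z * v%:C = (1 - c * z) * (1 - u) by rewrite /u /q; field.
  have nv : 1 - z * v%:C != 0 by rewrite -normc_gt0 (lt_le_trans e0)// he.
  have nu : 1 - u != 0 by apply: contraNneq nv => u0; rewrite uE u0 mulr0.
  have -> : (1 - z * v%:C)^-1 - p.[v%:C] = u ^+ (2 * n) / (1 - z * v%:C).
    rewrite pE -/u uE; apply: (mulIf nu); apply: (mulIf nc).
    have := geo u (2 * n)%N; set S := \sum_(_ < _) _ => geoE.
    rewrite (_ : _ * (1 - u) * _ = 1 - S * (1 - u)); last by field; rewrite nu nc.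
    by rewrite geoE; field; rewrite nu nc.
  rewrite normcM normcV normcX; apply: ler_pM.
  - by rewrite exprn_ge0 ?normc_ge0.
  - by rewrite invr_ge0 normc_ge0.
  - apply: lerXn2r; rewrite ?nnegrE ?normc_ge0//.
    have -> : u = ((v%:C - c) * z) / (1 - c * z) by rewrite /u /q; ring.
    by rewrite normcM normcV ler_pdivrMr ?normc_gt0// hr.
  - by rewrite lef_pV2 ?posrE ?he// (lt_le_trans e0)// he.
have mp : cmeasurable (fun v => p.[v%:C]).
  under eq_fun do rewrite (horner_coef_wide _ sp).
  elim: (2 * n)%N => [|k IH]; first by under eq_fun do rewrite big_ord0; exact: cmeasurable_cst.
  under eq_fun do rewrite big_ord_recr /=; apply: cmeasurableD => //.
  apply: cmeasurableM; first exact: cmeasurable_cst.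
  by apply: cmeasurableX; exact: id_cmeasurable.
have mK : cmeasurable (fun v : R => (1 - z * v%:C)^-1).
  by apply: cmeasurableV; exact: kernel_cmeasurable.
have B0 : 0 <= r ^+ (2 * n) / e by rewrite divr_ge0 ?exprn_ge0// ltW.
have pos v : 0 < v <= b -> 0 <= v <= b by move=> /andP[/ltW -> ->].
have iK : cintegrable M (fun v => (\1_(`]0, b]%classic : set R) v)%:C * (1 - z * v%:C)^-1).
  apply: (@node_cintegrable _ b M Mfin _ (e^-1)) => //; first by rewrite invr_ge0 ltW.
  by move=> v /pos vb; rewrite normcV lef_pV2 ?posrE ?he// (lt_le_trans e0)// he.
have ip : cintegrable M (fun v => (\1_(`]0, b]%classic : set R) v)%:C * p.[v%:C]).
  apply: (@node_cintegrable _ b M Mfin _ (e^-1 + r ^+ (2 * n) / e)) => //.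
    by rewrite addr_ge0// invr_ge0 ltW.
  move=> v /pos vb; rewrite -[X in normc X](subKr (1 - z * v%:C)^-1).
  apply: le_trans (normcB_le _ _) _; apply: lerD; last exact: kern.
  by rewrite normcV lef_pV2 ?posrE ?he// (lt_le_trans e0)// he.
have mD : cmeasurable (fun v => (1 - z * v%:C)^-1 - p.[v%:C]).
  apply: cmeasurableD => //; under eq_fun do rewrite -mulN1r.
  by apply: cmeasurableM => //; exact: cmeasurable_cst.
have -> : stieltjes b M z - \sum_(i < n) (w i)%:C / (1 - z * (x i)%:C) =
    node_integral b M (fun v => (1 - z * v%:C)^-1 - p.[v%:C]) -
    \sum_(i < n) (w i)%:C * ((1 - z * (x i)%:C)^-1 - p.[(x i)%:C]).
  rewrite node_integralB// node_integral_poly//.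
  under [X in _ = _ - X]eq_bigr do rewrite mulrBr.
  by rewrite sumrB /stieltjes; ring.
apply: le_trans (normcB_le _ _) _.
have -> : 3 / e * fine (M setT) * r ^+ (2 * n) =
  2 * (r ^+ (2 * n) / e) * fine (M setT) + fine (M setT) * (r ^+ (2 * n) / e).
  by move: (r ^+ _) => t; field; rewrite gt_eqF.
apply: lerD; first by apply: normc_node_integral => // v /pos; exact: kern.
apply: le_trans (normc_sum_le _ _ _) _.
apply: (@le_trans _ _ (\sum_(i < n) w i * (r ^+ (2 * n) / e))).
  apply: ler_sum => i _; rewrite normcM normc_real gtr0_norm// ler_wpM2l ?(ltW (w0 i))//.
  by apply: kern; apply: pos.
by rewrite -mulr_suml ler_wpM2r// sum_weights_le.
Qed.

End quadrature_error.

(** * Uniqueness of Pade approximants and partial fractions *)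

Section pade_uniqueness.
Context (R : realType).
Implicit Types (p q : {poly R[i]}) (z : R[i]) (f : R[i] -> R[i]).

Lemma horner_lowest_term p j : (forall i, (i < j)%N -> p`_i = 0) ->
  exists2 C : R, 0 <= C &
    forall z, normc z <= 1 -> normc (p.[z] - p`_j * z ^+ j) <= C * normc z ^+ j.+1.
Proof.
move=> p0; exists (\sum_(i < size p) normc p`_i).
  by apply: sumr_ge0 => i _; exact: normc_ge0.
move=> z z1.
have -> : p.[z] - p`_j * z ^+ j = \sum_(i < size p | (j < i)%N) p`_i * z ^+ i.
  rewrite horner_coef (bigID (fun i : 'I__ => (j < i)%N)) /= addrAC.
  suff -> : \sum_(i < size p | ~~ (j < i)%N) p`_i * z ^+ i = p`_j * z ^+ j by rewrite subrK.
  have [jp|jp] := ltnP j (size p).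
    rewrite (bigD1 (Ordinal jp)) /= ?ltnn// big1 ?addr0// => i /andP[ij].
    rewrite -val_eqE /= => ij'; rewrite p0 ?mul0r//.
    by rewrite ltn_neqAle ij' leqNgt.
  rewrite nth_default// mul0r big1// => i _; rewrite p0 ?mul0r//.
  exact: leq_trans (ltn_ord i) jp.
apply: le_trans (normc_sum_le _ _ _) _.
rewrite mulr_suml [leRHS](bigID (fun i : 'I__ => (j < i)%N)) /= -[leLHS]addr0; apply: lerD.
  apply: ler_sum => i ji; rewrite normcM normcX ler_wpM2l ?normc_ge0//.
  by apply: ler_wiXn2l => //; exact: normc_ge0.
by apply: sumr_ge0 => i _; rewrite mulr_ge0 ?normc_ge0// exprn_ge0 ?normc_ge0.
Qed.

(** The lowest nonzero coefficient would dominate near [0]. *)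
Lemma poly_zero_of_order p N (K s : R) : (size p <= N)%N -> 0 < s ->
  (forall z, normc z < s -> normc p.[z] <= K * normc z ^+ N) -> p = 0.
Proof.
move=> sp s0 pK; suff c0 j : p`_j = 0 by apply/polyP => j; rewrite c0 coef0.
have [Nj|jN] := leqP N j; first by rewrite nth_default// (leq_trans sp).
elim/ltn_ind: j jN => j IH jN.
have [C C0 pC] : exists2 C : R, 0 <= C &
    forall z, normc z <= 1 -> normc (p.[z] - p`_j * z ^+ j) <= C * normc z ^+ j.+1.
  by apply: horner_lowest_term => i ij; apply: IH => //; exact: ltn_trans jN.
apply/eqP; rewrite -normc_eq0 eq_le normc_ge0 andbT; apply/ler_addgt0Pr => e e0.
rewrite add0r.
have CK : 0 < C + `|K| + 1 by rewrite ltr_wpDl// addr_ge0.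
pose t := Num.min (Num.min s 1) (e / (C + `|K| + 1)) / 2.
have m0 : 0 < Num.min (Num.min s 1) (e / (C + `|K| + 1)) by rewrite !lt_min s0 ltr01 divr_gt0.
have t0 : 0 < t by rewrite divr_gt0.
have tm : t < Num.min (Num.min s 1) (e / (C + `|K| + 1)).
  by rewrite /t ltr_pdivrMr// mulr_natr mulr2n ltrDl.
have [ts [t1 te]] : t < s /\ t < 1 /\ t < e / (C + `|K| + 1).
  by move: tm; rewrite !lt_min => /andP[/andP[-> ->] ->].
have nt : normc t%:C = t by rewrite normc_real gtr0_norm.
have h1 := pC t%:C; rewrite nt in h1; have {}h1 := h1 (ltW t1).
have h2 := pK t%:C; rewrite nt in h2; have {}h2 := h2 ts.
have h3 : normc p`_j * t ^+ j <= C * t ^+ j.+1 + `|K| * t ^+ j.+1.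
  rewrite -{1}nt -normcX -normcM.
  have -> : p`_j * t%:C ^+ j = p.[t%:C] - (p.[t%:C] - p`_j * t%:C ^+ j) by ring.
  apply: le_trans (normcB_le _ _) _; rewrite addrC; apply: lerD => //.
  apply: le_trans h2 _; apply: (@le_trans _ _ (`|K| * t ^+ N)).
    by rewrite ler_wpM2r ?exprn_ge0 ?ler_norm// ltW.
  by rewrite ler_wpM2l// ler_wiXn2l// ltW.
have : normc p`_j <= (C + `|K|) * t.
  rewrite -(@ler_pM2r _ (t ^+ j)) ?exprn_gt0// (le_trans h3)//.
  by rewrite exprS -mulrDl mulrA.
move=> /le_trans; apply; apply: (@le_trans _ _ ((C + `|K| + 1) * t)).
  by rewrite ler_wpM2r ?(ltW t0)// lerDl.
by rewrite mulrC -ler_pdivlMr// ltW.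
Qed.

Lemma horner_near_zero p : exists2 s : R, 0 < s & forall z, normc z < s ->
  normc p.[z] <= normc p.[0] + 1 /\ normc p.[0] / 2 <= normc p.[z].
Proof.
have [C C0 pC] := @horner_lowest_term p 0 (fun i (h : (i < 0)%N) => match notF h with end).
pose d := if p.[0] == 0 then 1 else normc p.[0] / 2.
have d0 : 0 < d by rewrite /d; case: eqVneq => // h; rewrite divr_gt0// normc_gt0.
have C1 : 0 < C + 1 by rewrite ltr_wpDl.
exists (Num.min 1 (Num.min 1 d / (C + 1))); first by rewrite lt_min ltr01 divr_gt0// lt_min ltr01.
move=> z; rewrite lt_min => /andP[z1 zd].
have := pC z (ltW z1); rewrite expr0 mulr1 expr1 -horner_coef0 => h.
have zC : C * normc z <= Num.min 1 d.
  apply: (@le_trans _ _ ((C + 1) * normc z)); first by rewrite ler_wpM2r ?normc_ge0// lerDl.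
  by rewrite mulrC -ler_pdivlMr// ltW.
have {}h := le_trans h zC; move: h; rewrite le_min => /andP[h1 h2]; split.
  have -> : p.[z] = p.[0] + (p.[z] - p.[0]) by ring.
  by apply: le_trans (normcD_le _ _) _; rewrite lerD2l.
have [->|p0] := eqVneq p.[0] 0; first by rewrite normc0 mul0r normc_ge0.
have -> : p.[z] = p.[0] + (p.[z] - p.[0]) by ring.
apply: le_trans (lerB_normc _ _); move: h2; rewrite /d (negbTE p0); lra.
Qed.

(** The polynomial [p' q - p q'] vanishes to order [m + n + 1] at [0], above its degree.
    As both fractions are in lowest terms, they also have the same poles. *)
Lemma is_pade_unique m n f p q p' q' :
  is_pade m n f (p, q) -> is_pade m n f (p', q') ->
  forall z, p'.[z] / q'.[z] = p.[z] / q.[z].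
Proof.
move=> [sp sq q0 cpq [K [r [r0 fK]]]] [sp' sq' q0' cpq' [K' [r' [r0' fK']]]].
pose N := (m + n + 1)%N.
have E : p * q' - p' * q = 0.
  have [s s0 hs] := horner_near_zero q; have [s' s0' hs'] := horner_near_zero q'.
  apply: (@poly_zero_of_order _ N
    ((normc q.[0] + 1) * (normc q'.[0] + 1) * (`|K| + `|K'|)) (Num.min (Num.min r r') (Num.min s s'))).
  - apply: leq_trans (size_polyD _ _) _; rewrite size_polyN geq_max /N addn1.
    have H (u v : {poly R[i]}) : (size u <= m.+1)%N -> (size v <= n.+1)%N -> (size (u * v)%R <= (m + n).+1)%N.
      move=> hu hv; apply: leq_trans (size_polyMleq _ _) _.
      by have := leq_add hu hv; rewrite addSn addnS; case: (_ + size v)%N.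
    by rewrite !H.
  - by rewrite !lt_min r0 r0' s0 s0'.
  move=> z; rewrite !lt_min => /andP[/andP[zr zr'] /andP[/hs[b1 l1] /hs'[b2 l2]]].
  have nq : q.[z] != 0 by rewrite -normc_gt0 (lt_le_trans _ l1)// divr_gt0// normc_gt0.
  have nq' : q'.[z] != 0 by rewrite -normc_gt0 (lt_le_trans _ l2)// divr_gt0// normc_gt0.
  have -> : (p * q' - p' * q).[z] =
      q.[z] * q'.[z] * ((p.[z] / q.[z] - f z) - (p'.[z] / q'.[z] - f z)).
    by rewrite !hornerE; field; rewrite nq nq'.
  have conv (u : R[i]) (k : R) : `|u| <= k%:C * `|z| ^+ N -> normc u <= `|k| * normc z ^+ N.
    rewrite !normcE_norm -rmorphXn -rmorphM lecR => /le_trans; apply.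
    by rewrite ler_wpM2r ?exprn_ge0 ?normc_ge0// ler_norm.
  have a1 := conv _ _ (fK z _); have a2 := conv _ _ (fK' z _).
  rewrite !normcM -[leRHS]mulrA; apply: ler_pM; rewrite ?mulr_ge0 ?normc_ge0//.
    by apply: ler_pM; rewrite ?normc_ge0.
  rewrite mulrDl; apply: le_trans (normcB_le _ _) _; apply: lerD.
    by apply: a1; rewrite normcE_norm ltcR.
  by apply: a2; rewrite normcE_norm ltcR.
have {}E : p * q' = p' * q by apply/eqP; rewrite -subr_eq0 E.
have nq : q != 0 by apply: contraNneq q0 => ->; rewrite horner0.
have nq' : q' != 0 by apply: contraNneq q0' => ->; rewrite horner0.
have d1 : q %| q'.
  by rewrite -(Gauss_dvdpr q' (q := p)) ?E ?dvdp_mull// coprimep_sym.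
have d2 : q' %| q.
  by rewrite -(Gauss_dvdpr q (q := p')) -?E ?dvdp_mull// coprimep_sym.
have /eqpP[[c c'] /= /andP[c0 c0'] qq] : q %= q' by rewrite /eqp d1.
have pp : c *: p = c' *: p'.
  by apply: (mulIf nq'); rewrite -!scalerAl E scalerAr qq -scalerAr.
have scale (u v : {poly R[i]}) : c *: u = c' *: v -> v = (c / c') *: u.
  by move=> uv; rewrite mulrC -scalerA uv scalerA mulVf// scale1r.
move=> z; rewrite (scale _ _ pp) (scale _ _ qq) !hornerZ invfM mulrACA mulfV ?mul1r//.
by rewrite mulf_neq0// invr_eq0.
Qed.

(** By uniqueness the fraction chosen by [pade] may be replaced by any other. *)
Lemma padeE m n f p q z : is_pade m n f (p, q) -> pade m n f z = p.[z] / q.[z].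
Proof.
move=> pq; rewrite /pade; case: xgetP => [[p' q'] _ pq'|/(_ (p, q))] //=.
exact: is_pade_unique pq pq' z.
Qed.

End pade_uniqueness.

Section partial_fractions.
Context (F : fieldType) (n : nat) (x w : 'I_n -> F) (k : nat) (g : {poly F}).
Hypotheses (x_inj : injective x) (x0 : forall i, x i != 0) (w0 : forall i, w i != 0).

Definition node_denominator : {poly F} := \prod_(i < n) (1 - x i *: 'X).

Definition node_numerator : {poly F} := node_denominator * g +
  'X^(k.+1) * \sum_(i < n) w i *: \prod_(j < n | j != i) (1 - x j *: 'X).

Hypothesis size_g : (size g <= k.+1)%N.

Let factor_size i : size (1 - x i *: 'X : {poly F}) = 2.
Proof.
rewrite -opprB size_polyN size_polyDl; first by rewrite size_scale// size_polyX.
by rewrite size_polyN size_poly1 size_scale// size_polyX.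
Qed.

Lemma size_node_denominator : (size node_denominator <= n.+1)%N.
Proof.
apply: leq_trans (size_poly_prod_leq _ _) _ => /=.
under eq_bigr do rewrite factor_size.
by rewrite sum_nat_const card_ord muln2 -addnn -addSn addnK.
Qed.

Lemma size_node_numerator : (size node_numerator <= (n + k).+1)%N.
Proof.
apply: leq_trans (size_polyD _ _) _; rewrite geq_max; apply/andP; split.
  apply: leq_trans (size_polyMleq _ _) _.
  have := leq_add size_node_denominator size_g.
  by rewrite addSn addnS; case: (_ + size g)%N.
have sn : (size (\sum_(i < n) w i *: \prod_(j < n | j != i) (1 - x j *: 'X))%R <= n)%N.
  apply: leq_trans (size_sum _ _ _) _; apply/bigmax_leqP => i _.
  apply: leq_trans (size_scale_leq _ _) _; apply: leq_trans (size_poly_prod_leq _ _) _ => /=.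
  under eq_bigr do rewrite factor_size.
  rewrite sum_nat_const muln2 -addnn -addSn addnK.
  have := cardC1 i; rewrite card_ord => ->; by case: (n) i => [[]|].
have [->|s0] := eqVneq (\sum_(i < n) w i *: \prod_(j < n | j != i) (1 - x j *: 'X)) 0.
  by rewrite mulr0 size_poly0.
by rewrite mulrC size_mulXn// addnC addnS ltnS leq_add2r.
Qed.

Lemma horner_node_denominator z : node_denominator.[z] = \prod_(i < n) (1 - z * x i).
Proof. by rewrite horner_prod; apply: eq_bigr => i _; rewrite !hornerE mulrC. Qed.

Lemma node_fractionE z : (forall i, z * x i != 1) ->
  node_numerator.[z] / node_denominator.[z] =
  g.[z] + z ^+ k.+1 * \sum_(i < n) w i / (1 - z * x i).
Proof.
move=> zx; have fz i : 1 - z * x i != 0 by rewrite subr_eq0 eq_sym.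
have d0 : node_denominator.[z] != 0.
  by rewrite horner_node_denominator prodf_seq_neq0; apply/allP => i _ /=; exact: fz.
rewrite /node_numerator hornerD !hornerM mulrDl mulrAC mulfV// mul1r; congr (_ + _).
rewrite hornerXn -mulrA; congr (_ * _); rewrite horner_sum mulr_suml; apply: eq_bigr => i _.
rewrite hornerZ horner_prod horner_node_denominator [X in _ / X](bigD1 i)//= -mulrA; congr (_ * _).
under eq_bigr do rewrite !hornerE mulrC.
rewrite invfM mulrCA mulfV ?mulr1//.
by rewrite prodf_seq_neq0; apply/allP => j _; apply/implyP => _; exact: fz.
Qed.

(** At the pole [1 / x i] only the [i]-th term of the numerator survives. *)
Lemma coprime_node_fraction : coprimep node_numerator node_denominator.
Proof.
apply: (big_ind (fun q => coprimep node_numerator q)).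
- exact: coprimep1.
- by move=> p q hp hq; rewrite coprimepMr hp hq.
move=> i _; have -> : 1 - x i *: 'X = (- x i) *: ('X - (x i)^-1%:P).
  by rewrite scalerBr !scaleNr opprK scale_polyC mulfV// addrC.
rewrite coprimepZr ?oppr_eq0// coprimep_XsubC /root.
rewrite /node_numerator !hornerE horner_node_denominator (bigD1 i)//= mulVf// subrr !mul0r add0r.
rewrite horner_sum (bigD1 i)//= [X in _ * (_ + X)]big1 ?addr0.
  rewrite hornerZ horner_prod !mulf_neq0 ?expf_neq0 ?invr_eq0//.
  rewrite prodf_seq_neq0; apply/allP => j _; apply/implyP => ji.
  rewrite !hornerE subr_eq0 eq_sym; apply: contra ji => /eqP xji; apply/eqP/x_inj.
  by rewrite -[LHS](mulfVK (x0 i)) xji mul1r.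
move=> j ji; rewrite hornerZ horner_prod (bigD1 i)//= ?(eq_sym i)//.
have -> : (1 - x i *: 'X).[(x i)^-1] = 0 by rewrite !hornerE mulfV// subrr.
by rewrite mul0r mulr0.
Qed.

End partial_fractions.

(** * Pade approximants from Gaussian quadrature *)

Section pade_quadrature.
Context (R : realType) (b : R) (b0 : 0 < b).
Variable M : {measure set R -> \bar R}.
Hypothesis Mfin : (M setT < +oo)%E.
Variables (k : nat) (g : {poly R[i]}) (psi : R[i] -> R[i]).
Hypotheses (size_g : (size g <= k.+1)%N)
  (psiE : forall z, slit_plane b^-1%:E z -> psi z = g.[z] + z ^+ k.+1 * stieltjes b M z).
Variables (x w : forall n : nat, 'I_n -> R).
Arguments x : clear implicits.
Arguments w : clear implicits.
Hypothesis quad : forall n, (0 < n)%N -> [/\ forall i, 0 < x n i <= b, injective (x n),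
  (forall i, 0 < w n i) & forall j, (j < 2 * n)%N ->
  (\int[M]_(v in `]0%R, b]) (v ^+ j)%:E)%E = (\sum_(i < n) x n i ^+ j * w n i)%:E].
Implicit Types (z : R[i]).

Lemma slit_near_zero z : normc z < b^-1 -> slit_plane b^-1%:E z.
Proof.
move=> zb [_]; rewrite lee_fin leNgt => /negP; apply; apply: le_lt_trans zb.
by apply: le_trans (Re_le_normc _); exact: ler_norm.
Qed.

Let pade_num n : {poly R[i]} :=
  node_numerator (fun i => (x n i)%:C) (fun i => (w n i)%:C) k g.
Let pade_den n : {poly R[i]} := node_denominator (fun i => (x n i)%:C).

(** With the centre [0] the quadrature error is [O(z ^ (2 n))], and it is multiplied
    by [z ^ (k + 1)]. *)
Lemma pade_quadrature_is_pade n : (0 < n)%N ->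
  is_pade (n + k) n psi (pade_num n, pade_den n).
Proof.
move=> n0; have [xb xinj wpos q] := quad n0.
have x0 i : (x n i)%:C != 0.
  by rewrite -(rmorph0 (real_complex R)) (inj_eq (@complexI R)) gt_eqF//; have /andP[] := xb i.
have w0 i : (w n i)%:C != 0.
  by rewrite -(rmorph0 (real_complex R)) (inj_eq (@complexI R)) gt_eqF.
split.
- exact: size_node_numerator.
- exact: size_node_denominator.
- rewrite horner_node_denominator prodf_seq_neq0; apply/allP => i _ /=.
  by rewrite mul0r subr0 oner_eq0.
- by apply: coprime_node_fraction => // i j /complexI; exact: xinj.
exists (6 * fine (M setT) * b ^+ (2 * n)), (1 / (2 * b)); split.
  by rewrite divr_gt0// mulr_gt0.
move=> z; rewrite normcE_norm ltcR => zb.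
have zb' : normc z * b < 1 / 2.
  by move: zb; rewrite ltr_pdivlMr ?mulr_gt0//; lra.
have kern v : 0 <= v <= b -> 1 / 2 <= normc (1 - z * v%:C).
  by apply: (kernel_lower_near_zero b0); rewrite -div1r.
have zs : slit_plane b^-1%:E z.
  apply: slit_near_zero; rewrite -(ltr_pM2r b0) mulVf ?gt_eqF//; lra.
rewrite node_fractionE; last first.
  move=> i; have /andP[xi0 xib] := xb i.
  have : 1 / 2 <= normc (1 - z * (x n i)%:C) by apply: kern; rewrite xib ltW.
  by apply: contraTneq => ->; rewrite subrr normc0 -ltNge.
rewrite psiE// opprD addrACA subrr add0r -mulrBr normcE_norm -!rmorphXn -!rmorphM lecR.
have -> : (n + k + n + 1 = k.+1 + 2 * n)%N.
  by rewrite mul2n -addnn addn1 (addnC n k) -addnA -addSn.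
rewrite normcM normcX normcBC.
have r0 : 0 <= normc z * b by rewrite mulr_ge0 ?normc_ge0// ltW.
have := @quadrature_error _ b b0 M Mfin n (x n) (w n) n0 xb wpos q z 0 (normc z * b) (1 / 2) r0.
rewrite mul0r subr0 normc1 mulr1 => /(_ _ _ _ kern) err.
rewrite exprD mulrCA ler_wpM2l ?exprn_ge0 ?normc_ge0//.
apply: le_trans (err _ _ _) _; [lra|lra| |].
  move=> v /andP[v0 vb]; rewrite subr0 normcM normc_real ger0_norm// mulrC.
  by rewrite ler_wpM2l ?normc_ge0.
rewrite exprMn; move: (normc z ^+ _) (b ^+ _) => s t.
by rewrite le_eqVlt; apply/orP; left; apply/eqP; field.
Qed.

Lemma pade_quadratureE n z : (0 < n)%N -> (forall i, z * (x n i)%:C != 1) ->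
  pade (n + k) n psi z =
  g.[z] + z ^+ k.+1 * \sum_(i < n) (w n i)%:C / (1 - z * (x n i)%:C).
Proof.
move=> n0 zx; rewrite (padeE _ (pade_quadrature_is_pade n0)).
exact: node_fractionE.
Qed.

Lemma slit_node_neq1 n z : (0 < n)%N -> slit_plane b^-1%:E z ->
  forall i, z * (x n i)%:C != 1.
Proof.
move=> n0 zs i; have [xb _ _ _] := quad n0; have /andP[xi0 xib] := xb i.
have : 1 - z * (x n i)%:C != 0 by apply: (@slit_kernel_neq0 _ b) => //; rewrite xib ltW.
by rewrite subr_eq0 eq_sym.
Qed.

(** The centre given by [slit_kernel_geometry] serves a whole neighbourhood of [z0]. *)
Lemma pade_quadrature_local z0 : slit_plane b^-1%:E z0 -> exists (s C q : R),
  [/\ 0 < s, 0 < C, 0 < q & forall z n, normc (z - z0) < s -> (0 < n)%N ->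
    slit_plane b^-1%:E z ->
    normc (pade (n + k) n psi z - psi z) <= C * expR (- (q * n%:R))].
Proof.
move=> /(slit_kernel_geometry b0)[c [r [e [s [/andP[r0 r1] e0 s0 geom]]]]].
have Mge0 : 0 <= fine (M setT) by rewrite fine_ge0.
pose A := (normc z0 + s) ^+ k.+1.
have A0 : 0 <= A by rewrite exprn_ge0// addr_ge0 ?normc_ge0// ltW.
have D0 : 0 <= 3 / e * fine (M setT) by rewrite mulr_ge0// divr_ge0// ltW.
exists s, (A * (3 / e * fine (M setT)) + 1), (2 * (1 - r)); split=> //.
- by rewrite ltr_wpDl// mulr_ge0.
- by rewrite mulr_gt0// subr_gt0.
move=> z n zs n0 zslit; have [xb xinj wpos q] := quad n0.
rewrite pade_quadratureE//; last exact: slit_node_neq1.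
rewrite psiE// opprD addrACA subrr add0r -mulrBr normcM normcX.
have v00 : 0 <= (0 : R) <= b by rewrite lexx ltW.
have err := @quadrature_error _ b b0 M Mfin n (x n) (w n) n0 xb wpos q z c r e r0 e0
  (let: And3 _ _ h := geom z zs 0 v00 in h)
  (fun v vb => let: And3 h _ _ := geom z zs v vb in h)
  (fun v vb => let: And3 _ h _ := geom z zs v vb in h).
rewrite normcBC.
have zA : normc z ^+ k.+1 <= A.
  apply: lerXn2r; rewrite ?nnegrE ?normc_ge0 ?addr_ge0 ?normc_ge0 ?ltW//.
  have {1}-> : z = z0 + (z - z0) by ring.
  by apply: le_lt_trans (normcD_le _ _) _; rewrite ltrD2l.
have rn : r ^+ (2 * n) <= expR (- (2 * (1 - r) * n%:R)).
  have -> : - (2 * (1 - r) * n%:R) = (2 * n)%:R * - (1 - r) :> R.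
    by rewrite natrM; ring.
  rewrite expRM_natl; apply: lerXn2r; rewrite ?nnegrE ?expR_ge0//.
  by apply: le_trans (expR_ge1Dx _); lra.
apply: (@le_trans _ _ (A * (3 / e * fine (M setT) * r ^+ (2 * n)))).
  by apply: ler_pM; rewrite ?exprn_ge0 ?normc_ge0.
rewrite mulrA; apply: ler_pM => //; [exact: mulr_ge0|exact: exprn_ge0|by rewrite lerDl].
Qed.

(** The bounds [t^-1 exp (- t n)] weaken as [t] decreases to [0], so that the local
    ones have a common weakening on a compact set. *)
Lemma pade_quadrature_convergence (A : set R[i]) : compact (A : set R[i]^o) ->
  A `<=` slit_plane b^-1%:E -> exists c1 c2 : R, [/\ 0 < c1, 0 < c2 &
    forall z n, A z -> (0 < n)%N ->
      `|pade (n + k) n psi z - psi z| < (c1 * expR (- (c2 * n%:R)))%:C].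
Proof.
move=> /compact_near_coveringP cA As.
pose P (t : R) (z : R[i]^o) := forall n, (0 < n)%N -> slit_plane b^-1%:E z ->
  normc (pade (n + k) n psi z - psi z) <= t^-1 * expR (- (t * n%:R)).
have [t [t0 Pt]] : exists t : R, 0 < t /\ forall z, A z -> P t z.
  have : \forall t \near (0 : R)^'+, (A : set R[i]^o) `<=` P t.
    apply: cA => z0 /As /pade_quadrature_local[s [C [q [s0 C0 q0 h]]]].
    have s0' : 0 < s%:C :> R[i] by rewrite ltcR.
    exists (ball (z0 : R[i]^o) s%:C, [set t : R | 0 < t /\ t <= Num.min q C^-1]) => /=.
      split; first exact: nbhsx_ballx.
      near=> t; split => //; near: t; apply: nbhs_right_le.
      by rewrite lt_min q0 invr_gt0.
    move=> [z t] /= [zb [t0]]; rewrite le_min => /andP[tq tC] n n0 zslit.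
    have zs : normc (z - z0) < s.
      by move: zb; rewrite -ball_normE /ball_ /= normcE_norm ltcR normcBC.
    apply: le_trans (h z n zs n0 zslit) _; apply: ler_pM; rewrite ?expR_ge0 ?(ltW C0)//.
      by rewrite -[C]invrK lef_pV2 ?posrE ?invr_gt0.
    by rewrite ler_expR lerN2 ler_wpM2r.
  move=> H; have [t [t0 tA]] : exists t : R, 0 < t /\ (A : set R[i]^o) `<=` P t.
    have : \forall t \near (0 : R)^'+, 0 < t /\ (A : set R[i]^o) `<=` P t.
      by near=> t; split; [near: t; exact: nbhs_right_gt|near: t].
    by move/filter_ex.
  by exists t; split.
exists (t^-1 + 1), t; split=> //; first by rewrite addr_gt0 ?invr_gt0.
move=> z n Az n0; rewrite normcE_norm ltcR.
apply: le_lt_trans (Pt z Az n n0 (As _ Az)) _.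
by rewrite ltr_pM2r ?expR_gt0// ltrDl.
Unshelve. all: by end_near. Qed.

Lemma pade_quadrature_analytic n : (0 < n)%N ->
  analytic_on (slit_plane b^-1%:E) (pade (n + k) n psi).
Proof.
move=> n0 z0 z0s; have [xb _ _ _] := quad n0.
have [e [s [e0 s0 low]]] := slit_kernel_lower b0 z0s.
have A : analytic_at (fun z => g.[z] + z ^+ k.+1 *
    \sum_(i < n) (w n i)%:C / (1 - z * (x n i)%:C)) z0.
  have mulXn f j : analytic_at f z0 -> analytic_at (fun z => z ^+ j * f z) z0.
    move=> fA; elim: j => [|j IH]; first by under eq_fun do rewrite expr0 mul1r.
    by under eq_fun do rewrite exprS -mulrA; exact: analytic_atX.
  apply: analytic_atD.
    have -> : horner g = (fun z => \sum_(j < size g) g`_j * z ^+ j).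
      by apply/funext => z; exact: horner_coef.
    apply: analytic_at_sum => j; apply: analytic_atZ.
    by under eq_fun do rewrite -[_ ^+ _]mulr1; apply: mulXn; exact: analytic_at_cst.
  apply: mulXn; apply: analytic_at_sum => i; apply: analytic_atZ.
  apply: (@analytic_kernel _ b) => //; have /andP[x0 ->] := xb i; by rewrite ltW.
apply: (analytic_at_near s0 _ A) => z zs; rewrite pade_quadratureE// => i.
have /andP[xi0 xib] := xb i.
have : e <= normc (1 - z * (x n i)%:C) by apply: low => //; rewrite xib ltW.
by apply: contraTneq => ->; rewrite subrr normc0 -ltNge.
Qed.

End pade_quadrature.

(** * Extension of contents on bit sequences *)

Definition cantor_space (I : Type) := I -> bool.

HB.instance Definition _ (I : Type) := Pointed.copy (cantor_space I) (I -> bool).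

Definition cylinder (I : eqType) (A : set (cantor_space I)) : Prop :=
  exists l : seq I, forall f g : I -> bool, {in l, f =1 g} -> A f -> A g.

Lemma cylinder0 (I : eqType) : cylinder (@set0 (cantor_space I)).
Proof. by exists [::]. Qed.

Lemma cylinderU (I : eqType) : setU_closed (@cylinder I).
Proof.
move=> A B [l lA] [l' lB]; exists (l ++ l') => f g fg [Af|Bf].
  by left; apply: lA Af => i il; apply: fg; rewrite mem_cat il.
by right; apply: lB Bf => i il; apply: fg; rewrite mem_cat il orbT.
Qed.

Lemma cylinderC (I : eqType) : setC_closed (@cylinder I).
Proof.
move=> A [l lA]; exists l => f g fg; apply: contra_not => Ag.
by apply: lA Ag => i il; rewrite fg.
Qed.

Lemma cylinder_bit (I : eqType) (i : I) :
  cylinder [set f : cantor_space I | f i].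
Proof. by exists [:: i] => f g fg; rewrite /= fg ?mem_head. Qed.

(** If no finite union covered [A], then the points left over would have a limit along
    an ultrafilter, bit by bit; it lies in [A] and in no [F k], since membership in a
    cylinder depends on finitely many bits. *)
Lemma cylinder_compact (I : eqType) (A : set (cantor_space I))
    (F : nat -> set (cantor_space I)) :
  cylinder A -> (forall n, cylinder (F n)) -> A `<=` \bigcup_n F n ->
  exists n, A `<=` \big[setU/set0]_(k < n) F k.
Proof.
move=> [lA hA] cF AF; apply: contrapT => noN.
have /choice[f fP] n : exists f, A f /\ forall k, (k < n)%N -> ~ F k f.
  apply: contrapT => nof; apply: noN; exists n => g Ag.
  apply: contrapT => ng; apply: nof; exists g; split=> // k kn Fkg; apply: ng.
  by rewrite -bigcup_mkord; exists k.
have [U [UU oU]] := @ultraFilterLemma nat \oo _.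
pose g : I -> bool := fun i => `[< U [set n | f n i] >].
have Ug (l : seq I) : U [set n | {in l, g =1 f n}].
  elim: l => [|i l IHl]; first by apply: filterS filterT => n _ i; rewrite in_nil.
  have Ui : U [set n | g i = f n i].
    rewrite /g; case: asboolP => [Ui|nUi]; first by apply: filterS Ui => n /= ->.
    have [//|Ui] := in_ultra_setVsetC [set n | f n i] UU.
    by apply: filterS Ui => n /= /negP/negbTE ->.
  apply: filterS (filterI IHl Ui) => n [/= h1 h2] j; rewrite inE => /predU1P[->//|].
  exact: h1.
have [n gn] := filter_ex (Ug lA).
have [k _ Fkg] := AF g (hA _ _ (fun i il => esym (gn i il)) (fP n).1).
have [lk hk] := cF k.
have [m [gm km]] := filter_ex (filterI (Ug lk) (oU _ (nbhs_infty_gt k))).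
exact: (fP m).2 k km (hk _ _ gm Fkg).
Qed.

Definition cylinder_display : measure_display.
Proof. exact: default_measure_display. Qed.

HB.instance Definition _ (I : eqType) :=
  isAlgebraOfSets.Build cylinder_display (cantor_space I)
    (@cylinder0 I) (@cylinderU I) (@cylinderC I).

Section kolmogorov_extension.
Context (R : realType) (I : eqType) (p : set (cantor_space I) -> R).
Hypothesis p_ge0 : forall A, 0 <= p A.
Hypothesis pT : p setT = 1.
Hypothesis pU : forall A B, cylinder A -> cylinder B -> A `&` B = set0 ->
  p (A `|` B) = p A + p B.

Let content (A : set (cantor_space I)) := (p A)%:E.

Let content_ge0 A : (0 <= content A)%E.
Proof. by rewrite lee_fin. Qed.

Let content_additive : measure_function.semi_additive content.
Proof.
have p0 : content set0 = 0%E.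
  have /eqP := pU (@cylinder0 I) (@cylinder0 I) (setI0 _).
  by rewrite setU0 -subr_eq0 opprD addrA subrr sub0r oppr_eq0 /content => /eqP ->.
apply/(additive2P p0) => A B mA mB AB.
by rewrite /content pU// EFinD.
Qed.

HB.instance Definition _ :=
  isContent.Build _ _ _ content content_ge0 content_additive.

Let content_sigma_subadditive : measurable_subset_sigma_subadditive content.
Proof.
move=> A F mF mA AF.
have [n AFn] := cylinder_compact mA mF AF.
apply: (@le_trans _ _ (\sum_(k < n) content (F k))%E).
  by apply: content_subadditive => //.
rewrite -(big_mkord xpredT (fun k => content (F k))).
by apply: nneseries_lim_ge => k _ _; exact: content_ge0.
Qed.

HB.instance Definition _ :=
  Content_SigmaSubAdditive_isMeasure.Build _ _ _ content
    content_sigma_subadditive.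

Let ext := measure_extension content.

HB.instance Definition _ := Measure.on ext.

Let extT : ext setT = 1%E.
Proof.
rewrite /ext /measure_extension measurable_mu_extE; last first.
  exact: (@measurableT _ (cantor_space I)).
by rewrite /= /content pT.
Qed.

HB.instance Definition _ := Measure_isProbability.Build _ _ _ ext extT.

(** By compactness a finitely additive content on the cylinders is countably additive,
    and extends to the generated sigma-algebra. *)
Lemma kolmogorov_extension :
  exists P : probability
      (g_sigma_algebraType (@measurable _ (cantor_space I))) R,
    forall A : set (cantor_space I), cylinder A -> P A = (p A)%:E.
Proof.
by exists ext => A cA; rewrite /= /ext /measure_extension measurable_mu_extE.
Qed.

End kolmogorov_extension.


(** What the marginals [m t] of a Levy process satisfy; the last clause is stochastic
    continuity at time [0]. *)
Definition convolution_semigroup (R : realType) (m : R -> probability R R) :=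
  [/\ forall B, measurable B -> m 0 B = \d_(0 : R) B,
      forall s t, 0 <= s -> 0 <= t -> forall B, measurable B ->
        m (s + t) B = (\int[m t]_(y in setT) m s [set x : R | B (x + y)%R])%E &
      forall e, 0 < e -> m h [set x : R | e < `|x|] @[h --> 0^'+] --> 0%E].

Lemma measurable_tail (R : realType) (e : R) : measurable [set x : R | e < `|x|].
Proof.
rewrite (_ : mkset _ = ~` `[- e, e]%classic); first exact: measurableC.
by apply/seteqP; split=> x; rewrite /= in_itv /= -ler_norml ltNge => /negP.
Qed.

Lemma measurable_translate (R : realType) (y : R) (B : set R) :
  measurable B -> measurable [set x : R | B (x + y)].
Proof.
move=> mB; rewrite -[X in measurable X]setTI.
by apply: (measurable_funD (f := id) (g := cst y)) mB => //.
Qed.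

Lemma measurable_translated_measure (R : realType)
    (P : {sigma_finite_measure set R -> \bar R}) (B : set R) :
  measurable B -> measurable_fun setT (fun y : R => P [set x : R | B (x + y)]).
Proof.
move=> mB; pose A := [set z : R * R | B (z.1 + z.2)].
have mA : measurable A.
  rewrite -[X in measurable X]setTI.
  by apply: (measurable_funD (f := fst) (g := snd)) mB => //.
have := measurable_fun_ysection P mA; congr measurable_fun.
by apply/funext => y /=; congr (P _); apply/seteqP; split=> x; rewrite /ysection /= inE.
Qed.

Lemma forall_ltnS_set (T : Type) (Q : nat -> T -> Prop) (m : nat) :
  [set w | forall j, (j < m.+1)%N -> Q j w] =
  [set w | forall j, (j < m)%N -> Q j w] `&` [set w | Q m w].
Proof.
apply/seteqP; split=> w /= => [h|[h1 h2] j].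
  by split; [move=> j jm; apply: h; rewrite ltnS ltnW|exact: h].
by rewrite ltnS leq_eqVlt => /predU1P[->//|]; exact: h1.
Qed.

Lemma measurable_forall_ltn d (T : measurableType d) (Q : nat -> T -> Prop)
    (m : nat) : (forall j, (j < m)%N -> measurable [set w | Q j w]) ->
  measurable [set w | forall j, (j < m)%N -> Q j w].
Proof.
elim: m => [_|m IHm mQ].
  by rewrite (_ : mkset _ = setT)//; apply/seteqP; split.
rewrite forall_ltnS_set; apply: measurableI; last exact: mQ.
by apply: IHm => j jm; apply: mQ; rewrite ltnS ltnW.
Qed.

(** Restricted to a set [T] of times, since a process is first built on finitely many. *)
Definition increments_law (R : realType) (m : R -> probability R R)
    d (Omega : measurableType d) (P : probability Omega R)
    (X : R -> Omega -> R) (T : set R) :=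
  forall (n : nat) (t : nat -> R) (B : nat -> set R),
    (forall i, (i <= n)%N -> T (t i)) ->
    (forall i, (i < n)%N -> t i <= t i.+1) ->
    (forall i, measurable (B i)) ->
    P [set w | forall i, (i < n)%N -> B i (X (t i.+1) w - X (t i) w)] =
    (\prod_(i < n) m (t i.+1 - t i)%R (B i))%E.

Lemma measurable_increments (R : realType) d (Omega : measurableType d)
    (X : R -> Omega -> R) (n : nat) (t : nat -> R) (B : nat -> set R) :
  (forall s, measurable_fun setT (X s)) -> (forall i, measurable (B i)) ->
  measurable [set w | forall i, (i < n)%N -> B i (X (t i.+1) w - X (t i) w)].
Proof.
move=> mX mB; apply: measurable_forall_ltn => j _.
rewrite -[X in measurable X]setTI.
by apply: (measurable_funB (f := X (t j.+1)) (g := X (t j))) (mB j).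
Qed.

(** A repeated time contributes a zero increment. *)
Lemma increments_law_const (R : realType) (m : R -> probability R R)
    d (Omega : measurableType d) (P : probability Omega R)
    (X : R -> Omega -> R) (n : nat) (t : nat -> R) (B : nat -> set R) :
  (forall B, measurable B -> m 0 B = \d_(0 : R) B) ->
  (forall i, measurable (B i)) -> t n.+1 = t n ->
  P [set w | forall i, (i < n)%N -> B i (X (t i.+1) w - X (t i) w)] =
    (\prod_(i < n) m (t i.+1 - t i)%R (B i))%E ->
  P [set w | forall i, (i < n.+1)%N -> B i (X (t i.+1) w - X (t i) w)] =
    (\prod_(i < n.+1) m (t i.+1 - t i)%R (B i))%E.
Proof.
move=> m0 mB tn IH.
rewrite forall_ltnS_set big_ord_recr /= -IH tn subrr m0// diracE.
have [/set_mem Bn|/negP nBn] := boolP (_ \in _).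
  rewrite mule1; congr (P _); apply/seteqP; split=> w /=; first by case.
  by split=> //; rewrite subrr.
rewrite mule0 (_ : _ `&` _ = set0) ?measure0//.
by apply/seteqP; split=> w //= [_]; rewrite subrr => /mem_set.
Qed.

Lemma path_lt_le_last (R : realType) (x : R) (s : seq R) :
  path <%R x s -> forall v, v \in x :: s -> v <= last x s.
Proof.
elim: s x => [|y s IHs] x /=; first by move=> _ v; rewrite inE => /eqP ->.
move=> /andP[xy ys] v; rewrite inE => /predU1P[->|]; last exact: IHs.
by rewrite (le_trans (ltW xy))// IHs// mem_head.
Qed.

(** The times are added from left to right, each with a new independent increment on a
    product space. *)
Lemma finite_times_process (R : realType) (m : R -> probability R R) (s : seq R) :
  convolution_semigroup m -> path <%R 0 s ->
  exists d (Omega : measurableType d) (P : probability Omega R)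
    (X : R -> Omega -> R),
    (forall t, measurable_fun setT (X t)) /\
    increments_law m P X [set t | t \in 0 :: s].
Proof.
move=> [m0 mD _]; elim/last_ind: s => [_|s u IH].
  exists _, unit, \d_tt, (fun _ _ => 0); split=> // n t B tT tn mB.
  have t0 i : (i <= n)%N -> t i = 0 by move=> /tT /=; rewrite inE => /eqP.
  elim: n {tT tn} t0 => [|n IHn] t0.
    rewrite big_ord0 (_ : [set _ | _] = setT) ?probability_setT//.
    by apply/seteqP; split.
  apply: (@increments_law_const R m _ _ _ (fun _ _ => 0)) => //.
    by rewrite !t0.
  by apply: IHn => i ni; apply: t0; rewrite leqW.
rewrite rcons_path => /andP[s_sorted].
have [d [T [P [X [mX PX]]]]] := IH s_sorted.
set r := last 0 s => ru {IH}.
have le_r v : v \in 0 :: s -> v <= r.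
  exact: path_lt_le_last.
have r0 : 0 <= r by apply: le_r; rewrite mem_head.
pose Y t (w : R * T) := if t == u then X r w.2 + w.1 else X t w.2.
have mY t : measurable_fun setT (Y t).
  rewrite /Y; case: eqVneq => _; last exact: measurableT_comp.
  by apply: measurable_funD => //; exact: measurableT_comp.
exists _, _, (m (u - r)%R \x P)%E, Y; split => // n t B.
elim: n => [|n IHn] tT tn mB.
  rewrite big_ord0 (_ : mkset _ = setT) ?probability_setT//.
  by apply/seteqP; split.
have tle i j : (i <= j)%N -> (j <= n.+1)%N -> t i <= t j.
  elim: j => [|j IHj]; first by rewrite leqn0 => /eqP ->.
  rewrite leq_eqVlt => /predU1P[-> //|]; rewrite ltnS => ij jn.
  by apply: le_trans (tn j jn); apply: IHj => //; exact: ltnW.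
have old i : (i <= n.+1)%N -> t i != u -> t i \in 0 :: s.
  by move=> /tT /=; rewrite -rcons_cons mem_rcons inE => /orP[->|].
have [tnu|tnu] := eqVneq (t n.+1) u; last first.
  have tu i : (i <= n.+1)%N -> t i != u.
    move=> ni; rewrite lt_eqF//; apply: le_lt_trans ru; apply: le_trans (le_r _ (old _ _ tnu)) => //.
    exact: tle.
  rewrite -(PX n.+1 t B)//; last by move=> i ni; apply: old => //; exact: tu.
  set E := [set w : T | forall i, (i < n.+1)%N -> B i (X (t i.+1) w - X (t i) w)].
  have mE : measurable E by exact: (@measurable_increments R d T X n.+1 t B mX mB).
  have -> : [set w | forall i, (i < n.+1)%N -> B i (Y (t i.+1) w - Y (t i) w)] =
      setT `*` E.
    apply/seteqP; split=> -[y w] /=.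
      by move=> h; split=> // i ni; have := h i ni; rewrite /Y !(negbTE (tu _ _))// ltnW.
    by move=> [_ h] i ni; rewrite /Y !(negbTE (tu _ _))//; [exact: h|exact: ltnW].
  transitivity (m (u - r)%R setT * P E)%E; last by rewrite probability_setT mul1e.
  exact: product_measure1E.
have [tu|tu] := eqVneq (t n) u.
  apply: increments_law_const => //; first by rewrite tnu tu.
  by apply: IHn => // i ni; [apply: tT; rewrite leqW|apply: tn; rewrite ltnS ltnW].
pose t' i := if (i <= n)%N then t i else r.
have tu' i : (i <= n)%N -> t i != u.
  move=> ni; rewrite lt_eqF//; apply: le_lt_trans ru.
  by apply: le_trans (le_r _ (old _ _ tu)) => //; exact: tle.
pose B' y i := if (i < n)%N then B i else [set x : R | B n (x + y)].
have tr : t n <= r by apply: le_r; exact: old.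
set E := [set w | _].
transitivity (\int[m (u - r)%R]_y P (xsection E y))%E; first by [].
transitivity (\int[m (u - r)%R]_y ((\prod_(i < n) m (t i.+1 - t i)%R (B i)) *
    m (r - t n)%R [set x : R | B n (x + y)%R]))%E.
  apply: eq_integral => y _.
  rewrite (_ : xsection _ y = [set w | forall i, (i < n.+1)%N ->
      B' y i (X (t' i.+1) w - X (t' i) w)]); last first.
    rewrite forall_ltnS_set /E; apply/seteqP; split=> w; rewrite /xsection /= inE /=.
      move=> h; split.
        move=> i ni; have := h i (leqW ni); rewrite /B' /t' ni (ltnW ni) /Y.
        by rewrite !(negbTE (tu' _ _))// ltnW.
      move: (h n (leqnn _)); rewrite /B' /t' ltnn leqnn /Y tnu eqxx /= (negbTE tu).
      by rewrite addrAC.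
    move=> [h1 h2] i; rewrite ltnS leq_eqVlt => /predU1P[->|ni].
      move: h2; rewrite /B' /t' ltnn leqnn /Y tnu eqxx /= (negbTE tu).
      by rewrite addrAC.
    have := h1 i ni; rewrite /B' /t' ni (ltnW ni) /Y.
    by rewrite !(negbTE (tu' _ _))// ltnW.
  rewrite PX; first last.
  - by move=> i; rewrite /B'; case: ifPn => // _; exact: measurable_translate.
  - move=> i; rewrite ltnS /t' => ni; rewrite ni.
    case: ltnP => // ni'; first by apply: tn; rewrite ltnS ltnW.
    by have -> : i = n by apply/eqP; rewrite eqn_leq ni.
  - move=> i _; rewrite /t'; case: leqP => [ni|_] /=; last by rewrite mem_last.
    by apply: old; rewrite ?leqW// tu'.
  rewrite big_ord_recr /= /t' ltnn leqnn {2}/B' ltnn.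
  by congr (_ * _)%E; apply: eq_bigr => i _; rewrite /B' ltn_ord ltnW// ltn_ord.
rewrite [X in _ = X]big_ord_recr /= tnu.
rewrite ge0_integralZl//.
- have -> : u - t n = (r - t n) + (u - r) by ring.
  by rewrite mD// subr_ge0// ltW.
- exact: measurable_translated_measure.
- by apply: prode_ge0 => i _.
Qed.


(** An enumeration of the rationals: comparisons with them determine a real number. *)
Definition threshold (R : realType) (i : nat) : R :=
  ratr (odflt 0 (unpickle i) : rat).

Lemma threshold_dense (R : realType) (a b : R) :
  a < b -> exists i, a < threshold R i < b.
Proof.
move=> ab; have [q] := rat_in_itvoo ab.
by rewrite in_itv /= => qab; exists (pickle q); rewrite /threshold pickleK.
Qed.

(** An increment is coded by the set of rationals below it. A process on all times is
    then a random point of a Cantor space, where laws extend by compactness. *)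
Definition increment_bits (R : realType) (T : Type) (X : R -> T -> R) (w : T) :
    cantor_space (R * R * nat) :=
  fun i => threshold R i.2 <= X i.1.2 w - X i.1.1 w.

Lemma measurable_cylinder_preimage d (T : measurableType d) (I : eqType)
    (b : T -> cantor_space I) (A : set (cantor_space I)) :
  (forall i, measurable [set w | b w i]) -> cylinder A ->
  measurable [set w | A (b w)].
Proof.
move=> mb [l]; elim: l A => [|i l IHl] A hA.
  have [[f Af]|nA] := pselect (A !=set0).
    rewrite (_ : mkset _ = setT)//; apply/seteqP; split=> // w _ /=.
    exact: hA Af.
  rewrite (_ : mkset _ = set0)//; apply/seteqP; split=> // w Aw.
  by apply: nA; exists (b w).
pose force v (f : cantor_space I) : cantor_space I :=
  fun j => if j == i then v else f j.
have -> : [set w | A (b w)] =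
    ([set w | b w i] `&` [set w | A (force true (b w))]) `|`
    (~` [set w | b w i] `&` [set w | A (force false (b w))]).
  have forceE v w : b w i = v -> force v (b w) = b w.
    by move=> biv; apply/funext => j; rewrite /force; case: eqVneq => [->|].
  apply/seteqP; split=> w /=.
    move=> Aw; case bi : (b w i); [left|right].
      by rewrite forceE.
    by rewrite forceE.
  by move=> [[bi]|[/negP/negbTE bi]]; rewrite forceE.
have mforce v : measurable [set w | A (force v (b w))].
  apply: (IHl [set f | A (force v f)]) => f g fg /=; apply: hA => j.
  rewrite inE /force; case: eqVneq => //= _; exact: fg.
apply: measurableU; apply: measurableI => //; exact: measurableC.
Qed.

(** For the coded increments: the [i]-th one is at most [r i], as far as the first [N]
    rationals can tell. *)
Definition bits_below (R : realType) (n N : nat) (t r : nat -> R) :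
    set (cantor_space (R * R * nat)) :=
  [set f | forall i, (i < n)%N -> forall j, (j < N)%N ->
     r i < threshold R j -> ~~ f (t i, t i.+1, j)].

Definition below (R : realType) (N : nat) (r : R) : set R :=
  [set x | forall j, (j < N)%N -> r < threshold R j -> x < threshold R j].

(** If [q_i + q_j <= q_k], these bits say that the increment over [[a, c]] exceeds the
    sum of those over [[a, b]] and [[b, c]]; [bits_defect] says that it falls short of
    the sum, if [q_k <= q_i + q_j]. *)
Definition bits_excess (R : realType) (a b c : R) (i j k : nat) :
    set (cantor_space (R * R * nat)) :=
  [set f : cantor_space (R * R * nat) | [/\ ~~ f (a, b, i), ~~ f (b, c, j) & f (a, c, k)]].

Definition bits_defect (R : realType) (a b c : R) (i j k : nat) :
    set (cantor_space (R * R * nat)) :=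
  [set f : cantor_space (R * R * nat) | [/\ f (a, b, i), f (b, c, j) & ~~ f (a, c, k)]].

Lemma cylinder_bits_below (R : realType) n N (t r : nat -> R) :
  cylinder (bits_below n N t r).
Proof.
exists [seq (t i, t i.+1, j) | i <- iota 0 n, j <- iota 0 N] => f g fg h i ni j jN rj.
rewrite -fg; first exact: h.
by apply: allpairs_f; rewrite mem_iota.
Qed.

Lemma cylinder_bits_excess (R : realType) (a b c : R) i j k :
  cylinder (bits_excess a b c i j k).
Proof.
exists [:: (a, b, i); (b, c, j); (a, c, k)] => f g fg [h1 h2 h3].
by split; rewrite -fg// !inE eqxx ?orbT.
Qed.

Lemma cylinder_bits_defect (R : realType) (a b c : R) i j k :
  cylinder (bits_defect a b c i j k).
Proof.
exists [:: (a, b, i); (b, c, j); (a, c, k)] => f g fg [h1 h2 h3].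
by split; rewrite -fg// !inE eqxx ?orbT.
Qed.

Lemma measurable_below (R : realType) N (r : R) : measurable (below N r).
Proof.
apply: measurable_forall_ltn => j _.
have [rj|rj] := ltP r (threshold R j).
  rewrite (_ : mkset _ = `]-oo, threshold R j[%classic)//.
  by apply/seteqP; split=> x /=; rewrite in_itv /= => h; [exact: h|move=> _].
rewrite (_ : mkset _ = setT)//.
by apply/seteqP; split=> x //= _; rewrite ltNge rj.
Qed.

(** The law of the bits of a process on the times [s]. On the cylinders listed last its
    values do not depend on [s], which makes the laws for various [s] consistent. *)
Lemma finite_times_content (R : realType) (m : R -> probability R R)
    (s : seq R) : convolution_semigroup m ->
  exists q : set (cantor_space (R * R * nat)) -> R,
    [/\ forall A, 0 <= q A,
        forall A, cylinder A -> q A <= 1,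
        q setT = 1,
        forall A B, cylinder A -> cylinder B -> A `&` B = set0 ->
          q (A `|` B) = q A + q B &
      [/\ forall n N (t r : nat -> R), 0 <= t 0%N -> (forall i, t i <= t i.+1) ->
          (forall i, (i <= n)%N -> t i \in s) ->
          q (bits_below n N t r) =
            \prod_(i < n) fine (m (t i.+1 - t i) (below N (r i))),
        forall a b c i j k, threshold R i + threshold R j <= threshold R k ->
          q (bits_excess a b c i j k) = 0 &
        forall a b c i j k, threshold R k <= threshold R i + threshold R j ->
          q (bits_defect a b c i j k) = 0 ]].
Proof.
move=> sg; pose s' := sort <=%R (undup [seq x <- s | 0 < x]).
have s'_path : path <%R 0 s'.
  rewrite lt_path_sortedE; apply/andP; split.
    by apply/allP => x; rewrite mem_sort mem_undup mem_filter => /andP[].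
  by rewrite sort_lt_sorted undup_uniq.
have [d [T [P [X [mX PX]]]]] := finite_times_process sg s'_path.
pose b : T -> cantor_space (R * R * nat) := increment_bits X.
have mb i : measurable [set w | b w i].
  rewrite /b /increment_bits -[X in measurable X]setTI.
  have := measurable_funB (mX i.1.2) (mX i.1.1).
  move=> /(_ measurableT `[threshold R i.2, +oo[%classic).
  rewrite (_ : _ @^-1` _ = [set w | threshold R i.2 <= X i.1.2 w - X i.1.1 w]).
    by apply; exact: measurable_itv.
  by apply/seteqP; split=> w /=; rewrite in_itv /= andbT.
have mA A : cylinder A -> measurable [set w | A (b w)].
  exact: measurable_cylinder_preimage.
exists (fun A => fine (P [set w | A (b w)])); split.
- by move=> A; exact/fine_ge0.
- by move=> A /mA cA; rewrite -lee_fin fineK ?probability_le1// fin_num_measure.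
- by rewrite (_ : [set w | _] = setT) ?probability_setT.
- move=> A B cA cB AB; rewrite (_ : [set w | _] = [set w | A (b w)] `|` [set w | B (b w)])//.
  rewrite measureU//; try exact: mA.
    by rewrite fineD// fin_num_measure//; exact: mA.
  by apply/seteqP; split=> w //= [Aw Bw]; have : set0 (b w) by rewrite -AB.
split.
- move=> n N t r t0 tn ts.
  have tge0 i : 0 <= t i by elim: i => // i; move/le_trans; apply.
  pose B i := below N (r i).
  rewrite (_ : [set w | _] = [set w | forall i, (i < n)%N ->
      B i (X (t i.+1) w - X (t i) w)]); last first.
    apply/seteqP; split=> w /= h i ni j jN rj.
      by have := h i ni j jN rj; rewrite /b /increment_bits /= -ltNge.
    by rewrite /b /increment_bits /= -ltNge; exact: h.
  rewrite PX//; last by move=> i; exact: measurable_below.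
    elim: n {ts} => [|n IHn]; first by rewrite !big_ord0.
    rewrite !big_ord_recr /= -IHn fineM//; last first.
      by rewrite fin_num_measure//; exact: measurable_below.
    rewrite ge0_fin_numE; last by apply: prode_ge0.
    elim: n {IHn} => [|n IHn]; first by rewrite big_ord0 ltry.
    rewrite big_ord_recr /= lte_mul_pinfty//; first by apply: prode_ge0.
      by rewrite ge0_fin_numE//; apply: prode_ge0.
    by rewrite -ge0_fin_numE// fin_num_measure//; exact: measurable_below.
  move=> i ni /=; rewrite inE mem_sort mem_undup mem_filter ts// andbT.
  by rewrite eq_sym -le_eqVlt tge0.
- move=> a b' c i j k ijk; rewrite (_ : [set w | _] = set0) ?measure0//.
  apply/seteqP; split=> w //=; rewrite /bits_excess /b /increment_bits /=.
  by move=> [+ + +]; lra.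
- move=> a b' c i j k ijk; rewrite (_ : [set w | _] = set0) ?measure0//.
  apply/seteqP; split=> w //=; rewrite /bits_defect /b /increment_bits /=.
  by move=> [+ + +]; lra.
Qed.

(** * The law of the increment bits *)

Lemma ultrafilter_limit (R : realType) (T : Type) (U : set_system T)
    (f : T -> R) : UltraFilter U -> (forall x, 0 <= f x <= 1) ->
  exists2 l : R, 0 <= l & f x @[x --> U] --> l.
Proof.
move=> UU f01.
have fU : (f x @[x --> U]) `[0, 1]%classic.
  by rewrite /fmap /=; apply: filterS filterT => x _ /=; rewrite in_itv /= f01.
have [l [l01 cl]] := @segment_compact R 0 1 (f x @[x --> U]) _ fU.
exists l; first by move: l01; rewrite /= in_itv /= => /andP[].
move=> V lV; have [//|UnV] := in_ultra_setVsetC (f @^-1` V) UU.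
have [x [nVx Vx]] := cl (~` V) V UnV lV.
by [].
Qed.

(** Eventually along larger and larger finite sets of times. *)
Definition finset_filter (T : eqType) : set_system (seq T) :=
  [set S : set (seq T) | exists s0 : seq T, forall s : seq T, {subset s0 <= s} -> S s].

Lemma finset_filter_proper (T : eqType) : ProperFilter (@finset_filter T).
Proof.
apply: Build_ProperFilter.
  by move=> [s0 /(_ s0)]; apply.
split; first by exists [::].
  move=> S S' [s hs] [s' hs']; exists (s ++ s') => r hr; split.
    by apply: hs => x xs; apply: hr; rewrite mem_cat xs.
  by apply: hs' => x xs; apply: hr; rewrite mem_cat xs orbT.
by move=> S S' SS' [s hs]; exists s => r /hs /SS'.
Qed.

(** An ultrafilter limit, along the finite sets of times, of the laws of the processes
    on them: it is finitely additive and keeps the values that are eventually constant. *)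
Lemma increment_bits_measure (R : realType) (m : R -> probability R R) :
  convolution_semigroup m ->
  exists P : probability (g_sigma_algebraType
      (@measurable _ (cantor_space (R * R * nat)))) R,
    [/\ forall n N (t r : nat -> R), 0 <= t 0%N -> (forall i, t i <= t i.+1) ->
          P (bits_below n N t r) =
            (\prod_(i < n) fine (m (t i.+1 - t i)%R (below N (r i))))%:E,
        forall a b c i j k, threshold R i + threshold R j <= threshold R k ->
          P (bits_excess a b c i j k) = 0%E &
        forall a b c i j k, threshold R k <= threshold R i + threshold R j ->
          P (bits_defect a b c i j k) = 0%E ].
Proof.
move=> sg; have /choice[q qP] := fun s => @finite_times_content R m s sg.
have [U [UU FU]] := ultraFilterLemma (@finset_filter_proper R).
have /choice[p pP] : forall A : set (cantor_space (R * R * nat)),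
    exists l : R, 0 <= l /\ (cylinder A -> q s A @[s --> U] --> l).
  move=> A; have [cA|nA] := pselect (cylinder A); last by exists 0; split.
  have [|l l0 ql] := @ultrafilter_limit R _ U (q^~ A) UU.
    by move=> s; have [q0 q1 _ _ _] := qP s; rewrite q0 q1.
  by exists l; split.
have p_cst A l : cylinder A -> (exists s0 : seq R, forall s : seq R, {subset s0 <= s} -> q s A = l) ->
    p A = l.
  move=> cA [s0 ql]; have [_ /(_ cA) qA] := pP A.
  apply: (cvg_unique _ qA); first exact: norm_hausdorff.
  have /cvg_near_cst : \forall s \near U, q s A = l by apply: FU; exists s0.
  exact.
have p_ge0 A : 0 <= p A by have [] := pP A.
have pT : p setT = 1.
  apply: p_cst; first by exists [::].
  by exists [::] => s _; have [] := qP s.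
have pU A B : cylinder A -> cylinder B -> A `&` B = set0 -> p (A `|` B) = p A + p B.
  move=> cA cB AB; have [_ /(_ cA) qA] := pP A; have [_ /(_ cB) qB] := pP B.
  have [_ /(_ (cylinderU cA cB)) qAB] := pP (A `|` B).
  apply: (cvg_unique _ qAB); first exact: norm_hausdorff.
  rewrite (_ : (fun s => q s (A `|` B)) = (fun s => q s A + q s B)); last first.
    by apply/funext => s; have [_ _ _ ->] := qP s.
  exact: cvgD.
have [P PE] := kolmogorov_extension p_ge0 pT pU.
exists P; split.
- move=> n N t r t0 tn; rewrite PE; last exact: cylinder_bits_below.
  congr EFin; apply: p_cst; first exact: cylinder_bits_below.
  exists [seq t i | i <- iota 0 n.+1] => s hs; have [_ _ _ _ [-> //]] := qP s.
  by move=> i ni; apply: hs; apply: map_f; rewrite mem_iota.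
- move=> a b c i j k ijk; rewrite PE; last exact: cylinder_bits_excess.
  congr EFin; apply: p_cst; first exact: cylinder_bits_excess.
  by exists [::] => s _; have [_ _ _ _ [_ -> //]] := qP s.
- move=> a b c i j k ijk; rewrite PE; last exact: cylinder_bits_defect.
  congr EFin; apply: p_cst; first exact: cylinder_bits_defect.
  by exists [::] => s _; have [_ _ _ _ [_ _ -> //]] := qP s.
Qed.

(** * From half-lines to Borel sets *)

Lemma borel_halfline_ind (R : realType) (Q : set R -> Prop) : Q setT ->
  (forall r : R, Q `]-oo, r]%classic) ->
  (forall S, measurable S -> Q S -> Q (~` S)) ->
  (forall F : nat -> set R, (forall n, measurable (F n)) -> trivIset setT F ->
     (forall n, Q (F n)) -> Q (\bigcup_n F n)) ->
  forall S, measurable S -> Q S.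
Proof.
move=> QT Qr QC QU S mS.
pose G := [set B : set R | exists r : R, B = `]-oo, r]%classic].
have GE : (measurable : set (set R)) = <<s G >>.
  apply/seteqP; split; last first.
    by apply: smallest_sub => [|_ [r ->]]; [exact: sigma_algebra_measurable|].
  rewrite [X in X `<=` _](RGenOInfty.measurableE R).
  apply: smallest_sub; first exact: smallest_sigma_algebra.
  move=> _ [r ->]; rewrite (_ : [set` _] = ~` `]-oo, r]%classic); last by rewrite setCitvl.
  by apply: sigma_algebraC; apply: sub_sigma_algebra; exists r.
apply: (@dynkin_induction _ R G) => //; last by rewrite -GE.
- move=> _ _ [r ->] [r' ->]; exists (Num.min r r').
  by apply/seteqP; split=> x /=; rewrite !in_itv /= le_min => /andP.
- by move=> _ [r ->].
Qed.

(** The half-lines are replaced by Borel sets one coordinate at a time; for each, the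
    Borel sets that are allowed form a Dynkin system. *)
Lemma halfline_product d (T : measurableType d) (R : realType)
    (P : probability T R) (Y : nat -> T -> R) (nu : nat -> probability R R) :
  (forall i, measurable_fun setT (Y i)) ->
  (forall n (r : nat -> R), P [set w | forall i, (i < n)%N -> Y i w <= r i] =
     (\prod_(i < n) fine (nu i `]-oo, r i]%classic))%:E) ->
  forall n (B : nat -> set R), (forall i, measurable (B i)) ->
  P [set w | forall i, (i < n)%N -> B i (Y i w)] = (\prod_(i < n) fine (nu i (B i)))%:E.
Proof.
move=> mY hP n; suff main k : forall B : nat -> set R, (forall i, measurable (B i)) ->
    (forall i, (k <= i)%N -> (i < n)%N -> exists r : R, B i = `]-oo, r]%classic) ->
    P [set w | forall i, (i < n)%N -> B i (Y i w)] = (\prod_(i < n) fine (nu i (B i)))%:E.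
  by move=> B mB; apply: (main n) => // i ni; rewrite ltnNge ni.
elim: k => [|k IHk] B mB Br.
  have /choice[r rP] : forall i, exists r : R, (i < n)%N -> B i = `]-oo, r]%classic.
    move=> i; have [ni|_] := ltnP i n; last by exists 0.
    by have [r ->] := Br i (leq0n i) ni; exists r.
  have -> : [set w | forall i, (i < n)%N -> B i (Y i w)] =
      [set w | forall i, (i < n)%N -> Y i w <= r i].
    apply/seteqP; split=> w /= h i ni; have := h i ni.
      by rewrite rP //= in_itv.
    by rewrite rP //= in_itv.
  by rewrite hP; congr EFin; apply: eq_bigr => i _; rewrite rP.
have [nk|kn] := leqP n k.
  by apply: IHk => // i ki; rewrite ltnNge (leq_trans nk ki).
pose E := [set w | forall i, (i < n)%N -> i != k -> B i (Y i w)].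
have mYB (i : nat) S : measurable S -> measurable [set w | S (Y i w)].
  by move=> mS; rewrite -[X in measurable X]setTI; exact: (mY i).
have mE : measurable E.
  apply: measurable_forall_ltn => i _; case: eqVneq => _ /=.
    by rewrite (_ : mkset _ = setT)//; apply/seteqP; split.
  rewrite (_ : mkset _ = [set w | B i (Y i w)]); first exact: mYB.
  by apply/seteqP; split=> w //=; exact.
pose c := \prod_(i < n | i != Ordinal kn) fine (nu i (B i)).
pose upd S : nat -> set R := fun i => if i == k then S else B i.
have updE S : [set w | forall i, (i < n)%N -> upd S i (Y i w)] =
    E `&` [set w | S (Y k w)].
  apply/seteqP; split=> w /=.
    move=> h; split; last by have := h k kn; rewrite /upd eqxx.
    by move=> i ni ik; have := h i ni; rewrite /upd (negbTE ik).
  by move=> [h1 h2] i ni; rewrite /upd; case: eqVneq => [->//|]; exact: h1.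
have updP S : \prod_(i < n) fine (nu i (upd S i)) = fine (nu k S) * c.
  rewrite (bigD1 (Ordinal kn))//= /upd eqxx; congr (_ * _).
  by apply: eq_bigr => i; rewrite -val_eqE /= => /negbTE ->.
have half (r : R) : P (E `&` [set w | Y k w <= r]) =
    (fine (nu k `]-oo, r]%classic) * c)%:E.
  rewrite -updP -IHk.
  - by rewrite updE; congr (P (_ `&` _)).
  - by move=> i; rewrite /upd; case: ifP.
  - move=> i; rewrite /upd leq_eqVlt => /predU1P[<-|ki] ni; first by rewrite eqxx; exists r.
    by rewrite gtn_eqF//; exact: Br.
have PET : P E = c%:E.
  have Er : \bigcup_j (E `&` [set w | Y k w <= j%:R]) = E.
    apply/seteqP; split=> w; first by case=> j _ [].
    move=> Ew; exists (Num.truncn (Num.max 0 (Y k w))).+1 => //; split=> //=.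
    apply/ltW; apply: le_lt_trans (truncnS_gt _).
    by rewrite le_max lexx orbT.
  have h1 : P (E `&` [set w | Y k w <= j%:R]) @[j --> \oo] --> P E.
    rewrite -[X in _ --> P X]Er; apply: nondecreasing_cvg_mu.
    - move=> j; apply: measurableI => //; have := mYB k `]-oo, j%:R]%classic.
      rewrite (_ : [set w | _] = [set w | Y k w <= j%:R]); first by apply; exact: measurable_itv.
      by apply/seteqP; split=> w /=; rewrite in_itv.
    - by rewrite Er.
    - move=> i j ij; apply/subsetPset => w [Ew wi]; split=> //=.
      by apply: le_trans wi _; rewrite ler_nat.
  apply: (cvg_unique _ h1); first exact: ereal_hausdorff.
  rewrite /mkset; under eq_cvg do rewrite half.
  apply: cvg_EFin; first by near=> j.
  rewrite -[X in _ --> X]mul1r; apply: cvgM; last exact: cvg_cst.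
  apply: fine_cvg; rewrite -[X in _ --> X](probability_setT (nu k)).
  have ET : \bigcup_j `]-oo, j%:R]%classic = [set: R].
    apply/seteqP; split=> // x _; exists (Num.truncn (Num.max 0 x)).+1 => //=.
    rewrite in_itv /=; apply/ltW; apply: le_lt_trans (truncnS_gt _).
    by rewrite le_max lexx orbT.
  rewrite -ET; apply: nondecreasing_cvg_mu.
  - by [].
  - by rewrite ET.
  - move=> i j ij; apply/subsetPset => x /=; rewrite !in_itv /= => /le_trans; apply.
    by rewrite ler_nat.
rewrite (_ : B = upd (B k)); last first.
  by apply/funext => i; rewrite /upd; case: eqVneq => [->|].
rewrite updE updP; apply: (@borel_halfline_ind R (fun S =>
    P (E `&` [set w | S (Y k w)]) = (fine (nu k S) * c)%:E)) => //.
- by rewrite probability_setT mul1r -PET; congr (P _); apply/seteqP; split=> w //= [].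
- move=> S mS PS.
  have -> : E `&` [set w | (~` S) (Y k w)] = E `\` [set w | S (Y k w)] by [].
  rewrite measureD//; last 2 first.
  - exact: mYB.
  - by rewrite -ge0_fin_numE// fin_num_measure.
  transitivity (c%:E - (fine (nu k S) * c)%:E)%E; first by congr (_ - _)%E; [exact: PET|exact: PS].
  rewrite probability_setC// -EFinB -(fineK (fin_num_measure (nu k) S mS)) /=.
  by congr EFin; ring.
- move=> F mF tF hF.
  have -> : E `&` [set w | (\bigcup_j F j) (Y k w)] =
      \bigcup_j (E `&` [set w | F j (Y k w)]).
    by apply/seteqP; split=> w [] => [Ew [j _ Fj]|j _ [Ew Fj]]; [exists j|split=> //; exists j].
  rewrite EFinM fineK ?fin_num_measure//; last exact: bigcupT_measurable.
  rewrite !measure_bigcup//; last 2 first.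
  - by move=> j _; apply: measurableI => //; exact: mYB.
  - apply/trivIsetP => i j _ _ ij; apply/seteqP; split=> w //= [[_ Fi] [_ Fj]].
    have : (F i `&` F j) (Y k w) by [].
    by move/trivIsetP : tF => /(_ i j I I ij) ->.
  rewrite muleC -nneseriesZl//; apply: eq_eseriesr => j _.
  by apply: (eq_trans (hF j)); rewrite EFinM fineK ?fin_num_measure// muleC.
Unshelve. all: by end_near. Qed.

(** * Decoding the increments *)

Section increment_process.
Context (R : realType).
Implicit Types (f : cantor_space (R * R * nat)) (a b c : R).

(** The supremum of the rationals that the bits put below the increment. The bits may
    code an infinite increment, but only on a null set. *)
Definition decoded_increment a b f : \bar R :=
  esups (fun i => if f (a, b, i) then (threshold R i)%:E else -oo%E) 0%N.

Lemma decoded_increment_ge a b f i : f (a, b, i) ->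
  ((threshold R i)%:E <= decoded_increment a b f)%E.
Proof.
by move=> fi; apply: ereal_sup_ubound; exists i => //; rewrite fi.
Qed.

Lemma decoded_increment_le a b f (r : R) :
  (decoded_increment a b f <= r%:E)%E <->
  forall i, r < threshold R i -> ~~ f (a, b, i).
Proof.
split=> [fr i ri|h].
  apply/negP => /decoded_increment_ge /le_trans /(_ fr).
  by rewrite lee_fin leNgt ri.
apply: ge_ereal_sup => _ [i _ <-]; case: ifPn => [fi|_]; last exact: leNye.
by rewrite lee_fin leNgt; apply/negP => /h; rewrite fi.
Qed.

Lemma decoded_increment_gt a b f (r : R) : (r%:E < decoded_increment a b f)%E ->
  exists i, r < threshold R i /\ f (a, b, i).
Proof.
move=> rf; apply: contrapT => h.
have : (decoded_increment a b f <= r%:E)%E; last by rewrite leNgt rf.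
apply/decoded_increment_le => i ri; apply/negP => fi; apply: h.
by exists i.
Qed.

Let measurableC (A : set (cantor_space (R * R * nat))) : cylinder A ->
  measurable (A : set (g_sigma_algebraType (@measurable _ (cantor_space (R * R * nat))))).
Proof. exact: sub_sigma_algebra. Qed.

Lemma measurable_decoded_increment a b :
  measurable_fun [set: g_sigma_algebraType
     (@measurable _ (cantor_space (R * R * nat)))] (decoded_increment a b).
Proof.
apply: measurable_fun_esups => i.
apply: measurable_fun_ifT => //; try exact: measurable_cst.
apply: (@measurable_fun_bool _ _ _ _ true).
rewrite setTI; apply: measurableC; exact: (cylinder_bit (a, b, i)).
Qed.

Lemma below_decreasing (r : R) N N' : (N <= N')%N -> below N' r `<=` below N r.
Proof.
by move=> NN x h j jN rj; apply: h => //; exact: leq_trans NN.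
Qed.

Lemma bigcap_below (r : R) : \bigcap_N below N r = `]-oo, r]%classic.
Proof.
apply/seteqP; split=> x /=; rewrite in_itv /=.
  move=> h; rewrite leNgt; apply/negP => /threshold_dense[i /andP[ri ix]].
  by have := h i.+1 I i (ltnSn i) ri; rewrite ltNge (ltW ix).
by move=> xr N _ j _ rj; exact: le_lt_trans rj.
Qed.

Variables (m : R -> probability R R)
  (P : probability (g_sigma_algebraType
      (@measurable _ (cantor_space (R * R * nat)))) R).
Hypothesis m_sg : convolution_semigroup m.
Hypothesis P_below : forall n N (t r : nat -> R), 0 <= t 0%N ->
  (forall i, t i <= t i.+1) ->
  P (bits_below n N t r) =
    (\prod_(i < n) fine (m (t i.+1 - t i)%R (below N (r i))))%:E.
Hypothesis P_excess : forall a b c i j k,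
  threshold R i + threshold R j <= threshold R k -> P (bits_excess a b c i j k) = 0%E.
Hypothesis P_defect : forall a b c i j k,
  threshold R k <= threshold R i + threshold R j -> P (bits_defect a b c i j k) = 0%E.

(** The limit of the constraints by the first [N] rationals as [N] tends to infinity. *)
Lemma decoded_increments_le n (t r : nat -> R) : 0 <= t 0%N ->
  (forall i, t i <= t i.+1) ->
  P [set f | forall i, (i < n)%N ->
      (decoded_increment (t i) (t i.+1) f <= (r i)%:E)%E] =
  (\prod_(i < n) fine (m (t i.+1 - t i)%R `]-oo, r i]%classic))%:E.
Proof.
move=> t0 tn.
have -> : [set f | forall i, (i < n)%N ->
      (decoded_increment (t i) (t i.+1) f <= (r i)%:E)%E] =
    \bigcap_N bits_below n N t r.
  apply/seteqP; split=> f /= h.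
    by move=> N _ i ni j _ rj; have /decoded_increment_le := h i ni; apply.
  move=> i ni; apply/decoded_increment_le => j rj.
  exact: (h j.+1 I i ni j (ltnSn j) rj).
have h1 : P (bits_below n N t r) @[N --> \oo] --> P (\bigcap_N bits_below n N t r).
  apply: nonincreasing_cvg_mu.
  - by rewrite -ge0_fin_numE// fin_num_measure//; apply: measurableC; exact: cylinder_bits_below.
  - by move=> N; apply: measurableC; exact: cylinder_bits_below.
  - by apply: bigcapT_measurable => N; apply: measurableC; exact: cylinder_bits_below.
  - move=> N N' NN; apply/subsetPset => f h i ni j jN; apply: h => //.
    exact: leq_trans NN.
apply: (cvg_unique _ h1); first exact: ereal_hausdorff.
rewrite /mkset; under eq_cvg do rewrite P_below//.
apply: cvg_EFin; first by near=> N.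
rewrite /=; elim: n {h1} => [|n IHn].
  rewrite big_ord0; apply: cvg_near_cst; near=> N.
  by rewrite /= big_ord0.
rewrite [X in X @ _ --> _](_ : _ = (fun N =>
    (\prod_(i < n) fine (m (t i.+1 - t i) (below N (r i)))) *
    fine (m (t n.+1 - t n) (below N (r n))))); last first.
  by apply/funext => N /=; rewrite big_ord_recr.
rewrite big_ord_recr /=; apply: cvgM => //.
rewrite -[X in m _ X]/(`]-oo, r n]%classic) -bigcap_below.
apply: fine_cvg; rewrite fineK; last first.
  by rewrite fin_num_measure//; apply: bigcapT_measurable => N; exact: measurable_below.
apply: nonincreasing_cvg_mu.
- by rewrite -ge0_fin_numE// fin_num_measure//; exact: measurable_below.
- by move=> N; exact: measurable_below.
- by apply: bigcapT_measurable => N; exact: measurable_below.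
- by move=> N N' NN; apply/subsetPset; exact: below_decreasing.
Unshelve. all: by end_near. Qed.

End increment_process.

(** * Levy processes with prescribed marginals *)

Lemma le_measure_negligible d (T : measurableType d) (R : realType)
    (P : {measure set T -> \bar R}) (A B N : set T) :
  measurable A -> measurable B -> P.-negligible N -> A `<=` B `|` N ->
  (P A <= P B)%E.
Proof.
move=> mA mB [M [mM PM NM]] AB; rewrite -[leRHS]adde0 -PM.
apply: le_trans (measureU2 _ mB mM); apply: le_measure; rewrite ?inE//.
  exact: measurableU.
by move=> x /AB[Bx|/NM]; [left|right].
Qed.

Lemma eq_measure_negligible d (T : measurableType d) (R : realType)
    (P : {measure set T -> \bar R}) (A B N : set T) :
  measurable A -> measurable B -> P.-negligible N ->
  (forall x, ~ N x -> A x <-> B x) -> P A = P B.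
Proof.
move=> mA mB PN AB; apply/eqP; rewrite eq_le; apply/andP.
split; apply: le_measure_negligible PN _ => // x Ax;
  by have [Nx|nNx] := pselect (N x); [right|left; apply/(AB x nNx)].
Qed.

(** The distribution function of [nu] tends to [0] and to [1] at the two ends. *)
Lemma cdf_finite_ae d (T : measurableType d) (R : realType)
    (P : probability T R) (D : T -> \bar R) (nu : probability R R) :
  measurable_fun setT D ->
  (forall r : R, P [set w | (D w <= r%:E)%E] = nu `]-oo, r]%classic) ->
  P.-negligible [set w | D w \isn't a fin_num].
Proof.
move=> mD PD.
have mDle (r : R) : measurable [set w | (D w <= r%:E)%E].
  rewrite -[X in measurable X]setTI; have := mD measurableT `]-oo, r%:E]%classic.
  rewrite (_ : _ @^-1` _ = [set w | (D w <= r%:E)%E]).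
    by apply; exact: emeasurable_itv.
  by apply/seteqP; split=> w /=; rewrite in_itv.
have h1 : P [set w | D w = -oo%E] = 0%E.
  have E : \bigcap_k [set w | (D w <= (- k%:R)%:E)%E] = [set w | D w = -oo%E].
    apply/seteqP; split=> w /= h; last by move=> k _ /=; rewrite h leNye.
    have {}h k : (D w <= (- k%:R)%:E)%E by exact: (h k I).
    case: (D w) h => [r h|/(_ 0%N)|]//.
    have := h (Num.truncn (Num.max 0 (- r))).+1; rewrite lee_fin lerNr leNgt.
    by rewrite (le_lt_trans _ (truncnS_gt _))// le_max lexx orbT.
  have c1 : P [set w | (D w <= (- k%:R)%:E)%E] @[k --> \oo] -->
      P [set w | D w = -oo%E].
    rewrite -E; apply: nonincreasing_cvg_mu => //.
    - by rewrite -ge0_fin_numE// fin_num_measure.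
    - exact: bigcapT_measurable.
    - move=> i j ij; apply/subsetPset => w /= /le_trans; apply.
      by rewrite lee_fin lerN2 ler_nat.
  move: c1; under eq_fun do rewrite PD.
  move=> c1; apply: (cvg_unique _ c1); first exact: ereal_hausdorff.
  have E' : \bigcap_k `]-oo, (- k%:R : R)]%classic = set0.
    apply/seteqP; split=> r //= h.
    have := h (Num.truncn (Num.max 0 (- r))).+1 I.
    rewrite /= in_itv /= lerNr leNgt.
    by rewrite (le_lt_trans _ (truncnS_gt _))// le_max lexx orbT.
  suff : nu `]-oo, (- k%:R : R)]%classic @[k --> \oo] -->
    nu (\bigcap_k `]-oo, (- k%:R : R)]%classic) by rewrite E' measure0.
  apply: nonincreasing_cvg_mu => //.
  - by rewrite -ge0_fin_numE// fin_num_measure.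
  - by rewrite E'.
  - move=> i j ij; apply/subsetPset => w /=; rewrite !in_itv /= => /le_trans; apply.
    by rewrite lerN2 ler_nat.
have h2 : P [set w | D w = +oo%E] = 0%E.
  have E : \bigcup_k [set w | (D w <= k%:R%:E)%E] = ~` [set w | D w = +oo%E].
    apply/seteqP; split=> w /= h.
      by case: h => k _ /= + wy; rewrite wy.
    case Dw : (D w) h => [r|//|] _; last by exists 0%N => //=; rewrite Dw leNye.
    exists (Num.truncn (Num.max 0 r)).+1 => //=; rewrite Dw lee_fin ltW//.
    by rewrite (le_lt_trans _ (truncnS_gt _))// le_max lexx orbT.
  have mE : measurable (~` [set w | D w = +oo%E]).
    by rewrite -E; exact: bigcupT_measurable.
  have c1 : P [set w | (D w <= k%:R%:E)%E] @[k --> \oo] -->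
      P (~` [set w | D w = +oo%E]).
    rewrite -E; apply: nondecreasing_cvg_mu => //.
    - exact: bigcupT_measurable.
    - move=> i j ij; apply/subsetPset => w /= /le_trans; apply.
      by rewrite lee_fin ler_nat.
  have : P (~` [set w | D w = +oo%E]) = 1%E.
    move: c1; under eq_fun do rewrite PD.
    move=> c1; apply: (cvg_unique _ c1); first exact: ereal_hausdorff.
    have E' : \bigcup_k `]-oo, (k%:R : R)]%classic = setT.
      apply/seteqP; split=> r //= _; exists (Num.truncn (Num.max 0 r)).+1 => //=.
      by rewrite in_itv /= ltW// (le_lt_trans _ (truncnS_gt _))// le_max lexx orbT.
    suff : nu `]-oo, (k%:R : R)]%classic @[k --> \oo] -->
      nu (\bigcup_k `]-oo, (k%:R : R)]%classic) by rewrite E' probability_setT.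
    apply: nondecreasing_cvg_mu => //; first by rewrite E'.
    move=> i j ij; apply/subsetPset => w /=; rewrite !in_itv /= => /le_trans; apply.
    by rewrite ler_nat.
  move=> h; rewrite -[X in P X]setCK probability_setC// h subee//.
rewrite (_ : mkset _ = [set w | D w = -oo%E] `|` [set w | D w = +oo%E]).
  apply: negligibleU; apply/negligibleP => //.
  by rewrite (_ : mkset _ = D @^-1` [set -oo%E])// -[X in measurable X]setTI; exact: mD.
by rewrite (_ : mkset _ = D @^-1` [set +oo%E])// -[X in measurable X]setTI; exact: mD.
apply/seteqP; split=> w /=; first by case: (D w) => [r||] //= _; [right|left].
by case=> ->.
Qed.


Section levy_existence.
Context (R : realType) (m : R -> probability R R).
Let Omega := g_sigma_algebraType (@measurable _ (cantor_space (R * R * nat))).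
Variable P : probability Omega R.
Hypothesis m_sg : convolution_semigroup m.
Hypothesis P_below : forall n N (t r : nat -> R), 0 <= t 0%N ->
  (forall i, t i <= t i.+1) ->
  P (bits_below n N t r) =
    (\prod_(i < n) fine (m (t i.+1 - t i)%R (below N (r i))))%:E.
Hypothesis P_excess : forall a b c i j k,
  threshold R i + threshold R j <= threshold R k -> P (bits_excess a b c i j k) = 0%E.
Hypothesis P_defect : forall a b c i j k,
  threshold R k <= threshold R i + threshold R j -> P (bits_defect a b c i j k) = 0%E.

Let D a b : Omega -> \bar R := decoded_increment a b.
Let mD a b : measurable_fun setT (D a b).
Proof. exact: measurable_decoded_increment. Qed.

Let mDle a b (r : R) : measurable [set w | (D a b w <= r%:E)%E].
Proof.
rewrite -[X in measurable X]setTI; have := @mD a b measurableT `]-oo, r%:E]%classic.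
rewrite (_ : _ @^-1` _ = [set w | (D a b w <= r%:E)%E]).
  by apply; exact: emeasurable_itv.
by apply/seteqP; split=> w /=; rewrite in_itv.
Qed.

Let PD a b (r : R) : 0 <= a -> a <= b ->
  P [set w | (D a b w <= r%:E)%E] = m (b - a)%R `]-oo, r]%classic.
Proof.
move=> a0 ab; pose t i := if i is 0%N then a else b.
have tn i : t i <= t i.+1 by case: i.
have := @decoded_increments_le R m P P_below 1 t (fun=> r) a0 tn.
rewrite big_ord1 fineK ?fin_num_measure// => <-; congr (P _).
by apply/seteqP; split=> w /= h; [case|exact: (h 0%N)].
Qed.

Let D_negligible a b : 0 <= a -> a <= b ->
  P.-negligible [set w | D a b w \isn't a fin_num].
Proof. by move=> a0 ab; apply: cdf_finite_ae => // r; exact: PD. Qed.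

Let negligible_bigcup3 (F : nat -> nat -> nat -> set Omega) :
  (forall i j k, P (F i j k) = 0%E) -> (forall i j k, measurable (F i j k)) ->
  P.-negligible [set w | exists i j k, F i j k w].
Proof.
move=> F0 mF; rewrite (_ : mkset _ = \bigcup_i \bigcup_j \bigcup_k F i j k).
  apply: negligible_bigcup => i; apply: negligible_bigcup => j.
  apply: negligible_bigcup => k; apply/(negligibleP _ (mF i j k)); exact: F0.
apply/seteqP; split=> w /=; first by move=> [i [j [k h]]]; exists i => //; exists j => //; exists k.
by move=> [i _ [j _ [k _ h]]]; exists i, j, k.
Qed.

(** A failure of additivity shows on three rationals, and there are countably many
    triples, each of probability zero. *)
Let D_additive a b c : 0 <= a -> a <= b -> b <= c ->
  P.-negligible [set w | fine (D a c w) - fine (D a b w) <> fine (D b c w)].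
Proof.
move=> a0 ab bc.
have excess_negligible : P.-negligible [set w | exists i j k,
    (if threshold R i + threshold R j <= threshold R k
     then bits_excess a b c i j k else set0) w].
  apply: negligible_bigcup3 => i j k; case: ifPn => h //; first exact: P_excess.
  by apply: sub_sigma_algebra; exact: cylinder_bits_excess.
have defect_negligible : P.-negligible [set w | exists i j k,
    (if threshold R k <= threshold R i + threshold R j
     then bits_defect a b c i j k else set0) w].
  apply: negligible_bigcup3 => i j k; case: ifPn => h //; first exact: P_defect.
  by apply: sub_sigma_algebra; exact: cylinder_bits_defect.
have n1 := D_negligible a0 ab.
have n2 := D_negligible (le_trans a0 ab) bc.
have n3 := D_negligible a0 (le_trans ab bc).
apply: negligibleS (negligibleU (negligibleU n1 (negligibleU n2 n3))
  (negligibleU excess_negligible defect_negligible)) => w /= xyz.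
have [ab_fin|] := boolP (D a b w \is a fin_num); last by left; left.
have [bc_fin|] := boolP (D b c w \is a fin_num); last by left; right; left.
have [ac_fin|] := boolP (D a c w \is a fin_num); last by left; right; right.
right; move: xyz.
have xE := fineK ab_fin; have yE := fineK bc_fin; have zE := fineK ac_fin.
move: (fine (D a b w)) xE (fine (D b c w)) yE (fine (D a c w)) zE => x xE y yE z zE xyz.
have [lt|gt|eq] := ltgtP z (x + y); last by exfalso; apply: xyz; rewrite eq addrAC subrr add0r.
- right.
  pose e := (x + y - z) / 2.
  have e0 : 0 < e by rewrite /e; lra.
  have [i [xi fi]] : exists i, x - e < threshold R i /\ w (a, b, i).
    by apply: decoded_increment_gt; rewrite -/(D a b w) -xE lte_fin; lra.
  have [j [yj fj]] : exists j, y - e < threshold R j /\ w (b, c, j).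
    by apply: decoded_increment_gt; rewrite -/(D b c w) -yE lte_fin; lra.
  have [k /andP[zk kij]] : exists k, z < threshold R k < threshold R i + threshold R j.
    by apply: threshold_dense; move: xi yj; rewrite /e; lra.
  exists i, j, k; rewrite (ltW kij); split=> //.
  have /decoded_increment_le h : (D a c w <= z%:E)%E by rewrite zE.
  exact: h.
- left.
  have [k [xyk fk]] : exists k, x + y < threshold R k /\ w (a, c, k).
    by apply: decoded_increment_gt; rewrite -/(D a c w) -zE lte_fin.
  pose e := (threshold R k - x - y) / 2.
  have e0 : 0 < e by rewrite /e; lra.
  have [i /andP[xi ix]] : exists i, x < threshold R i < x + e.
    by apply: threshold_dense; lra.
  have [j /andP[yj jy]] : exists j, y < threshold R j < y + e.
    by apply: threshold_dense; lra.
  exists i, j, k; case: ifPn => [_|]; last by move: ix jy; rewrite /e; lra.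
  split=> //.
    have /decoded_increment_le h : (D a b w <= x%:E)%E by rewrite xE.
    exact: h.
  have /decoded_increment_le h : (D b c w <= y%:E)%E by rewrite yE.
  exact: h.
Qed.

Let X t (w : Omega) : R := fine (D 0 t w).

Let mX t : measurable_fun setT (X t).
Proof. by apply: measurableT_comp (mD 0 t); exact: fine_measurable. Qed.

Let fineD_law n (t : nat -> R) (B : nat -> set R) : 0 <= t 0%N ->
  (forall i, t i <= t i.+1) -> (forall i, measurable (B i)) ->
  P [set w | forall i, (i < n)%N -> B i (fine (D (t i) (t i.+1) w))] =
  (\prod_(i < n) fine (m (t i.+1 - t i)%R (B i)))%:E.
Proof.
move=> t0 tn mB.
have tge0 i : 0 <= t i by elim: i => // i; move/le_trans; apply.
have mf i : measurable_fun setT (fun w => fine (D (t i) (t i.+1) w)).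
  by apply: measurableT_comp (mD _ _); exact: fine_measurable.
apply: (@halfline_product _ _ _ P (fun i w => fine (D (t i) (t i.+1) w))
  (fun i => m (t i.+1 - t i)%R)) => // {B mB}n r.
rewrite -(decoded_increments_le P_below n r t0 tn).
apply: (@eq_measure_negligible _ _ _ P _ _
    (\bigcup_i [set w | D (t i) (t i.+1) w \isn't a fin_num])).
- apply: measurable_forall_ltn => i _; rewrite -[X in measurable X]setTI.
  have := mf i measurableT `]-oo, r i]%classic.
  rewrite (_ : _ @^-1` _ = [set w | fine (D (t i) (t i.+1) w) <= r i]).
    by apply; exact: measurable_itv.
  by apply/seteqP; split=> w /=; rewrite in_itv.
- by apply: measurable_forall_ltn => i _; exact: mDle.
- by apply: negligible_bigcup => i; exact: D_negligible.
- move=> w Dfin; have Df i : D (t i) (t i.+1) w \is a fin_num.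
    by apply: contrapT => h; apply: Dfin; exists i => //; exact/negP.
  by split=> h i ni; have := h i ni; rewrite -lee_fin (fineK (Df i)).
Qed.

Let increments n (t : nat -> R) (B : nat -> set R) : 0 <= t 0%N ->
  (forall i, t i <= t i.+1) -> (forall i, measurable (B i)) ->
  P [set w | forall i, (i < n)%N -> B i (X (t i.+1) w - X (t i) w)] =
  (\prod_(i < n) fine (m (t i.+1 - t i)%R (B i)))%:E.
Proof.
move=> t0 tn mB; rewrite -fineD_law//.
have tge0 i : 0 <= t i by elim: i => // i; move/le_trans; apply.
apply: (@eq_measure_negligible _ _ _ P _ _ (\bigcup_i [set w |
    fine (D 0 (t i.+1) w) - fine (D 0 (t i) w) <> fine (D (t i) (t i.+1) w)])).
- exact: (@measurable_increments R _ Omega X n t B mX mB).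
- apply: measurable_forall_ltn => i _; rewrite -[X in measurable X]setTI.
  have mf : measurable_fun setT (fun w => fine (D (t i) (t i.+1) w)).
    by apply: measurableT_comp (mD _ _); exact: fine_measurable.
  exact: mf.
- by apply: negligible_bigcup => i; exact: D_additive.
- move=> w Dadd; have Da i : X (t i.+1) w - X (t i) w = fine (D (t i) (t i.+1) w).
    by apply: contrapT => h; apply: Dadd; exists i.
  by split=> h i ni; have := h i ni; rewrite Da.
Qed.

Let increment a b (B : set R) : 0 <= a -> a <= b -> measurable B ->
  P [set w | B (X b w - X a w)] = m (b - a)%R B.
Proof.
move=> a0 ab mB; pose t i := if i is 0%N then a else b.
have tn i : t i <= t i.+1 by case: i.
have := @increments 1 t (fun=> B) a0 tn (fun=> mB).
rewrite big_ord1 fineK ?fin_num_measure// => <-; congr (P _).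
by apply/seteqP; split=> w /= h; [case|exact: (h 0%N)].
Qed.

Let marginal b (B : set R) : 0 <= b -> measurable B -> P [set w | B (X b w)] = m b B.
Proof.
move=> b0 mB; pose t i := if i is 0%N then 0 : R else b.
have tn i : t i <= t i.+1 by case: i.
have := @fineD_law 1 t (fun=> B) (lexx _) tn (fun=> mB).
rewrite big_ord1 fineK ?fin_num_measure//= subr0 => <-; congr (P _).
by apply/seteqP; split=> w /= h; [case|exact: (h 0%N)].
Qed.

Lemma increment_process_levy : exists Y : R -> {RV P >-> R}, levy_process Y /\
  forall B, measurable B -> P [set w | B (Y 1 w)] = m 1 B.
Proof.
pose Y t : {RV P >-> R} := HB.pack (X t) (isMeasurableFun.Build _ _ _ _ (X t) (mX t)).
exists Y; split; last by move=> B mB; exact: marginal.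
have [m0 _ m_cont] := m_sg.
split.
- apply/negligibleP.
    apply: measurableC; rewrite -[X in measurable X]setTI.
    exact: (mX 0) (measurable_set1 0).
  apply: (eq_trans (marginal (lexx 0) (measurableC (measurable_set1 0)))).
  rewrite m0; last exact: measurableC.
  by rewrite diracE memNset//= => h; apply: h.
- move=> n t B t0 tn mB; rewrite (increments n t0 tn mB) -prodEFin.
  apply: eq_bigr => i _; rewrite increment// ?fineK ?fin_num_measure//.
  by elim: (nat_of_ord i) => // j; move/le_trans; apply.
- move=> s t s0 t0 B mB.
  rewrite (_ : P [set w | B (Y (s + t) w - Y s w)] = m (s + t - s)%R B).
    by rewrite addrAC subrr add0r -marginal.
  by rewrite -increment// lerDl.
- move=> s e s0 e0.
  pose Ae := [set x : R | e < `|x|].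
  have mAe : measurable Ae by exact: measurable_tail.
  have Pe t : 0 <= t -> P [set w | e < `|Y t w - Y s w|] = m `|t - s| Ae.
    move=> t0; have [st|/ltW ts] := leP s t.
      by rewrite ger0_norm ?subr_ge0//; exact: (increment s0 st mAe).
    rewrite distrC ger0_norm ?subr_ge0// -(increment t0 ts mAe).
    by congr (P _); apply/seteqP; split=> w; rewrite /Ae /= distrC.
  have m0e : m 0 Ae = 0%E.
    by rewrite m0// diracE memNset// /Ae /= normr0 => /(lt_trans e0); rewrite ltxx.
  move=> V /= V0; have [d /= d0 dV] := m_cont e e0 V V0.
  exists d => //= t /= std t0; rewrite /= Pe//.
  have [ts|ts] := eqVneq t s.
    by rewrite ts subrr normr0 m0e; exact: nbhs_singleton V0.
  apply: (dV `|t - s|); last by rewrite normr_gt0 subr_eq0.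
  by rewrite /= sub0r normrN normr_id distrC.
Qed.

End levy_existence.

Theorem levy_process_existence (R : realType) (m : R -> probability R R) :
  convolution_semigroup m ->
  exists (d : measure_display) (Omega : measurableType d)
    (P : probability Omega R) (X : R -> {RV P >-> R}),
    levy_process X /\ forall B, measurable B -> P [set w | B (X 1 w)] = m 1 B.
Proof.
move=> sg; have [P [P1 P2 P3]] := increment_bits_measure sg.
have [X hX] := increment_process_levy sg P1 P2 P3.
by exists _, _, P, X.
Qed.

(** * Convolution of probability measures *)

Section density.
Context d (T : measurableType d) (R : realType).
Variables (mu nu : {measure set T -> \bar R}) (g : T -> R).
Hypotheses (mg : measurable_fun setT g) (g_ge0 : forall x, 0 <= g x).
Hypothesis nuE : forall A, measurable A -> nu A = (\int[mu]_(x in A) (g x)%:E)%E.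
Import HBNNSimple.

Let nnsfun_density (h : {nnsfun T >-> R}) :
  (\int[nu]_x (h x)%:E = \int[mu]_x ((h x)%:E * (g x)%:E))%E.
Proof.
under eq_integral do rewrite fimfunE -fsumEFin//.
rewrite ge0_integral_fsum//; last 2 first.
- by move=> y; exact/measurable_EFinP/measurable_funM.
- by move=> y x _; rewrite nnfun_muleindic_ge0.
transitivity (\sum_(k \in range h) \int[mu]_x ((k * \1_(h @^-1` [set k]) x)%:E * (g x)%:E))%E.
  apply: eq_fsbigr => r _; rewrite integralZl_indic_nnsfun// integral_indic// setIT.
  rewrite nuE//; have [r0|r0] := leP 0 r.
    under [RHS]eq_integral do rewrite EFinM -muleA.
    rewrite ge0_integralZl//.
    - congr (_ * _)%E; rewrite [LHS]integral_mkcond; apply: eq_integral => x _.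
      by rewrite /patch indicE; case: ifPn; rewrite ?mul1e ?mul0e.
    - apply/measurable_EFinP; apply: measurable_funM => //.
    - by move=> x _; rewrite -EFinM lee_fin mulr_ge0.
  rewrite preimage_nnfun0// integral_set0 mule0.
  by under eq_integral do rewrite indic0 mulr0 mul0e; rewrite integral0.
rewrite -ge0_integral_fsum//.
- apply: eq_integral => x _; rewrite fimfunE -fsumEFin// ge0_mule_fsuml//.
  by move=> r; exact: nnfun_muleindic_ge0.
- move=> r; under eq_fun do rewrite -EFinM.
  by apply/measurable_EFinP; apply: measurable_funM => //; exact: measurable_funM.
- move=> r x _; apply: mule_ge0; last by rewrite lee_fin.
  by rewrite EFinM nnfun_muleindic_ge0.
Qed.

Lemma ge0_integral_density (f : T -> \bar R) :
  measurable_fun setT f -> (forall x, (0 <= f x)%E) ->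
  (\int[nu]_x f x = \int[mu]_x (f x * (g x)%:E))%E.
Proof.
move=> mf f0; pose f_ := nnsfun_approx measurableT mf.
have cf x : (f_ n x)%:E @[n --> \oo] --> f x by apply: cvg_nnsfun_approx => // y _.
transitivity (limn (fun n => \int[nu]_x (f_ n x)%:E)%E).
  rewrite -monotone_convergence//.
  - by apply: eq_integral => x _; apply/esym/cvg_lim.
  - by move=> n; exact/measurable_EFinP.
  - by move=> n x _; rewrite lee_fin.
  - by move=> x _ a b ab; rewrite lee_fin; exact/lefP/nd_nnsfun_approx.
under eq_fun do rewrite nnsfun_density.
rewrite -monotone_convergence//.
- apply: eq_integral => x _; apply: cvg_lim => //.
  by apply: cvgeZr.
- by move=> n; apply: emeasurable_funM; exact/measurable_EFinP.
- by move=> n x _; rewrite mule_ge0 ?lee_fin.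
- move=> x _ a b ab; rewrite lee_wpmul2r ?lee_fin//.
  exact/lefP/nd_nnsfun_approx.
Qed.

Lemma ge0_integral_density_in (D : set T) (f : T -> \bar R) : measurable D ->
  measurable_fun D f -> (forall x, D x -> (0 <= f x)%E) ->
  (\int[nu]_(x in D) f x = \int[mu]_(x in D) (f x * (g x)%:E))%E.
Proof.
move=> mD mf f0; rewrite integral_mkcond ge0_integral_density.
- rewrite [RHS]integral_mkcond; apply: eq_integral => x _.
  by rewrite /patch; case: ifPn; rewrite ?mul0e.
- exact/(measurable_restrictT _ mD).
- by move=> x; rewrite /patch; case: ifPn => // /set_mem; exact: f0.
Qed.

End density.

Section convolution.
Context (R : realType).
Implicit Types P Q : probability R R.

Let sum2 (z : R * R) : R := z.1 + z.2.

Let measurable_sum2 : measurable_fun setT sum2.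
Proof. exact: measurable_funD. Qed.

HB.instance Definition _ := isMeasurableFun.Build _ _ _ _ sum2 measurable_sum2.

Definition convolution P Q : probability R R :=
  distribution (P \x Q)%E (sum2 : {mfun _ >-> _}).

Lemma ge0_integral_convolution P Q (f : R -> \bar R) :
  measurable_fun setT f -> (forall x, (0 <= f x)%E) ->
  (\int[convolution P Q]_x f x = \int[P]_x \int[Q]_y f (x + y)%R)%E.
Proof.
move=> mf f0; rewrite /convolution ge0_integral_distribution//.
exact: (fubini_tonelli1 (f \o sum2) (measurableT_comp mf measurable_sum2) (fun z => f0 _)).
Qed.

Lemma convolution_set P Q (B : set R) : measurable B ->
  convolution P Q B = (\int[Q]_y P [set x : R | B (x + y)%R])%E.
Proof.
move=> mB.
have m1 : measurable_fun setT (EFin \o \1_B : R -> \bar R) by exact/measurable_EFinP.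
have p1 x : (0 <= (\1_B x : R)%:E)%E by rewrite lee_fin.
have -> : convolution P Q B = (\int[convolution P Q]_x (\1_B x)%:E)%E.
  by rewrite integral_indic// setIT.
rewrite ge0_integral_convolution//.
transitivity (\int[Q]_y \int[P]_x (\1_B (x + y)%R)%:E)%E.
  exact: (fubini_tonelli ((EFin \o \1_B) \o sum2) (measurableT_comp m1 measurable_sum2) (fun z => p1 _)).
apply: eq_integral => y _.
have -> : (fun x => (\1_B (x + y)%R)%:E) = (EFin \o \1_[set x : R | B (x + y)%R] : R -> \bar R).
  by apply/funext => x; rewrite /= !indicE; congr (_%:R%:E); apply/idP/idP; rewrite !inE.
rewrite integral_indic ?setIT//; exact: measurable_translate.
Qed.

Lemma measurable_fun_int_translate P (f : R -> \bar R) :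
  measurable_fun setT f -> (forall x, (0 <= f x)%E) ->
  measurable_fun setT (fun x : R => \int[P]_y f (x + y)%R)%E.
Proof.
move=> mf f0.
exact: (measurable_fun_fubini_tonelli_F (f \o sum2)
  (measurableT_comp mf measurable_sum2) (fun z => f0 _)).
Qed.

End convolution.

Section semigroup_product.
Context (R : realType).
Implicit Types (P Q : probability R R) (m g c : R -> probability R R).

Lemma semigroup_convolution m s t B : convolution_semigroup m -> 0 <= s -> 0 <= t ->
  measurable B -> m (s + t) B = convolution (m s) (m t) B.
Proof. by move=> [_ mD _] s0 t0 mB; rewrite convolution_set// mD. Qed.

Lemma ge0_integral_semigroupD m s t (f : R -> \bar R) : convolution_semigroup m ->
  0 <= s -> 0 <= t -> measurable_fun setT f -> (forall x, (0 <= f x)%E) ->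
  (\int[m (s + t)%R]_x f x = \int[m s]_x \int[m t]_y f (x + y)%R)%E.
Proof.
move=> sg s0 t0 mf f0; rewrite -ge0_integral_convolution//.
by apply: eq_measure_integral => B mB _; exact: semigroup_convolution.
Qed.

Lemma integral_translate_swap P Q a (f : R -> \bar R) :
  measurable_fun setT f -> (forall x, (0 <= f x)%E) ->
  (\int[P]_x \int[Q]_y f (a + x + y)%R = \int[Q]_y \int[P]_x f (a + y + x)%R)%E.
Proof.
move=> mf f0; pose h (z : R * R) := f (a + z.1 + z.2).
have mh : measurable_fun setT h.
  apply: (measurableT_comp mf); apply: measurable_funD => //.
  by apply: measurable_funD.
rewrite (fubini_tonelli h mh (fun z => f0 _)).
by apply: eq_integral => y _; apply: eq_integral => x _; rewrite /h /= addrAC.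
Qed.

(** Tonelli regroups the two increments over [s] and the two over [t]. For the tails,
    a sum larger than [e] has a summand larger than [e / 2]. *)
Lemma convolution_semigroup_product g c : convolution_semigroup g ->
  convolution_semigroup c -> convolution_semigroup (fun t => convolution (g t) (c t)).
Proof.
move=> sg sc; have [g0 _ g_tail] := sg; have [c0 _ c_tail] := sc; split.
- move=> B mB; rewrite convolution_set//.
  rewrite (eq_measure_integral \d_(0 : R)); last by move=> A mA _; exact: c0.
  rewrite integral_dirac//; last exact: measurable_translated_measure.
  rewrite diracT mul1e g0; last exact: measurable_translate.
  by rewrite !diracE; congr ((nat_of_bool _)%:R%:E); apply/idP/idP; rewrite !inE /= addr0.
- move=> s t s0 t0 B mB; rewrite -convolution_set//.
  have m1 : measurable_fun setT (EFin \o \1_B : R -> \bar R) by exact/measurable_EFinP.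
  have p1 x : (0 <= (EFin \o \1_B : R -> \bar R) x)%E by rewrite lee_fin.
  have indE P : P B = (\int[P]_x (EFin \o \1_B) x)%E by rewrite integral_indic// setIT.
  rewrite !indE; move: (EFin \o \1_B) m1 p1 => f mf f0 {indE}.
  have mI P : measurable_fun setT (fun x : R => \int[P]_y f (x + y)%R)%E.
    exact: measurable_fun_int_translate.
  have I0 P x : (0 <= \int[P]_y f (x + y)%R)%E by apply: integral_ge0.
  rewrite [RHS]ge0_integral_convolution//.
  rewrite ge0_integral_convolution//.
  have mf' (u : R) : measurable_fun setT (fun y : R => f (u + y)%R).
    by apply: measurableT_comp mf _; exact: measurable_funD.
  transitivity (\int[g (s + t)%R]_x \int[c s]_y1 \int[c t]_y2 f (x + y1 + y2)%R)%E.
    apply: eq_integral => x _.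
    rewrite (ge0_integral_semigroupD sc s0 t0 (mf' x) (fun y => f0 _)).
    by apply: eq_integral => y1 _; apply: eq_integral => y2 _; rewrite addrA.
  pose H (x : R) := (\int[c t]_y f (x + y)%R)%E.
  rewrite (@ge0_integral_semigroupD g s t (fun x => \int[c s]_y H (x + y)%R)%E)//; last 2 first.
  - by apply: measurable_fun_int_translate; [exact: mI|exact: I0].
  - by move=> x; apply: integral_ge0 => y _; exact: I0.
  rewrite [RHS]ge0_integral_convolution//.
  apply: eq_integral => x1 _.
  rewrite [LHS](@integral_translate_swap (g t) (c s) x1 H (mI _) (I0 _)).
  apply: eq_integral => y1 _.
  rewrite (ge0_integral_convolution _ _ (mf' (x1 + y1)) (fun y => f0 _)).
  by apply: eq_integral => x2 _; apply: eq_integral => y2 _; rewrite !addrA.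
- move=> e e0.
  have e20 : 0 < e / 2 by rewrite divr_gt0.
  have mtail r := @measurable_tail R r.
  have le2 h : (convolution (g h) (c h) [set x : R | e < `|x|]%R <=
      g h [set x : R | (e / 2 < `|x|)%R] + c h [set x : R | (e / 2 < `|x|)%R])%E.
    rewrite /convolution /distribution /pushforward.
    set A := (X in ((g h \x c h)%E X <= _)%E).
    have mA : measurable A.
      rewrite -[X in measurable X]setTI.
      apply: (measurable_funD (f := fst) (g := snd)) (mtail e) => //.
    apply: (@le_trans _ _ ((g h \x c h)%E (([set x : R | (e / 2 < `|x|)%R] `*` setT) `|`
        (setT `*` [set x : R | (e / 2 < `|x|)%R])))).
      apply: le_measure; rewrite ?inE//.
        by apply: measurableU; exact: measurableX.
      move=> [x y]; rewrite /A /= => exy.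
      have [|xe] := ltP (e / 2) `|x|; first by left.
      right; split=> //; rewrite ltNge; apply/negP => ye.
      by have := ler_normD x y; move: exy xe ye; lra.
    apply: le_trans (measureU2 _ _ _) _; try exact: measurableX.
    have gT : g h [set: R] = 1%E by exact: probability_setT.
    have cT : c h [set: R] = 1%E by exact: probability_setT.
    apply: leeD.
      by rewrite -[leRHS]mule1 -cT; rewrite le_eqVlt; apply/orP; left; apply/eqP;
        exact: product_measure1E.
    by rewrite -[leRHS]mul1e -gT; rewrite le_eqVlt; apply/orP; left; apply/eqP;
      exact: product_measure1E.
  have z0 : (cst 0 : R -> \bar R) h @[h --> 0^'+] --> 0%E by exact: cvg_cst.
  have s0 : (g h [set x : R | (e / 2 < `|x|)%R] + c h [set x : R | (e / 2 < `|x|)%R])%E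
      @[h --> 0^'+] --> 0%E.
    by rewrite -[X in _ --> X]adde0; apply: cvgeD => //; [exact: g_tail|exact: c_tail].
  apply: squeeze_cvge z0 s0.
  by near=> h; rewrite le2 andbT; exact: measure_ge0.
Unshelve. all: by end_near. Qed.

Lemma dirac_semigroup (b : R) : convolution_semigroup (fun t => \d_(b * t) : probability R R).
Proof.
have dE (x : R) (A : set R) : (\d_x : probability R R) A = (x \in A)%:R%:E by exact: diracE.
split.
- by move=> B mB; rewrite mulr0.
- move=> s t s0 t0 B mB; rewrite integral_dirac//; last first.
    exact: (measurable_translated_measure (\d_(b * s) : probability R R) mB).
  rewrite !dE in_setT mul1e; congr ((nat_of_bool _)%:R%:E).
  by apply/idP/idP; rewrite !inE /= mulrDr.
- move=> e e0; apply: cvg_near_cst.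
  have h0 : b * h @[h --> 0^'+] --> (0 : R).
    rewrite -[X in _ --> X](mulr0 b); apply: cvgM; first exact: cvg_cst.
    exact: cvg_at_right_filter.
  have /cvgr0Pnorm_lt/(_ _ e0) := h0; apply: filterS => h he.
  by rewrite dE memNset//= => /(lt_trans he); rewrite ltxx.
Qed.

End semigroup_product.

(** * Compound Poisson semigroups *)

Section compound_poisson.
Context (R : realType).
Local Open Scope ereal_scope.

(** Both sides sum over all pairs, the right-hand one grouped by [N = m + n]. *)
Lemma nneseries_cauchy_product (u v w : nat -> \bar R) :
  (forall n, 0 <= u n) -> (forall n, 0 <= v n) -> (forall n, 0 <= w n) ->
  \sum_(0 <= n <oo) \sum_(0 <= m <oo) u n * (v m * w (m + n)%N) =
  \sum_(0 <= N <oo) (\sum_(n < N.+1) u n * v (N - n)%N) * w N.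
Proof.
move=> u0 v0 w0.
pose g n N := u n * (v (N - n)%N * w N).
have g0 n N : 0 <= g n N by rewrite mule_ge0// mule_ge0.
transitivity (\sum_(0 <= n <oo) \sum_(0 <= N <oo) (if (n <= N)%N then g n N else 0)).
  apply: eq_eseriesr => n _.
  transitivity (\sum_(0 <= m <oo) g n (m + n)%N).
    by apply: eq_eseriesr => m _; rewrite /g addnK.
  by rewrite (nneseries_addn n (g0 n)) eseries_cond/= -eseries_mkcond.
rewrite (nneseries_interchange xpredT xpredT); last by move=> n N; case: ifP.
apply: eq_eseriesr => N _.
rewrite (nneseries_split 0 N.+1)/=; last by move=> n _; case: ifP.
rewrite [X in _ + X]eseries0 ?adde0; last first.
  by move=> n; rewrite add0n ltnNge => /negbTE ->.
rewrite add0n big_mkord ge0_sume_distrl; last by move=> i _; rewrite mule_ge0.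
apply: eq_bigr => i _; rewrite -ltnS ltn_ord.
by rewrite /g muleA.
Qed.

Definition poisson_weight (a : R) (n : nat) : R :=
  (expR (- a) * (a ^+ n / n`!%:R))%R.

Lemma poisson_weight_ge0 a n : (0 <= a)%R -> (0 <= poisson_weight a n)%R.
Proof.
by move=> a0; rewrite /poisson_weight mulr_ge0 ?expR_ge0// divr_ge0// exprn_ge0.
Qed.

Lemma poisson_weight_sum a : (0 <= a)%R ->
  \sum_(0 <= n <oo) (poisson_weight a n)%:E = 1.
Proof.
move=> a0; transitivity ((expR (- a))%:E * (expR a)%:E); last first.
  by rewrite -EFinM expRN mulVf// gt_eqF// expR_gt0.
under eq_eseriesr do rewrite /poisson_weight EFinM.
rewrite nneseriesZl//=; last first.
  by move=> n _; rewrite lee_fin divr_ge0// exprn_ge0.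
congr *%E; rewrite expRE -EFin_lim; last first.
  rewrite /pseries/=; under eq_fun do rewrite mulrC.
  exact: is_cvg_series_exp_coeff.
apply/congr_lim/funext => n/=; rewrite /pseries/= /series/= -sumEFin//.
by under eq_bigr do rewrite mulrC.
Qed.

Lemma poisson_weightD a b N : (\sum_(n < N.+1) poisson_weight a n *
    poisson_weight b (N - n)%N)%R = poisson_weight (a + b) N.
Proof.
rewrite /poisson_weight opprD expRD exprDn mulr_suml mulr_sumr.
rewrite (reindex_inj rev_ord_inj)/=; apply: eq_bigr => i _.
have iN : (i <= N)%N by rewrite -ltnS.
rewrite subSS subKn// -(bin_fact iN) -mulr_natr.
have f1 : ((N - i)`!%:R : R) != 0%R by rewrite pnatr_eq0 -lt0n fact_gt0.
have f2 : (i`!%:R : R) != 0%R by rewrite pnatr_eq0 -lt0n fact_gt0.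
have f3 : ('C(N, i)%:R : R) != 0%R by rewrite pnatr_eq0 -lt0n bin_gt0.
rewrite !natrM; field; by rewrite f1 f2 f3.
Qed.

Variables (nu : probability R R).

Fixpoint convolution_power (n : nat) : probability R R :=
  if n is n'.+1 then convolution nu (convolution_power n') else \d_(0 : R)%R.

Lemma ge0_integral_convolution_powerD n m (f : R -> \bar R) :
  measurable_fun setT f -> (forall x, 0 <= f x) ->
  \int[convolution_power (n + m)]_x f x =
  \int[convolution_power n]_x \int[convolution_power m]_y f (x + y)%R.
Proof.
move=> mf f0; elim: n f mf f0 => [|n IHn] f mf f0 /=.
  rewrite add0n integral_dirac//; last exact: measurable_fun_int_translate.
  by rewrite diracT mul1e; apply: eq_integral => y _; rewrite add0r.
have mf' (u : R) : measurable_fun setT (fun y : R => f (u + y)%R).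
  by apply: measurableT_comp mf _; exact: measurable_funD.
rewrite ge0_integral_convolution// [RHS]ge0_integral_convolution//; last 2 first.
- exact: measurable_fun_int_translate.
- by move=> x; exact: integral_ge0.
apply: eq_integral => x _; rewrite (IHn _ (mf' x) (fun y => f0 _)).
by apply: eq_integral => y _; apply: eq_integral => z _; rewrite addrA.
Qed.

(** The law of a sum of independent variables of law [nu], the number of them being
    Poisson of parameter [a]. *)
Definition poisson_mixture (a : R) (a0 : (0 <= a)%R) : set R -> \bar R :=
  mseries (fun n => mscale (NngNum (poisson_weight_ge0 n a0)) (convolution_power n)) 0.

Section poisson_mixture.
Variables (a : R) (a0 : (0 <= a)%R).

HB.instance Definition _ := Measure.on (poisson_mixture a0).

Lemma ge0_integral_poisson_mixture (f : R -> \bar R) :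
  measurable_fun setT f -> (forall x, 0 <= f x) ->
  \int[poisson_mixture a0]_x f x =
  \sum_(0 <= n <oo) (poisson_weight a n)%:E * \int[convolution_power n]_x f x.
Proof.
move=> mf f0; rewrite ge0_integral_measure_series//.
by apply: eq_eseriesr => n _; rewrite ge0_integral_mscale.
Qed.

Let poisson_mixtureT : poisson_mixture a0 setT = 1.
Proof.
rewrite -(poisson_weight_sum a0) /poisson_mixture /mseries.
apply: eq_eseriesr => n _; rewrite -[RHS]mule1 /mscale /=.
by congr (_ * _); exact: probability_setT.
Qed.

HB.instance Definition _ :=
  Measure_isProbability.Build _ _ _ (poisson_mixture a0) poisson_mixtureT.

End poisson_mixture.

Variables (rate : R) (rate_ge0 : (0 <= rate)%R).

(** The absolute value makes this a probability at every real time; only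
    [0 <= rate * t] matters. *)
Definition compound_poisson (t : R) : probability R R :=
  poisson_mixture (normr_ge0 (rate * t)%R).

Lemma ge0_integral_compound_poisson t (f : R -> \bar R) : (0 <= t)%R ->
  measurable_fun setT f -> (forall x, 0 <= f x) ->
  \int[compound_poisson t]_x f x =
  \sum_(0 <= n <oo) (poisson_weight (rate * t) n)%:E * \int[convolution_power n]_x f x.
Proof.
move=> t0 mf f0; rewrite ge0_integral_poisson_mixture//.
by rewrite ger0_norm// mulr_ge0.
Qed.

(** Poisson weights multiply by the binomial theorem and convolution powers by
    associativity; the mass away from [0] at time [h] is at most the probability of a
    jump, which is [O(h)]. *)
Lemma compound_poisson_semigroup : convolution_semigroup compound_poisson.
Proof.
have set_integral t B : (0 <= t)%R -> measurable B -> compound_poisson t B =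
    \sum_(0 <= n <oo) (poisson_weight (rate * t) n)%:E * convolution_power n B.
  move=> t0 mB.
  have -> : compound_poisson t B = \int[compound_poisson t]_x (\1_B x)%:E.
    by rewrite integral_indic// setIT.
  rewrite ge0_integral_compound_poisson//; last exact/measurable_EFinP.
  by apply: eq_eseriesr => n _; rewrite integral_indic// setIT.
split.
- move=> B mB; rewrite set_integral// mulr0.
  rewrite (nneseries_split 0 1)/=; last first.
    by move=> n _; rewrite mule_ge0// lee_fin poisson_weight_ge0.
  rewrite [X in _ + X]eseries0 ?adde0; last first.
    by move=> [|n] //= _ _; rewrite /poisson_weight expr0n /= mul0r mulr0 mul0e.
  by rewrite big_nat1 /poisson_weight oppr0 expR0 expr0 fact0 divr1 mulr1 mul1e.
- move=> s t s0 t0 B mB; rewrite -convolution_set//.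
  have m1 : measurable_fun setT (EFin \o \1_B : R -> \bar R) by exact/measurable_EFinP.
  have p1 x : 0 <= (EFin \o \1_B : R -> \bar R) x by rewrite lee_fin.
  have indE (P : probability R R) : P B = \int[P]_x (EFin \o \1_B) x.
    by rewrite integral_indic// setIT.
  rewrite !indE; move: (EFin \o \1_B) m1 p1 => f mf f0 {indE}.
  rewrite [RHS](ge0_integral_convolution _ _ mf f0).
  have st0 : (0 <= s + t)%R by rewrite addr_ge0.
  have mI : measurable_fun setT (fun x : R => \int[compound_poisson t]_y f (x + y)%R).
    exact: measurable_fun_int_translate.
  have I0 x : 0 <= \int[compound_poisson t]_y f (x + y)%R by exact: integral_ge0.
  rewrite [LHS](ge0_integral_compound_poisson st0 mf f0).
  rewrite [RHS](ge0_integral_compound_poisson s0 mI I0).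
  have rs0 : (0 <= rate * s)%R by rewrite mulr_ge0.
  have rt0 : (0 <= rate * t)%R by rewrite mulr_ge0.
  pose w N := \int[convolution_power N]_x f x.
  transitivity (\sum_(0 <= N <oo) (\sum_(n < N.+1)
      (poisson_weight (rate * s) n)%:E * (poisson_weight (rate * t) (N - n)%N)%:E) * w N).
    apply: eq_eseriesr => N _; congr (_ * _).
    rewrite mulrDr -poisson_weightD -sumEFin.
    by apply: eq_bigr => i _; rewrite EFinM.
  rewrite -(@nneseries_cauchy_product
    (fun n => (poisson_weight (rate * s) n)%:E)
    (fun n => (poisson_weight (rate * t) n)%:E) w); last 3 first.
  - by move=> n; rewrite lee_fin poisson_weight_ge0.
  - by move=> n; rewrite lee_fin poisson_weight_ge0.
  - by move=> n; apply: integral_ge0.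
  apply: eq_eseriesr => n _.
  rewrite nneseriesZl; last first.
    by move=> m _; rewrite mule_ge0 ?lee_fin ?poisson_weight_ge0//; exact: integral_ge0.
  congr (_ * _).
  have mf' (u : R) : measurable_fun setT (fun y : R => f (u + y)%R).
    by apply: measurableT_comp mf _; exact: measurable_funD.
  under [RHS]eq_integral => x _.
    rewrite (ge0_integral_compound_poisson t0 (mf' x) (fun y => f0 _)).
    over.
  rewrite integral_nneseries//; last 2 first.
  - move=> m; apply: emeasurable_funM; first exact: measurable_cst.
    exact: measurable_fun_int_translate.
  - move=> m x _; rewrite mule_ge0 ?lee_fin ?poisson_weight_ge0//.
    by apply: integral_ge0.
  apply: eq_eseriesr => m _.
  rewrite ge0_integralZl//; last 3 first.
  - exact: measurable_fun_int_translate.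
  - by move=> x _; apply: integral_ge0.
  - by rewrite lee_fin poisson_weight_ge0.
  by rewrite /w addnC ge0_integral_convolution_powerD.
- move=> e e0.
  have me := measurable_tail e.
  have z0 : (cst 0 : R -> \bar R) h @[h --> 0^'+] --> 0 by exact: cvg_cst.
  have s0 : (1 - expR (- (rate * h)))%:E @[h --> 0^'+] --> 0.
    apply: cvg_EFin; first by near=> h.
    rewrite -[X in _ --> X](subrr 1%R); apply: cvgB; first exact: cvg_cst.
    suff : expR (- (rate * h)) @[h --> 0^'+] --> expR (- (rate * 0)).
      by rewrite mulr0 oppr0 expR0.
    apply: (cvg_comp (fun h : R => - (rate * h))%R expR); last exact: continuous_expR.
    apply: cvgN; apply: cvgM; first exact: cvg_cst.
    exact: cvg_at_right_filter.
  apply: squeeze_cvge z0 s0; near=> h.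
  have h0 : (0 <= h)%R by apply: ltW; near: h; exact: nbhs_right_gt.
  have rh0 : (0 <= rate * h)%R by rewrite mulr_ge0.
  rewrite measure_ge0 /= set_integral//.
  have -> : (1 - expR (- (rate * h)))%:E =
      \sum_(1 <= n <oo) (poisson_weight (rate * h) n)%:E.
    have := poisson_weight_sum rh0; rewrite (nneseries_split 0 1)/=; last first.
      by move=> n _; rewrite lee_fin poisson_weight_ge0.
    rewrite big_nat1 {1}/poisson_weight expr0 fact0 divr1 mulr1.
    by rewrite EFinB => <-; rewrite addeAC subee// add0e.
  rewrite (nneseries_split 0 1)/=; last first.
    by move=> n _; rewrite mule_ge0// lee_fin poisson_weight_ge0.
  rewrite big_nat1 /= diracE memNset ?mule0 ?add0e; last first.
    by rewrite /= normr0 => /(lt_trans e0); rewrite ltxx.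
  apply: lee_nneseries => n _; first by rewrite mule_ge0// lee_fin poisson_weight_ge0.
  by rewrite -[leRHS]mule1 lee_wpmul2l ?lee_fin ?poisson_weight_ge0// probability_le1.
Unshelve. all: by end_near. Qed.

End compound_poisson.

(** * Gaussian semigroups *)

Section gaussian.
Context (R : realType).
Local Notation leb := (@lebesgue_measure R).

Lemma ge0_integral_translate (y : R) (f : R -> \bar R) :
  measurable_fun setT f -> (forall x, (0 <= f x)%E) ->
  (\int[leb]_x f (x + y)%R = \int[leb]_x f x)%E.
Proof.
move=> mf f0; pose phi : measurableTypeR R -> measurableTypeR R := fun x => x + y.
have mphi : measurable_fun setT phi by exact: measurable_funD.
rewrite -[LHS](@ge0_integral_pushforward _ _ _ _ _ phi mphi leb setT f)//.
apply: eq_measure_integral => A mA _; apply/esym/lebesgue_measure_unique => //.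
  move=> _ [[a b]] _ <-.
  rewrite /= /pushforward (_ : phi @^-1` _ = `]a - y, b - y]%classic).
    rewrite !lebesgue_measure_itv /= !lte_fin ltrD2r.
    by case: ifP => // _; rewrite -!EFinB; congr EFin; ring.
  by apply/seteqP; split=> x; rewrite /phi /= !in_itv /= ltrBlDr lerBrDr.
Qed.

(** The centred Gaussian density of variance [a]. *)
Definition gauss_pdf (a x : R) : R := normal_pdf 0 (Num.sqrt a) x.

Lemma gauss_pdfE a x : 0 < a ->
  gauss_pdf a x = (Num.sqrt (a * pi *+ 2))^-1 * expR (- x ^+ 2 / (a *+ 2)).
Proof.
move=> a0; have sa0 : Num.sqrt a != 0 by rewrite gt_eqF// sqrtr_gt0.
rewrite /gauss_pdf normal_pdfE// /normal_peak /normal_fun subr0.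
by rewrite sqr_sqrtr ?ltW.
Qed.

Lemma gauss_pdf_ge0 a x : 0 <= gauss_pdf a x.
Proof. exact: normal_pdf_ge0. Qed.

Lemma measurable_gauss_pdf a : measurable_fun setT (gauss_pdf a).
Proof. exact: measurable_normal_pdf. Qed.

Lemma integral_gauss_pdf a : (\int[leb]_x (gauss_pdf a x)%:E = 1)%E.
Proof. exact: integral_normal_pdf. Qed.

(** Completing the square. *)
Lemma gauss_pdf_product s t x y : 0 < s -> 0 < t ->
  gauss_pdf s (x - y) * gauss_pdf t y =
  gauss_pdf (s + t) x * gauss_pdf (s * t / (s + t)) (y - x * t / (s + t)).
Proof.
move=> s0 t0; have st0 : 0 < s + t by rewrite addr_gt0.
have q0 : 0 < s * t / (s + t) by rewrite divr_gt0// mulr_gt0.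
have pi0 := @pi_gt0 R.
rewrite !gauss_pdfE//.
move: (@pi R) pi0 => p p0; rewrite mulrACA -expRD -invfM -sqrtrM; last first.
  by rewrite mulrn_wge0// mulr_ge0// ltW.
rewrite [RHS]mulrACA -expRD -invfM -sqrtrM; last first.
  by rewrite mulrn_wge0// mulr_ge0// ltW.
have sn0 : s != 0 by rewrite gt_eqF.
have tn0 : t != 0 by rewrite gt_eqF.
have stn0 : s + t != 0 by rewrite gt_eqF.
congr ((Num.sqrt _)^-1 * expR _).
  by field.
by field; rewrite stn0 tn0 sn0.
Qed.

(** Doubling the variance leaves an exponential factor, which absorbs powers of [x]. *)
Lemma gauss_pdf_double a x : 0 < a ->
  gauss_pdf a x = Num.sqrt 2 * expR (- x ^+ 2 / (a *+ 4)) * gauss_pdf (a *+ 2) x.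
Proof.
move=> a0; rewrite !gauss_pdfE ?mulrn_wgt0//.
have an0 : a != 0 by rewrite gt_eqF.
move: (@pi R) => p.
rewrite mulrACA -expRD; congr (_ * expR _); last first.
  by field.
have -> : a *+ 2 * p *+ 2 = 2 * (a * p *+ 2) by ring.
by rewrite sqrtrM// invfM mulrA divff ?mul1r// gt_eqF// sqrtr_gt0.
Qed.

Lemma gauss_pdf_convolution s t x : 0 < s -> 0 < t ->
  (\int[leb]_y (gauss_pdf s (x - y) * gauss_pdf t y)%:E = (gauss_pdf (s + t) x)%:E)%E.
Proof.
move=> s0 t0; under eq_integral do rewrite gauss_pdf_product// EFinM.
rewrite ge0_integralZl//; last 3 first.
- apply/measurable_EFinP; apply: (measurableT_comp (measurable_gauss_pdf _)).
  by apply: measurable_funB.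
- by move=> y _; rewrite lee_fin gauss_pdf_ge0.
- by rewrite lee_fin gauss_pdf_ge0.
rewrite (@ge0_integral_translate (- (x * t / (s + t)))
  (fun y => (gauss_pdf (s * t / (s + t)) y)%:E)).
- by rewrite integral_gauss_pdf mule1.
- by apply/measurable_EFinP; exact: measurable_gauss_pdf.
- by move=> y; rewrite lee_fin gauss_pdf_ge0.
Qed.

Let forget (x : measurableTypeR R) : R := x.

Let measurable_forget : measurable_fun setT forget.
Proof. exact: (@measurable_id _ _ setT). Qed.

HB.instance Definition _ := isMeasurableFun.Build _ _ _ _ forget measurable_forget.

(** Brownian marginals of variance rate [s2]; a Dirac mass in the degenerate case. *)
Definition gauss_marginal (s2 t : R) : probability R R :=
  if 0 < s2 * t
  then (distribution (normal_prob 0 (Num.sqrt (s2 * t))) (forget : {mfun _ >-> _}) :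
    probability R R)
  else (\d_(0 : R) : probability R R).

Lemma ge0_integral_gauss_marginal s2 t (f : R -> \bar R) : 0 < s2 * t ->
  measurable_fun setT f -> (forall x, (0 <= f x)%E) ->
  (\int[gauss_marginal s2 t]_x f x = \int[leb]_x (f x * (gauss_pdf (s2 * t) x)%:E))%E.
Proof.
move=> st0 mf f0; rewrite /gauss_marginal st0 ge0_integral_distribution//.
apply: (@ge0_integral_density _ _ _ leb) => //.
- exact: measurable_gauss_pdf.
- by move=> x; exact: gauss_pdf_ge0.
Qed.

Lemma gauss_marginal_set s2 t B : 0 < s2 * t -> measurable B ->
  gauss_marginal s2 t B = (\int[leb]_x ((\1_B x)%:E * (gauss_pdf (s2 * t) x)%:E))%E.
Proof.
move=> st0 mB; rewrite -ge0_integral_gauss_marginal//.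
  by rewrite integral_indic// setIT.
exact/measurable_EFinP.
Qed.

(** The densities convolve by [gauss_pdf_convolution]; the exponential factor of
    [gauss_pdf_double] makes the tails [O(h)]. *)
Lemma gauss_marginal_semigroup s2 : 0 <= s2 ->
  convolution_semigroup (gauss_marginal s2).
Proof.
move=> s20; split.
- by move=> B mB; rewrite /gauss_marginal mulr0 ltxx.
- move=> s t s0 t0 B mB.
  have [s2t|s2t] := ltP 0 (s2 * t); last first.
    have s2t0 : s2 * t = 0 by apply/eqP; rewrite eq_le s2t mulr_ge0.
    have -> : gauss_marginal s2 (s + t) = gauss_marginal s2 s.
      by rewrite /gauss_marginal mulrDr s2t0 addr0.
    rewrite [in RHS]/gauss_marginal s2t0 ltxx integral_dirac//; last first.
      exact: measurable_translated_measure.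
    rewrite diracT mul1e; congr (_ _).
    by apply/seteqP; split=> x /=; rewrite addr0.
  have [s2s|s2s] := ltP 0 (s2 * s); last first.
    have s2s0 : s2 * s = 0 by apply/eqP; rewrite eq_le s2s mulr_ge0.
    have -> : gauss_marginal s2 (s + t) = gauss_marginal s2 t.
      by rewrite /gauss_marginal mulrDr s2s0 add0r.
    have -> : gauss_marginal s2 s = \d_(0 : R) by rewrite /gauss_marginal s2s0 ltxx.
    under eq_integral => y _.
      rewrite (_ : _ [set x | _] = (\1_B y)%:E); last first.
        by rewrite [LHS]diracE indicE; congr ((nat_of_bool _)%:R%:E);
          apply/idP/idP; rewrite !inE /= add0r.
      over.
    by rewrite integral_indic// setIT.
  have s2st : 0 < s2 * (s + t) by rewrite mulrDr addr_gt0.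
  have mB' y : measurable [set x : R | B (x + y)] by exact: measurable_translate.
  have mT := measurable_translated_measure (gauss_marginal s2 s) mB.
  have T0 (y : R) : (0 <= gauss_marginal s2 s [set x : R | B (x + y)%R])%E.
    exact: measure_ge0.
  rewrite [LHS](gauss_marginal_set s2st mB) [RHS](ge0_integral_gauss_marginal s2t mT T0).
  pose F (z : measurableTypeR R * measurableTypeR R) : \bar R := (\1_B z.1 * (gauss_pdf (s2 * s) (z.1 - z.2) *
    gauss_pdf (s2 * t) z.2))%:E.
  have mF : measurable_fun setT F.
    apply/measurable_EFinP; apply: measurable_funM.
      exact: (measurableT_comp (measurable_indic mB)).
    apply: measurable_funM; last exact: (measurableT_comp (measurable_gauss_pdf _)).
    apply: (measurableT_comp (measurable_gauss_pdf _)).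
    by apply: measurable_funB.
  have F0 z : (0 <= F z)%E by rewrite lee_fin !mulr_ge0 ?gauss_pdf_ge0.
  transitivity (\int[leb]_x \int[leb]_y F (x, y))%E.
    apply: eq_integral => x _; rewrite mulrDr -gauss_pdf_convolution// -ge0_integralZl//.
    - by apply/measurable_EFinP; apply: measurable_funM;
        apply: (measurableT_comp (measurable_gauss_pdf _)) => //; exact: measurable_funB.
    - by move=> y _; rewrite lee_fin mulr_ge0// gauss_pdf_ge0.
  rewrite (@fubini_tonelli _ _ _ _ _ leb leb F mF F0); apply: eq_integral => y _.
  transitivity ((\int[leb]_x ((\1_[set x : R | B (x + (y : R))%R] x)%:E *
      (gauss_pdf (s2 * s) x)%:E)) * (gauss_pdf (s2 * t) y)%:E)%E; last first.
    by congr (_ * _)%E; apply/esym/gauss_marginal_set.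
  rewrite -ge0_integralZr//; last 3 first.
  - apply: emeasurable_funM; apply/measurable_EFinP; last exact: measurable_gauss_pdf.
    exact: (measurable_indic (mB' y)).
  - by move=> x _; rewrite mule_ge0// lee_fin gauss_pdf_ge0.
  - by rewrite lee_fin gauss_pdf_ge0.
  rewrite -[LHS](@ge0_integral_translate y)//.
  + apply: eq_integral => x _; rewrite /F /= addrK -!EFinM mulrA.
    by congr ((_ * _ * _)%:E); rewrite !indicE; congr ((nat_of_bool _)%:R).
  + exact: (measurableT_comp mF (pair2_measurable y)).
- move=> e e0.
  have me := measurable_tail e.
  have z0 : (cst 0%E : R -> \bar R) h @[h --> 0^'+] --> 0%E by exact: cvg_cst.
  (* [exp (- y) <= 1 / y] with [y = x^2 / (4 s2 h)], on [|x| > e] *)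
  pose C := Num.sqrt 2 * (s2 *+ 4 / e ^+ 2).
  have C0 : 0 <= C by rewrite mulr_ge0// ?sqrtr_ge0// divr_ge0 ?mulrn_wge0// sqr_ge0.
  have h0 : (C * h)%:E @[h --> 0^'+] --> 0%E.
    apply: cvg_EFin; first by near=> h.
    rewrite -[X in _ --> X](mulr0 C); apply: cvgM; first exact: cvg_cst.
    exact: cvg_at_right_filter.
  apply: squeeze_cvge z0 h0; near=> h.
  have hp : 0 < h by near: h; exact: nbhs_right_gt.
  rewrite measure_ge0 /=.
  have [s2h|s2h] := ltP 0 (s2 * h); last first.
    rewrite /gauss_marginal ltNge s2h /= diracE memNset; last first.
      by rewrite /= normr0 => /(lt_trans e0); rewrite ltxx.
    by rewrite lee_fin mulr_ge0// ltW.
  rewrite gauss_marginal_set//.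
  apply: (@le_trans _ _ (\int[leb]_x ((C * h)%:E * (gauss_pdf (s2 * h *+ 2) x)%:E))%E); last first.
    rewrite ge0_integralZl//.
    - by rewrite integral_gauss_pdf mule1.
    - by apply/measurable_EFinP; exact: measurable_gauss_pdf.
    - by move=> x _; rewrite lee_fin gauss_pdf_ge0.
    - by rewrite lee_fin mulr_ge0// ltW.
  apply: ge0_le_integral => //.
  - by move=> x _; rewrite mule_ge0// lee_fin gauss_pdf_ge0.
  - apply: emeasurable_funM; apply/measurable_EFinP; last exact: measurable_gauss_pdf.
    exact: (measurable_indic me).
  - by apply: emeasurable_funM; apply/measurable_EFinP => //; exact: measurable_gauss_pdf.
  move=> x _; rewrite -!EFinM lee_fin indicE.
  case: (boolP (x \in _)) => [|_]; last first.
    by rewrite mul0r mulr_ge0 ?gauss_pdf_ge0// mulr_ge0// ltW.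
  rewrite inE /= mul1r => ex; rewrite gauss_pdf_double// ler_wpM2r ?gauss_pdf_ge0//.
  rewrite /C -mulrA ler_wpM2l ?sqrtr_ge0//.
  have ex2 : e ^+ 2 <= x ^+ 2.
    by rewrite -(real_normK (num_real x)) lerXn2r ?nnegrE// ltW.
  have x20 : 0 < x ^+ 2 by apply: lt_le_trans ex2; rewrite exprn_gt0.
  have q0 : 0 < x ^+ 2 / (s2 * h *+ 4) by rewrite divr_gt0// mulrn_wgt0.
  rewrite mulNr expRN -[leRHS]invrK lef_pV2 ?posrE ?expR_gt0 ?invr_gt0//; last first.
    by rewrite mulr_gt0// divr_gt0 ?exprn_gt0// mulrn_wgt0// -(pmulr_lgt0 _ hp).
  apply: le_trans (expR_ge1Dx _); apply: (@le_trans _ _ (x ^+ 2 / (s2 * h *+ 4))); last first.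
    by rewrite lerDr.
  have -> : s2 *+ 4 / e ^+ 2 * h = s2 * h *+ 4 / e ^+ 2 by ring.
  rewrite invfM invrK mulrC ler_wpM2r// invr_ge0 mulrn_wge0//; exact: ltW.
Unshelve. all: by end_near. Qed.

End gaussian.

Section trigonometric_bounds.
Context (R : realType).
Implicit Types (f : R -> R) (x y : R).

Lemma le0_of_derive_ge0 f g y : (forall x, is_derive x 1 f (g x)) ->
  (forall x, 0 <= x -> 0 <= g x) -> f 0 = 0 -> 0 <= y -> 0 <= f y.
Proof.
move=> fg g0 f0 y0; rewrite -f0.
have df x : derivable f x 1 by have [] := fg x.
apply: (@ger0_derive1_ndecry _ f 0) => //.
- by move=> x; rewrite in_itv /= andbT => x0; rewrite derive1E derive_val g0// ltW.
- apply: continuous_subspaceT => x; exact/differentiable_continuous/derivable1_diffP.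
Qed.

Lemma sin_le_id y : 0 <= y -> sin y <= y.
Proof.
move=> y0; rewrite -subr_ge0.
apply: (@le0_of_derive_ge0 (fun x => x - sin x) (fun x => 1 - cos x)) => //.
by rewrite sin0 subr0.
Qed.

Lemma cos_ge_quadratic y : 1 - y ^+ 2 / 2 <= cos y.
Proof.
wlog y0 : y / 0 <= y.
  move=> h; have [/h//|/ltW] := leP 0 y; rewrite -oppr_ge0 => /h.
  by rewrite sqrrN cosN.
rewrite -subr_ge0.
apply: (@le0_of_derive_ge0 (fun x => cos x - (1 - x ^+ 2 / 2)) (fun x => x - sin x)) => //.
- by move=> x; apply: is_derive_eq; rewrite /GRing.scale /=; field.
- by move=> x x0; rewrite subr_ge0 sin_le_id.
- by rewrite cos0 expr0n /= mul0r subr0 subrr.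
Qed.

Lemma sin_ge_cubic y : 0 <= y -> y - y ^+ 3 / 6 <= sin y.
Proof.
move=> y0; rewrite -subr_ge0.
apply: (@le0_of_derive_ge0 (fun x => sin x - (x - x ^+ 3 / 6))
  (fun x => cos x - (1 - x ^+ 2 / 2))) => //.
- by move=> x; apply: is_derive_eq; rewrite /GRing.scale /=; field.
- by move=> x _; rewrite subr_ge0 cos_ge_quadratic.
- by rewrite sin0 expr0n /= mul0r subr0 subrr.
Qed.

Lemma cos_le_quartic y : cos y <= 1 - y ^+ 2 / 2 + y ^+ 4 / 24.
Proof.
wlog y0 : y / 0 <= y.
  move=> h; have [/h//|/ltW] := leP 0 y; rewrite -oppr_ge0 => /h.
  by rewrite sqrrN cosN (_ : (- y) ^+ 4 = y ^+ 4)//; ring.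
rewrite -subr_ge0.
apply: (@le0_of_derive_ge0 (fun x => 1 - x ^+ 2 / 2 + x ^+ 4 / 24 - cos x)
  (fun x => sin x - (x - x ^+ 3 / 6))) => //.
- by move=> x; apply: is_derive_eq; rewrite /GRing.scale /=; field.
- by move=> x x0; rewrite subr_ge0 sin_ge_cubic.
- by rewrite cos0 !expr0n /= !mul0r subr0 addr0 subrr.
Qed.

End trigonometric_bounds.

Section gauss_moments.
Context (R : realType) (a : R) (a0 : 0 < a).
Local Notation leb := (@lebesgue_measure R).

Lemma is_derive_gauss_pdf (x : R) :
  is_derive x 1 (gauss_pdf a) (- (x / a) * gauss_pdf a x).
Proof.
pose c := (Num.sqrt (a * pi *+ 2))^-1.
have -> : gauss_pdf a = fun x => c * expR (- x ^+ 2 / (a *+ 2)).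
  by apply/funext => y; rewrite gauss_pdfE.
have an0 : a != 0 by rewrite gt_eqF.
move: c => c; apply: is_derive_eq; rewrite /GRing.scale /=.
by field.
Qed.

Lemma continuous_gauss_pdf : continuous (gauss_pdf a).
Proof. by apply: continuous_normal_pdf; rewrite gt_eqF// sqrtr_gt0. Qed.

Lemma gauss_pdf_le_double_quartic x :
  x ^+ 4 * gauss_pdf a x <= 32 * Num.sqrt 2 * a ^+ 2 * gauss_pdf (a *+ 2) x.
Proof.
rewrite gauss_pdf_double// mulrA ler_wpM2r ?gauss_pdf_ge0//.
have an0 : a != 0 by rewrite gt_eqF.
pose y := x ^+ 2 / (a *+ 4).
have y0 : 0 <= y by rewrite divr_ge0 ?sqr_ge0// mulrn_wge0// ltW.
have -> : x ^+ 4 = 16 * a ^+ 2 * y ^+ 2 by rewrite /y; field.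
rewrite mulNr -/y expRN.
have -> : 16 * a ^+ 2 * y ^+ 2 * (Num.sqrt 2 * (expR y)^-1) =
    16 * Num.sqrt 2 * a ^+ 2 * (y ^+ 2 / expR y) by ring.
have -> : 32 * Num.sqrt 2 * a ^+ 2 = 16 * Num.sqrt 2 * a ^+ 2 * 2 by ring.
have C0 : 0 <= 16 * Num.sqrt 2 * a ^+ 2 by rewrite mulr_ge0 ?sqr_ge0// mulr_ge0 ?sqrtr_ge0.
rewrite ler_wpM2l//.
rewrite ler_pdivrMr ?expR_gt0//.
have := expR_ge1Dxn 1 y0; rewrite !factS fact0 !muln1; lra.
Qed.

Let mpdf : measurable_fun setT (gauss_pdf a). Proof. exact: measurable_gauss_pdf. Qed.

Lemma gauss_fourth_moment_le :
  (\int[leb]_x (x ^+ 4 * gauss_pdf a x)%:E <= (32 * Num.sqrt 2 * a ^+ 2)%:E)%E.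
Proof.
apply: (@le_trans _ _ (\int[leb]_x (32 * Num.sqrt 2 * a ^+ 2 * gauss_pdf (a *+ 2) x)%:E)%E).
  apply: ge0_le_integral => //.
  - by move=> x _; rewrite lee_fin mulr_ge0 ?gauss_pdf_ge0// exprn_even_ge0.
  - by apply/measurable_EFinP; apply: measurable_funM => //; exact: exprn_measurable.
  - apply/measurable_EFinP; apply: measurable_funM => //; exact: measurable_gauss_pdf.
  - by move=> x _; rewrite lee_fin gauss_pdf_le_double_quartic.
under eq_integral do rewrite EFinM.
rewrite ge0_integralZl//.
- by rewrite integral_gauss_pdf mule1.
- by apply/measurable_EFinP; exact: measurable_gauss_pdf.
- by move=> x _; rewrite lee_fin gauss_pdf_ge0.
- by rewrite lee_fin mulr_ge0 ?sqr_ge0// mulr_ge0 ?sqrtr_ge0.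
Qed.

Let bigcup_sym : \bigcup_n `[- n.+1%:R, n.+1%:R]%classic = [set: R].
Proof.
apply/seteqP; split=> // x _; exists (Num.truncn `|x|) => //=.
by rewrite in_itv /= -ler_norml ltW// truncnS_gt.
Qed.

Let cvg_sym (f : R -> \bar R) : measurable_fun setT f -> (forall x, (0 <= f x)%E) ->
  (\int[leb]_(x in `[(- n.+1%:R)%R, n.+1%:R]) f x)%E @[n --> \oo] --> (\int[leb]_x f x)%E.
Proof.
move=> mf f0; rewrite -bigcup_sym; apply: ge0_nondecreasing_set_cvg_integral => //.
- move=> i j ij; apply/subsetPset => x /=; rewrite !in_itv /= => /andP[xi ix].
  rewrite (le_trans _ xi) ?(le_trans ix) ?ler_nat//.
  by rewrite lerN2 ler_nat.
- by move=> i; exact: measurable_funTS.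
Qed.

(** Integration by parts: [(x^2 - a) p(x)] is the derivative of [- a x p(x)]. *)
Lemma gauss_second_moment : (\int[leb]_x (x ^+ 2 * gauss_pdf a x)%:E = a%:E)%E.
Proof.
have m2 : measurable_fun setT (fun x : R => (x ^+ 2 * gauss_pdf a x)%:E).
  by apply/measurable_EFinP; apply: measurable_funM => //; exact: exprn_measurable.
have p2 x : (0 <= (x ^+ 2 * gauss_pdf a x)%:E)%E.
  by rewrite lee_fin mulr_ge0 ?sqr_ge0 ?gauss_pdf_ge0.
have mp : measurable_fun setT (fun x : R => (gauss_pdf a x)%:E).
  exact/measurable_EFinP.
have pp x : (0 <= (gauss_pdf a x)%:E)%E by rewrite lee_fin gauss_pdf_ge0.
have h1 := cvg_sym m2 p2; have h2 := cvg_sym mp pp.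
rewrite integral_gauss_pdf in h2.
pose F x := - (a * (x * gauss_pdf a x)).
have an0 : a != 0 by rewrite gt_eqF.
have dF (x : R) : is_derive x 1 F ((x ^+ 2 - a) * gauss_pdf a x).
  have := is_derive_gauss_pdf x => dp.
  rewrite /F; apply: is_derive_eq; rewrite /GRing.scale /=; by field.
have cF : continuous F.
  move=> x; apply/differentiable_continuous/derivable1_diffP.
  by have [] := dF x.
have cf : continuous (fun x : R => (x ^+ 2 - a) * gauss_pdf a x).
  move=> x; apply: cvgM; last exact: continuous_gauss_pdf.
  by apply: cvgB; [exact: exprn_continuous|exact: cvg_cst].
have FTC n : (\int[leb]_(x in `[(- n.+1%:R)%R, n.+1%:R]) (x ^+ 2 * gauss_pdf a x)%:E =
    a%:E * \int[leb]_(x in `[(- n.+1%:R)%R, n.+1%:R]) (gauss_pdf a x)%:E -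
    (2 * a * (n.+1%:R * gauss_pdf a n.+1%:R))%:E)%E.
  have n0 : - n.+1%:R < n.+1%:R :> R by rewrite gt0_cp.
  have ci : {within `[- n.+1%:R, n.+1%:R], continuous (fun x : R => a * gauss_pdf a x)}.
    apply: continuous_subspaceT => x; apply: cvgM; first exact: cvg_cst.
    exact: continuous_gauss_pdf.
  have ca : {within `[- n.+1%:R, n.+1%:R], continuous (fun x : R => (x ^+ 2 - a) * gauss_pdf a x)}.
    exact: continuous_subspaceT.
  have i1 := continuous_compact_integrable (@segment_compact R _ _) ca.
  have i2 := continuous_compact_integrable (@segment_compact R _ _) ci.
  transitivity (\int[leb]_(x in `[(- n.+1%:R)%R, n.+1%:R])
      (((x ^+ 2 - a) * gauss_pdf a x)%:E + (a * gauss_pdf a x)%:E))%E.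
    by apply: eq_integral => x _; rewrite -EFinD; congr EFin; ring.
  rewrite integralD//=.
  rewrite (@continuous_FTC2 _ _ F)//; last 2 first.
  - split.
    + by move=> x _; have [] := dF x.
    + exact: cvg_at_right_filter (cF _).
    + exact: cvg_at_left_filter (cF _).
  - by move=> x _; rewrite derive1E; have [_ ->] := dF x.
  under eq_integral do rewrite EFinM.
  rewrite ge0_integralZl//; last 2 first.
  - exact: measurable_funTS.
  - by rewrite lee_fin ltW.
  rewrite addeC; congr (_ + _)%E; rewrite -EFinB /F; congr EFin.
  have -> : gauss_pdf a (- n.+1%:R) = gauss_pdf a n.+1%:R.
    by rewrite !gauss_pdfE// sqrrN.
  ring.
apply: (cvg_unique _ h1); first exact: ereal_hausdorff.
suff : (a%:E * \int[leb]_(x in `[(- n.+1%:R)%R, n.+1%:R]) (gauss_pdf a x)%:E -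
    (2 * a * (n.+1%:R * gauss_pdf a n.+1%:R))%:E)%E @[n --> \oo] --> (a%:E * 1 - 0)%E.
  by rewrite mule1 sube0; under eq_cvg do rewrite -FTC.
apply: cvgeB => //.
- exact: cvgeZl.
- apply: cvg_EFin; first by near=> n.
  rewrite [X in X @ _ --> _](_ : _ =
      (fun n => 2 * a * (n.+1%:R * gauss_pdf a n.+1%:R))); last by apply/funext.
  rewrite -[X in _ --> X](mulr0 (2 * a)); apply: cvgM; first exact: cvg_cst.
  pose c := (Num.sqrt (a * pi *+ 2))^-1.
  have c0 : 0 <= c by rewrite invr_ge0 sqrtr_ge0.
  have u0 : (c * (a *+ 2)) * harmonic n @[n --> \oo] --> (0 : R).
    rewrite -[X in _ --> X](mulr0 (c * (a *+ 2))); apply: cvgM; first exact: cvg_cst.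
    exact: cvg_harmonic.
  have z0 : (0 : R) @[n --> \oo] --> (0 : R) by exact: cvg_cst.
  apply: squeeze_cvgr z0 u0; near=> n; rewrite mulr_ge0 ?gauss_pdf_ge0//=.
  rewrite gauss_pdfE// -/c mulrCA -mulrA ler_wpM2l//.
  have n0 : 0 < n.+1%:R :> R by rewrite ltr0n.
  rewrite -ler_pdivlMl// mulNr expRN.
  rewrite -[leRHS]invrK lef_pV2 ?posrE ?expR_gt0 ?invr_gt0 ?mulr_gt0 ?mulrn_wgt0 ?invr_gt0//.
  have -> : ((n.+1%:R)^-1 * (a *+ 2 * (n.+1%:R)^-1))^-1 = n.+1%:R ^+ 2 / (a *+ 2).
    field; by rewrite an0 gt_eqF.
  by apply: le_trans (expR_ge1Dx _); rewrite lerDr.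
Unshelve. all: by end_near. Qed.

End gauss_moments.

(** * Characteristic functions *)

Section characteristic_function.
Context (R : realType).
Implicit Types (P Q : probability R R) (u : R).

Definition characteristic_function P u : R[i] :=
  cintegral P (fun x => cexp (u *i * x%:C)).

Lemma characteristic_functionE P u : characteristic_function P u =
  (\int[P]_x cos (u * x))%R +i* (\int[P]_x sin (u * x))%R.
Proof.
rewrite /characteristic_function /cintegral.
by congr (_ +i* _); apply: eq_Rintegral => x _; rewrite mul_imaginary_real cexp_imaginary.
Qed.

Lemma measurable_cosM u : measurable_fun setT (fun x : R => cos (u * x)).
Proof.
apply: (measurableT_comp (f := @cos R)); first exact: continuous_measurable_fun (@continuous_cos R).
exact: measurable_funM.
Qed.

Lemma measurable_sinM u : measurable_fun setT (fun x : R => sin (u * x)).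
Proof.
apply: (measurableT_comp (f := @sin R)); first exact: continuous_measurable_fun (@continuous_sin R).
exact: measurable_funM.
Qed.

Lemma bounded_integrable d (T : measurableType d) (P : probability T R) (f : T -> R) (b : R) :
  measurable_fun setT f -> (forall x, `|f x| <= b) -> P.-integrable setT (EFin \o f).
Proof.
move=> mf fb; apply: measurable_bounded_integrable => //.
  by apply: (le_lt_trans (probability_le1 P measurableT)); rewrite ltry.
exists b; split; first exact: num_real.
by move=> c bc x _; exact: le_trans (fb x) (ltW bc).
Qed.

Lemma cosM_integrable P u : P.-integrable setT (EFin \o (fun x => cos (u * x))).
Proof. exact: (@bounded_integrable _ _ P _ 1 (measurable_cosM u) (fun x => cos_max _)). Qed.

Lemma sinM_integrable P u : P.-integrable setT (EFin \o (fun x => sin (u * x))).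
Proof. exact: (@bounded_integrable _ _ P _ 1 (measurable_sinM u) (fun x => sin_max _)). Qed.

Lemma integral_affine P (f : R -> R) (c e : R) : P.-integrable setT (EFin \o f) ->
  (\int[P]_x (c + e * f x)%:E = (c + e * \int[P]_x f x)%:E)%E.
Proof.
move=> fi; under eq_integral do rewrite EFinD EFinM.
have cT : P setT = 1%E by exact: probability_setT.
rewrite integralD//; last 2 first.
- exact: finite_measure_integrable_cst.
- exact: integrableZl.
rewrite integral_cst// integralZl// EFinD EFinM /Rintegral fineK; last exact: integrable_fin_num.
by congr (_ + _)%E; rewrite -[RHS]mule1; congr (_ * _)%E; exact: cT.
Qed.

Lemma Rintegral_convolution P Q (f : R -> R) (b : R) : measurable_fun setT f ->
  (forall x, `|f x| <= b) ->
  (\int[convolution P Q]_x f x = \int[P]_x \int[Q]_y f (x + y))%R.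
Proof.
move=> mf fb; rewrite /Rintegral.
have mf2 : measurable_fun setT (fun z : R * R => f (z.1 + z.2)).
  by apply: (measurableT_comp mf); exact: measurable_funD.
have i2 : (P \x Q)%E.-integrable setT (EFin \o (fun z : R * R => f (z.1 + z.2))).
  exact: (@bounded_integrable _ _ (P \x Q)%E _ b mf2).
rewrite /convolution integral_distribution//; last exact/measurable_EFinP.
rewrite -[X in fine X = _](integral12_prod_meas1 i2); congr fine.
apply: eq_integral => x _; rewrite /fubini_F /= fineK//.
apply: integrable_fin_num => //; apply: (@bounded_integrable _ _ Q _ b) => //.
by apply: measurableT_comp mf _; exact: measurable_funD.
Qed.

Lemma characteristic_function_convolution P Q u :
  characteristic_function (convolution P Q) u =
  characteristic_function P u * characteristic_function Q u.
Proof.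
rewrite !characteristic_functionE.
have ic := cosM_integrable Q u; have isn := sinM_integrable Q u.
have jc := cosM_integrable P u; have jsn := sinM_integrable P u.
have iZ (S : probability R R) (f : R -> R) (r : R) : S.-integrable setT (EFin \o f) ->
    S.-integrable setT (EFin \o (fun x => r * f x)).
  move=> h; rewrite (_ : _ \o _ = (fun x => r%:E * (f x)%:E)%E); first exact: integrableZl.
  by apply/funext => x /=.
have iZr (S : probability R R) (f : R -> R) (r : R) : S.-integrable setT (EFin \o f) ->
    S.-integrable setT (EFin \o (fun x => f x * r)).
  by move=> /(iZ _ _ r); under eq_fun do rewrite /= mulrC.
rewrite (Rintegral_convolution _ _ (measurable_cosM u) (fun x => cos_max _)).
rewrite (Rintegral_convolution _ _ (measurable_sinM u) (fun x => sin_max _)).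
have cE x : (\int[Q]_y cos (u * (x + y)) = cos (u * x) * \int[Q]_y cos (u * y)
    - sin (u * x) * \int[Q]_y sin (u * y))%R.
  under eq_Rintegral do rewrite mulrDr cosD.
  by rewrite RintegralB// ?RintegralZl//; [exact: iZ|exact: iZ].
have sE x : (\int[Q]_y sin (u * (x + y)) = sin (u * x) * \int[Q]_y cos (u * y)
    + cos (u * x) * \int[Q]_y sin (u * y))%R.
  under eq_Rintegral do rewrite mulrDr sinD.
  by rewrite RintegralD// ?RintegralZl//; [exact: iZ|exact: iZ].
under eq_Rintegral do rewrite cE.
under [X in _ +i* X = _]eq_Rintegral do rewrite sE.
rewrite RintegralB// ?RintegralD// ?RintegralZr//; try exact: iZr.
apply/eqP; rewrite eq_complex /=; apply/andP; split=> //.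
by rewrite addrC.
Qed.

Lemma eq_characteristic_function P Q u :
  (forall B, measurable B -> P B = Q B) ->
  characteristic_function P u = characteristic_function Q u.
Proof.
move=> PQ; rewrite !characteristic_functionE /Rintegral.
by congr (fine _ +i* fine _); apply: eq_measure_integral => B mB _; exact: PQ.
Qed.

Lemma characteristic_function_dirac (c u : R) :
  characteristic_function (\d_c : probability R R) u = cexp ((u * c) *i).
Proof.
rewrite characteristic_functionE cexp_imaginary /Rintegral.
rewrite !integral_dirac//; try (by apply/measurable_EFinP; exact: measurable_cosM).
  by rewrite !diracT !mul1e.
by apply/measurable_EFinP; exact: measurable_sinM.
Qed.

(** If [C] and [S] are the means of the cosine and the sine, then [C^2 + S^2] is the
    mean of [C cos + S sin], which Cauchy-Schwarz bounds pointwise by the root of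
    [C^2 + S^2]. *)
Lemma characteristic_function_le1 P u : normc (characteristic_function P u) <= 1.
Proof.
have ic := cosM_integrable P u; have isn := sinM_integrable P u.
rewrite characteristic_functionE /=.
set C := Rintegral _ _ _; set S := Rintegral _ _ _.
have CS : C ^+ 2 + S ^+ 2 <= Num.sqrt (C ^+ 2 + S ^+ 2).
  have E : C ^+ 2 + S ^+ 2 = \int[P]_x (C * cos (u * x) + S * sin (u * x)).
    rewrite RintegralD//; last 2 first.
    - rewrite (_ : _ \o _ = (fun x => C%:E * (cos (u * x))%:E)%E) //; exact: integrableZl.
    - rewrite (_ : _ \o _ = (fun x => S%:E * (sin (u * x))%:E)%E) //; exact: integrableZl.
    by rewrite !RintegralZl.
  rewrite [leLHS]E -[leRHS]mulr1.
  have -> : 1 = fine (P setT) by rewrite probability_setT.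
  rewrite -Rintegral_cst//; apply: le_Rintegral => //.
  - rewrite (_ : _ \o _ = ((fun x => C%:E * (cos (u * x))%:E) \+
        (fun x => S%:E * (sin (u * x))%:E))%E) //.
    by apply: integrableD => //; exact: integrableZl.
  - by apply: (@bounded_integrable _ _ P) => // x; exact: lexx.
  move=> x _; apply: (le_trans (ler_norm _)); rewrite -sqrtr_sqr ler_wsqrtr//.
  rewrite -[leRHS]mulr1 -(cos2Dsin2 (u * x)).
  move: (cos (u * x)) (sin (u * x)) => p q; rewrite -subr_ge0.
  rewrite (_ : _ - _ = (C * q - S * p) ^+ 2) ?sqr_ge0//; ring.
have s0 := sqrtr_ge0 (C ^+ 2 + S ^+ 2).
have CS0 : 0 <= C ^+ 2 + S ^+ 2 by rewrite addr_ge0 ?sqr_ge0.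
rewrite leNgt; apply/negP => s1.
move: CS; rewrite -{1}(sqr_sqrtr CS0) expr2 leNgt ltr_pMl ?s1//.
exact: lt_trans s1.
Qed.

End characteristic_function.

(** * Exponents of semigroups *)

Section infinitely_divisible_exponent.
Context (R : realType).
Local Notation leb := (@lebesgue_measure R).
Implicit Types (m : R -> probability R R) (u : R).

Lemma cvg_difference_quotient (f : R -> R) (l : R) : is_derive (0 : R) 1 f l -> f 0 = 1 ->
  (n.+1%:R * (f n.+1%:R^-1 - 1)) @[n --> \oo] --> l.
Proof.
move=> [df <-] f0.
have : h^-1 *: (f (h + 0) - f 0) @[h --> (0:R)^'] --> 'D_1 f 0.
  have := df; rewrite /derivable /derive => /cvg_ex[/= l' hl].
  rewrite (cvg_lim _ hl)//; move: hl; apply: cvg_trans; apply: near_eq_cvg; near=> h.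
  by rewrite !addr0 [h%:A]mulr1.
move=> h; have hn : (n.+1%:R^-1 : R) @[n --> \oo] --> (0 : R)^'.
  move=> A; rewrite /= /nbhs /= => -[e e0 eA].
  have /cvgrPdist_lt/(_ _ e0) := @cvg_harmonic R.
  apply: filterS => n /=; rewrite sub0r normrN => ne.
  by apply: eA => //=; rewrite ?sub0r ?normrN// invr_eq0 pnatr_eq0.
have := cvg_comp _ _ hn h; apply: cvg_trans; apply: near_eq_cvg; near=> n => /=.
by rewrite addr0 f0 invrK.
Unshelve. all: by end_near. Qed.

(** The roots [e] of [exp eta] given by [exp (eta / n)] have the same expansion, and
    [|g^n - e^n| <= n |g - e|] in the unit disk. *)
Lemma eq_cexp_of_roots (G eta : R[i]) (g : nat -> R[i]) (K : R) :
  complex.Re eta <= 0 ->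
  (forall n, normc (g n) <= 1) -> (forall n, G = g n ^+ n.+1) ->
  (forall n, normc (g n - 1 - n.+1%:R^-1%:C * eta) <= K * n.+1%:R^-1 ^+ 2) ->
  G = cexp eta.
Proof.
move=> eta0 g1 Gg gK.
pose E n := cexp (n.+1%:R^-1%:C * eta).
have n0 n : n.+1%:R != 0 :> R by rewrite pnatr_eq0.
have Ere n : complex.Re (n.+1%:R^-1%:C * eta) = n.+1%:R^-1 * complex.Re eta.
  by case: (eta) => p q /=; rewrite mul0r subr0.
have Eim n : complex.Im (n.+1%:R^-1%:C * eta) = n.+1%:R^-1 * complex.Im eta.
  by case: (eta) => p q /=; rewrite mul0r addr0.
have EE n : cexp eta = E n ^+ n.+1.
  rewrite /E -cexpMn -mulrnAl -rmorphMn /= -mulr_natr mulVf// mul1r.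
  by [].
have E1 n : normc (E n) <= 1.
  by rewrite normc_cexp Ere -expR0 ler_expR mulr_ge0_le0.
(* real and imaginary part of [n (exp (eta / n) - 1) - eta] *)
pose er n := n.+1%:R * (complex.Re (E n) - 1) - complex.Re eta.
pose ei n := n.+1%:R * complex.Im (E n) - complex.Im eta.
have bound n : normc (G - cexp eta) <= K * n.+1%:R^-1 + (`|er n| + `|ei n|).
  rewrite (Gg n) (EE n); apply: le_trans (normc_sub_exp_le _ (g1 n) (E1 n)) _.
  have -> : g n - E n = (g n - 1 - n.+1%:R^-1%:C * eta) - (E n - 1 - n.+1%:R^-1%:C * eta) by ring.
  apply: le_trans (ler_wpM2l _ (normcB_le _ _)) _; first exact: ler0n.
  rewrite mulrDr; apply: lerD.
    apply: le_trans (ler_wpM2l _ (gK n)) _; first exact: ler0n.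
    by rewrite expr2 mulrCA [n.+1%:R * (_ * _)]mulrA mulfV// mul1r.
  apply: le_trans (ler_wpM2l _ (normc_le_add _)) _; first exact: ler0n.
  have nrm (x : R) : n.+1%:R * `|x| = `|n.+1%:R * x| by rewrite normrM [`|n.+1%:R|]ger0_norm.
  rewrite mulrDr !nrm.
  suff [-> ->] : n.+1%:R * complex.Re (E n - 1 - n.+1%:R^-1%:C * eta) = er n /\
    n.+1%:R * complex.Im (E n - 1 - n.+1%:R^-1%:C * eta) = ei n by [].
  rewrite /er /ei; move: (Ere n) (Eim n); case: (E n) => p q; case: (_ * eta) => p' q' /= -> ->.
  by split; field.
have er0 : er n @[n --> \oo] --> (0 : R).
  rewrite -(subrr (complex.Re eta)); apply: cvgB; last exact: cvg_cst.
  pose f t := expR (t * complex.Re eta) * cos (t * complex.Im eta).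
  have : is_derive (0 : R) 1 f (complex.Re eta).
    by apply: is_derive_eq; rewrite /GRing.scale /= !mul0r expR0 cos0 sin0; ring.
  move/cvg_difference_quotient; rewrite /f !mul0r expR0 cos0 mulr1 => /(_ erefl).
  by under eq_cvg do rewrite -Ere -Eim.
have ei0 : ei n @[n --> \oo] --> (0 : R).
  rewrite -(subrr (complex.Im eta)); apply: cvgB; last exact: cvg_cst.
  pose f t := 1 + expR (t * complex.Re eta) * sin (t * complex.Im eta).
  have : is_derive (0 : R) 1 f (complex.Im eta).
    by apply: is_derive_eq; rewrite /GRing.scale /= !mul0r expR0 cos0 sin0; ring.
  move/cvg_difference_quotient; rewrite /f !mul0r sin0 mulr0 addr0 => /(_ erefl).
  by under eq_cvg do rewrite addrC addKr -Ere -Eim.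
have lim : K * n.+1%:R^-1 + (`|er n| + `|ei n|) @[n --> \oo] --> (0 : R).
  have z0 : K * 0 + (`|(0 : R)| + `|(0 : R)|) = 0 by rewrite normr0; ring.
  rewrite -[X in _ --> X]z0; apply: cvgD; first by apply: cvgM; [exact: cvg_cst|exact: cvg_harmonic].
  by apply: cvgD; apply: cvg_norm.
have : normc (G - cexp eta) <= 0.
  rewrite -(cvg_lim _ lim)//; apply: limr_ge; first by apply/cvg_ex; exists 0.
  by near=> n.
by rewrite le_eqVlt ltNge normc_ge0 orbF normc_eq0 subr_eq0 => /eqP.
Unshelve. all: by end_near. Qed.

Lemma characteristic_function_semigroup_root m u n : convolution_semigroup m ->
  characteristic_function (m 1) u =
  characteristic_function (m n.+1%:R^-1) u ^+ n.+1.
Proof.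
move=> sg; set h : R := n.+1%:R^-1.
have h0 : 0 <= h by rewrite invr_ge0 ler0n.
suff H k : characteristic_function (m (k%:R * h)) u = characteristic_function (m h) u ^+ k.
  by rewrite -H mulfV// pnatr_eq0.
elim: k => [|k IH].
  have [m0 _ _] := sg; rewrite mul0r expr0 (eq_characteristic_function u m0).
  rewrite (characteristic_function_dirac 0 u) mulr0 cexp_imaginary cos0 sin0.
  by [].
rewrite exprSr -IH -characteristic_function_convolution -addn1 natrD mulrDl mul1r.
apply: eq_characteristic_function => B mB.
by apply: semigroup_convolution => //; rewrite mulr_ge0.
Qed.

Lemma ge0_integral_opp (f : R -> \bar R) :
  measurable_fun setT f -> (forall x, (0 <= f x)%E) ->
  (\int[leb]_x f (- x)%R = \int[leb]_x f x)%E.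
Proof.
move=> mf f0; pose phi : measurableTypeR R -> measurableTypeR R := fun x => - x.
have mphi : measurable_fun setT phi by exact: measurable_funN.
rewrite -[LHS](@ge0_integral_pushforward _ _ _ _ _ phi mphi leb setT f)//.
by apply: eq_measure_integral => A mA _; exact: lebesgue_measureN.
Qed.

(** The roots are the characteristic functions at time [1 / n]. The second moment gives
    their first-order term and the fourth moment bounds the error. *)
Lemma characteristic_function_gauss (s2 u : R) : 0 <= s2 ->
  characteristic_function (gauss_marginal s2 1) u = cexp (- (s2 * u ^+ 2 / 2))%:C.
Proof.
rewrite le_eqVlt => /predU1P[<-|s20].
  have -> : gauss_marginal (0 : R) 1 = \d_(0 : R) by rewrite /gauss_marginal mul0r ltxx.
  by rewrite (characteristic_function_dirac 0 u) mulr0 !mul0r oppr0.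
have sg := gauss_marginal_semigroup (ltW s20).
have eta0 : - (s2 * u ^+ 2 / 2) <= 0.
  by rewrite oppr_le0 divr_ge0// mulr_ge0 ?sqr_ge0// ltW.
apply: (@eq_cexp_of_roots _ _
    (fun n => characteristic_function (gauss_marginal s2 n.+1%:R^-1) u)
    (u ^+ 4 * (32 * Num.sqrt 2 * s2 ^+ 2 / 24))) => //.
- by move=> n; exact: characteristic_function_le1.
- by move=> n; exact: characteristic_function_semigroup_root.
move=> n; set h : R := n.+1%:R^-1.
have h0 : 0 < h by rewrite invr_gt0 ltr0n.
have sh0 : 0 < s2 * h by exact: mulr_gt0.
rewrite characteristic_functionE.
set a := s2 * h in sh0 *.
have gE f : measurable_fun setT f -> (forall x, (0 <= f x)%E) ->
    (\int[gauss_marginal s2 h]_x f x = \int[leb]_x (f x * (gauss_pdf a x)%:E))%E.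
  exact: ge0_integral_gauss_marginal.
have sym f : measurable_fun setT f -> (forall x, (0 <= f x)%E) ->
    (\int[gauss_marginal s2 h]_x f (- x)%R = \int[gauss_marginal s2 h]_x f x)%E.
  move=> mf f0; rewrite !gE//; last exact: (measurableT_comp mf).
  pose fp (x : R) := (f x * (gauss_pdf a x)%:E)%E.
  have mfp : measurable_fun setT fp.
    by apply: emeasurable_funM => //; apply/measurable_EFinP; exact: measurable_gauss_pdf.
  have fp0 x : (0 <= fp x)%E by rewrite mule_ge0// lee_fin gauss_pdf_ge0.
  rewrite -[RHS](ge0_integral_opp mfp fp0).
  by apply: eq_integral => x _; rewrite /fp !gauss_pdfE// sqrrN.
have ic := cosM_integrable (gauss_marginal s2 h) u.
have is_ := sinM_integrable (gauss_marginal s2 h) u.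
have mc := measurable_cosM u; have ms := measurable_sinM u.
have S0 : \int[gauss_marginal s2 h]_x sin (u * x) = 0.
  have m1 (e : R) : measurable_fun setT (fun x : R => (1 + e * sin (u * x))%:E).
    by apply/measurable_EFinP; apply: measurable_funD => //; exact: measurable_funM.
  have E (e : R) : (\int[gauss_marginal s2 h]_x (1 + e * sin (u * x))%:E =
      (1 + e * \int[gauss_marginal s2 h]_x sin (u * x))%:E)%E.
    exact: integral_affine.
  have p1 x : (0 <= (1 + 1 * sin (u * x))%:E)%E.
    by rewrite lee_fin mul1r -lerBlDl sub0r sin_geN1.
  have := sym _ (m1 1) p1.
  rewrite E; under eq_integral do rewrite mulrN sinN mulrN -mulN1r.
  under eq_integral do rewrite mulrA mulr1.
  rewrite E => -[]; lra.
have m2 : measurable_fun setT (fun x : R => (x ^+ 2)%:E).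
  by apply/measurable_EFinP; exact: exprn_measurable.
have m4 : measurable_fun setT (fun x : R => (x ^+ 4)%:E).
  by apply/measurable_EFinP; exact: exprn_measurable.
have p2 (x : R) : (0 <= (x ^+ 2)%:E)%E by rewrite lee_fin sqr_ge0.
have p4 (x : R) : (0 <= (x ^+ 4)%:E)%E by rewrite lee_fin exprn_even_ge0.
have I2 : (\int[gauss_marginal s2 h]_x (x ^+ 2)%:E = a%:E)%E.
  by rewrite gE//; under eq_integral do rewrite -EFinM; rewrite gauss_second_moment.
have I4 : (\int[gauss_marginal s2 h]_x (x ^+ 4)%:E <= (32 * Num.sqrt 2 * a ^+ 2)%:E)%E.
  by rewrite gE//; under eq_integral do rewrite -EFinM; rewrite gauss_fourth_moment_le.
set C := Rintegral _ _ (fun x => cos _).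
have IC : (\int[gauss_marginal s2 h]_x (1 - cos (u * x))%:E = (1 - C)%:E)%E.
  by under eq_integral do rewrite -mulN1r; rewrite integral_affine// mulN1r.
have mC : measurable_fun setT (fun x : R => (1 - cos (u * x))%:E).
  by apply/measurable_EFinP; exact: measurable_funB.
have pC x : (0 <= (1 - cos (u * x))%:E)%E by rewrite lee_fin subr_ge0 cos_le1.
have u20 : 0 <= u ^+ 2 / 2 by rewrite divr_ge0 ?sqr_ge0.
have u40 : 0 <= u ^+ 4 / 24 by rewrite divr_ge0 ?exprn_even_ge0.
have C1 : 1 - C <= u ^+ 2 / 2 * a.
  rewrite -lee_fin -IC EFinM -I2 -ge0_integralZl//.
  apply: ge0_le_integral => //; first exact: measurable_funeM.
  move=> x _; rewrite -EFinM lee_fin.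
  have := cos_ge_quadratic (u * x); rewrite exprMn; lra.
have C2 : u ^+ 2 / 2 * a <= 1 - C + u ^+ 4 / 24 * (32 * Num.sqrt 2 * a ^+ 2).
  rewrite -lee_fin EFinM -I2 -ge0_integralZl// EFinD -IC.
  apply: (@le_trans _ _ (\int[gauss_marginal s2 h]_x
      ((1 - cos (u * x))%:E + (u ^+ 4 / 24)%:E * (x ^+ 4)%:E))%E).
    apply: ge0_le_integral => //.
    - by move=> x _; rewrite mule_ge0.
    - exact: measurable_funeM.
    - by apply: emeasurable_funD => //; exact: measurable_funeM.
    move=> x _; rewrite -!EFinM -EFinD lee_fin.
    have := cos_le_quartic (u * x); rewrite !exprMn; lra.
  rewrite ge0_integralD//; last 2 first.
  - by move=> x _; rewrite mule_ge0.
  - exact: measurable_funeM.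
  rewrite ge0_integralZl// [X in (_ <= _ + X)%E]EFinM; apply: leeD2l; exact: lee_wpmul2l.
rewrite S0; set z := (X in normc X).
have -> : z = (C - 1 + u ^+ 2 / 2 * a)%:C.
  by rewrite /z /a; apply/eqP; rewrite eq_complex /=; apply/andP; split; apply/eqP; field.
rewrite normc_real ger0_norm; last by lra.
move: C2; rewrite /a exprMn; move: (Num.sqrt 2) => q; lra.
Qed.

End infinitely_divisible_exponent.

Section compound_poisson_exponent.
Context (R : realType) (nu : probability R R) (rate : R) (rate0 : 0 <= rate).
Local Notation cp := (compound_poisson nu rate).

(** No jump, one jump, and a probability [O(h^2)] of at least two. *)
Lemma compound_poisson_mean_expansion (h : R) (f : R -> R) : 0 <= h ->
  measurable_fun setT f -> (forall x, 0 <= f x <= 2) ->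
  `|(\int[cp h]_x f x - ((1 - rate * h) * f 0 + rate * h * \int[nu]_x f x))%R|
    <= 6 * (rate * h) ^+ 2.
Proof.
move=> h0 mf f02; set q := rate * h.
have q0 : 0 <= q by exact: mulr_ge0.
have mfE : measurable_fun setT (EFin \o f) by exact/measurable_EFinP.
have f0E x : (0 <= (EFin \o f) x)%E by rewrite lee_fin; have /andP[] := f02 x.
have fb x : `|f x| <= 2 by have /andP[? ?] := f02 x; rewrite ger0_norm.
have If (S : probability R R) : S.-integrable setT (EFin \o f).
  exact: (@bounded_integrable _ _ _ S _ 2 mf fb).
pose J n := (\int[convolution_power nu n]_x (f x)%:E)%E.
have J0 n : (0 <= J n)%E by apply: integral_ge0 => x _; exact: f0E.
have JE (S : probability R R) : (\int[S]_x (f x)%:E = (\int[S]_x f x)%R%:E)%E.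
  by apply/esym/fineK; apply: integrable_fin_num => //; exact: If.
have R2 (S : probability R R) : 0 <= (\int[S]_x f x)%R <= 2.
  apply/andP; split; first by apply: Rintegral_ge0 => x _; have /andP[] := f02 x.
  have := @integral_affine _ S f 2 (-1) (If S); rewrite mulN1r => E.
  rewrite -subr_ge0 -lee_fin -E; apply: integral_ge0 => x _.
  by rewrite lee_fin mulN1r subr_ge0; have /andP[] := f02 x.
have pw0 n : (0 <= (poisson_weight q n)%:E)%E by rewrite lee_fin poisson_weight_ge0.
have JE0 : J 0%N = (f 0)%:E by rewrite /J /= integral_dirac// diracT mul1e.
have JE1 : J 1%N = (\int[nu]_x f x)%R%:E.
  rewrite /J /= (ge0_integral_convolution nu \d_(0 : R) mfE f0E) -JE.
  apply: eq_integral => x _; rewrite integral_dirac//; last first.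
    by apply: measurableT_comp mfE _; exact: measurable_funD.
  by rewrite diracT mul1e /= addr0.
have main : (\int[cp h]_x (f x)%:E =
    \sum_(0 <= n <oo) (poisson_weight q n)%:E * J n)%E.
  exact: (ge0_integral_compound_poisson nu rate0 h0 mfE f0E).
have total := poisson_weight_sum q0.
pose T := (\sum_(2 <= n <oo) (poisson_weight q n)%:E * J n)%E.
pose W := (\sum_(2 <= n <oo) (poisson_weight q n)%:E)%E.
have T0 : (0 <= T)%E by apply: nneseries_ge0 => n _ _; rewrite mule_ge0.
have W0 : (0 <= W)%E by apply: nneseries_ge0 => n _ _.
have TW : (T <= 2%:E * W)%E.
  rewrite /W -nneseriesZl; last by [].
  apply: lee_nneseries => n _; first by rewrite mule_ge0.
  by rewrite muleC lee_wpmul2r// /J JE lee_fin; have /andP[] := R2 (convolution_power nu n).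
rewrite (nneseries_split 0 2)//= -/W in total.
rewrite (nneseries_split 0 2)/= in main; last by move=> n _; rewrite mule_ge0.
rewrite -/T add0n in main total.
rewrite !big_nat_recr//= big_geq// add0e in main total.
rewrite JE0 JE1 JE in main.
have pE0 : poisson_weight q 0 = expR (- q) by rewrite /poisson_weight expr0 fact0 divr1 mulr1.
have pE1 : poisson_weight q 1 = expR (- q) * q by rewrite /poisson_weight expr1 factS fact0 mul1n divr1.
rewrite pE0 pE1 in main total.
have {}main : ((\int[cp h]_x f x)%R%:E = (expR (- q))%:E * (f 0)%:E +
  (expR (- q) * q)%:E * (\int[nu]_x f x)%R%:E + T)%E by exact: main.
have {}total : ((expR (- q))%:E + (expR (- q) * q)%:E + W = 1%:E)%E.
  by move: total; rewrite ?big_geq// ?add0r.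
have Wfin : W \is a fin_num.
  by rewrite ge0_fin_numE//; apply: le_lt_trans (ltry 1); rewrite -total leeDr// -EFinD lee_fin addr_ge0 ?mulr_ge0 ?expR_ge0.
have Tfin : T \is a fin_num.
  by rewrite ge0_fin_numE//; apply: (le_lt_trans TW); rewrite -(fineK Wfin) -EFinM ltry.
move: main total TW T0 W0; rewrite -(fineK Wfin) -(fineK Tfin).
move: (fine T) (fine W) => t w; rewrite -!EFinM -!EFinD !lee_fin => -[->] [tot] tw t0 w0.
move: (R2 nu); set j := Rintegral _ _ _ => /andP[j0 j2].
have /andP[f00 f02'] := f02 0.
(* used of the exponential: [1 - q <= exp (- q) <= 1 / (1 + q)] *)
have E0 := expR_ge1Dx (- q).
have E1 : expR (- q) * (1 + q) <= 1.
  by rewrite expRN mulrC ler_pdivrMr ?expR_gt0// mul1r expR_ge1Dx.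
have Eg := expR_gt0 (- q).
move: (expR (- q)) E0 E1 Eg tot => E E0 E1 Eg tot.
have El1 : E <= 1 by nra.
have E2 : E <= 1 - q + q ^+ 2 by nra.
have a1 : 0 <= (E - (1 - q)) * f 0 <= 2 * q ^+ 2.
  apply/andP; split; first by apply: mulr_ge0 => //; lra.
  nra.
have a2 : 0 <= q * (1 - E) * j <= 2 * q ^+ 2.
  have qE : 0 <= q * (1 - E) <= q ^+ 2 by apply/andP; split; nra.
  apply/andP; split; first by apply: mulr_ge0 => //; lra.
  by move: (q * (1 - E)) qE => y /andP[y0 y1]; nra.
have a3 : w <= q ^+ 2 by nra.
rewrite ler_norml; apply/andP; split; lra.
Qed.

Lemma characteristic_function_compound_poisson (u : R) :
  characteristic_function (cp 1) u = cexp (rate%:C * (characteristic_function nu u - 1)).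
Proof.
have sg := compound_poisson_semigroup nu rate0.
set eta := _ * _.
have [ReE ImE] : complex.Re eta = rate * (\int[nu]_x cos (u * x) - 1)%R /\
    complex.Im eta = rate * (\int[nu]_x sin (u * x))%R.
  by rewrite /eta characteristic_functionE /=; split; ring.
have cm := measurable_cosM u; have sm := measurable_sinM u.
have ci S := cosM_integrable S u; have si S := sinM_integrable S u.
have half (S : probability R R) (f : R -> R) : S.-integrable setT (EFin \o f) ->
    (\int[S]_x (1 + f x) = 1 + \int[S]_x f x)%R.
  move=> fi; have := @integral_affine _ S f 1 1 fi; rewrite mul1r.
  by under eq_integral do rewrite mul1r; move=> /(congr1 fine).
have bnd h (f : R -> R) : 0 <= h -> measurable_fun setT f -> (forall x, `|f x| <= 1) ->
    `|(\int[cp h]_x f x - f 0 - rate * h * (\int[nu]_x f x - f 0))%R| <= 6 * (rate * h) ^+ 2.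
  move=> h0 mf f1.
  have fi S := @bounded_integrable _ _ _ S f 1 mf f1.
  have m1 : measurable_fun setT (fun x : R => 1 + f x) by exact: measurable_funD.
  have f02 x : 0 <= 1 + f x <= 2.
    by have := f1 x; rewrite ler_norml => /andP[? ?]; apply/andP; split; lra.
  have := compound_poisson_mean_expansion h0 m1 f02.
  rewrite !half//; congr (`|_| <= _); ring.
apply: (@eq_cexp_of_roots _ _ _ (fun n => characteristic_function (cp n.+1%:R^-1) u) (12 * rate ^+ 2)).
- rewrite ReE mulr_ge0_le0// subr_le0.
  have := le_trans (Re_le_normc _) (characteristic_function_le1 nu u).
  by rewrite characteristic_functionE /= ler_norml => /andP[].
- by move=> n; exact: characteristic_function_le1.
- by move=> n; exact: characteristic_function_semigroup_root.
move=> n; set h : R := n.+1%:R^-1.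
have h0 : 0 <= h by rewrite invr_ge0 ler0n.
apply: le_trans (normc_le_add _) _.
have -> : 12 * rate ^+ 2 * h ^+ 2 = 6 * (rate * h) ^+ 2 + 6 * (rate * h) ^+ 2 by ring.
rewrite characteristic_functionE; move: ReE ImE; case: (eta) => p q /= -> ->.
apply: lerD.
- have := bnd h _ h0 cm (fun x => cos_max _); rewrite mulr0 cos0.
  by congr (`|_| <= _); ring.
- have := bnd h _ h0 sm (fun x => sin_max _); rewrite mulr0 sin0.
  by congr (`|_| <= _); ring.
Qed.

End compound_poisson_exponent.


(** * Integrals against an exponential *)

Section exponential_integrals.
Context (R : realType) (be : R) (be0 : 0 < be).
Local Notation leb := (@lebesgue_measure R).
Implicit Types (t x : R).

Lemma expRN_decay n x : 0 < x -> x ^+ n * expR (- (be * x)) <= n.+1`!%:R / be ^+ n.+1 / x.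
Proof.
move=> x0; have bx0 : 0 <= be * x by rewrite mulr_ge0 ?ltW.
have := expR_ge1Dxn n bx0; rewrite expRN => h.
have f0 : 0 < n.+1`!%:R :> R by rewrite ltr0n fact_gt0.
have bn0 : 0 < be ^+ n.+1 by rewrite exprn_gt0.
rewrite ler_pdivrMr ?expR_gt0// -ler_pdivrMl ?mulr_gt0 ?divr_gt0 ?exprn_gt0 ?invr_gt0//.
have h2 : (be * x) ^+ n.+1 / n.+1`!%:R <= expR (be * x) by apply: le_trans h; rewrite lerDr.
apply: le_trans h2.
rewrite le_eqVlt; apply/orP; left; apply/eqP.
rewrite exprMn [x ^+ n.+1]exprSr; field.
by rewrite !gt_eqF.
Qed.

Lemma cvg_pinfty_decay (F : R -> R) (C : R) : (forall x, 0 < x -> `|F x| <= C / x) ->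
  F x @[x --> +oo] --> (0 : R).
Proof.
move=> FC; apply/cvgrPdist_le => e e0; near=> x.
have x0 : 0 < x by near: x; exact: nbhs_pinfty_gt.
have Cx : C / e <= x by near: x; apply: nbhs_pinfty_ge; rewrite num_real.
rewrite sub0r normrN; apply: le_trans (FC x x0) _.
by move: Cx; rewrite !ler_pdivrMr// mulrC.
Unshelve. all: by end_near. Qed.

Lemma integral_of_decaying_primitive (f F : R -> R) (C : R) :
  (forall x, is_derive x 1 F (f x)) -> continuous f -> (forall x, 0 <= x -> 0 <= f x) ->
  (forall x, 0 < x -> `|F x| <= C / x) ->
  (\int[leb]_(x in `]0%R, +oo[) (f x)%:E = (- F 0)%:E)%E.
Proof.
move=> dF cf f0 FC.
have mf : measurable_fun setT f by exact: continuous_measurable_fun.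
rewrite integral_itv_obnd_cbnd; last by apply: measurable_funTS; exact/measurable_EFinP.
have FTC := @ge0_continuous_FTC2y _ f F 0 0 f0 _ (cvg_pinfty_decay FC).
rewrite FTC ?sub0e//.
- exact: continuous_subspaceT.
- apply: cvg_at_right_filter; apply/differentiable_continuous/derivable1_diffP.
  by have [] := dF 0.
- by move=> x _; rewrite derive1E; have [_ ->] := dF x.
Qed.

Let den_neq0 t : be ^+ 2 + t ^+ 2 != 0.
Proof. by rewrite gt_eqF// ltr_pwDl ?sqr_ge0// exprn_gt0. Qed.

Let bn0 : be != 0. Proof. by rewrite gt_eqF. Qed.

Let cexpN : continuous (fun x : R => expR (- (be * x))).
Proof.
move=> x; apply: continuous_comp; last exact: continuous_expR.
by apply: cvgN; apply: cvgM; [exact: cvg_cst|exact: cvg_id].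
Qed.

Let ccos t : continuous (fun x : R => cos (t * x)).
Proof.
move=> x; apply: continuous_comp; last exact: continuous_cos.
by apply: cvgM; [exact: cvg_cst|exact: cvg_id].
Qed.

Let csin t : continuous (fun x : R => sin (t * x)).
Proof.
move=> x; apply: continuous_comp; last exact: continuous_sin.
by apply: cvgM; [exact: cvg_cst|exact: cvg_id].
Qed.

Let decay0 x : 0 < x -> expR (- (be * x)) <= be^-1 ^+ 2 * be / x.
Proof.
move=> x0; have := expRN_decay 0 x0; rewrite expr0 mul1r factS fact0 muln1 expr1 => /le_trans; apply.
by rewrite ler_wpM2r ?invr_ge0 ?(ltW x0)// le_eqVlt; apply/orP; left; apply/eqP; field.
Qed.

Lemma integral_expN : (\int[leb]_(x in `]0%R, +oo[) (expR (- (be * x)))%:E = (be^-1)%:E)%E.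
Proof.
pose F x := - be^-1 * expR (- (be * x)).
transitivity ((- F 0)%:E); last by rewrite /F !mulr0 oppr0 expR0 mulr1 opprK.
apply: (@integral_of_decaying_primitive _ F (be^-1 ^+ 2)).
- by move=> x; apply: is_derive_eq; rewrite /GRing.scale /=; field.
- exact: cexpN.
- by move=> x _; exact: expR_ge0.
move=> x x0; rewrite normrM normrN !gtr0_norm ?expR_gt0 ?invr_gt0//.
apply: le_trans (ler_wpM2l _ (decay0 x0)) _; first by rewrite invr_ge0 ltW.
by rewrite le_eqVlt; apply/orP; left; apply/eqP; field; rewrite bn0 gt_eqF.
Qed.

Let bounded_term (p q c t x : R) : `|p * cos (t * x) + q * sin (t * x)| <= `|p| + `|q|.
Proof.
apply: le_trans (ler_normD _ _) _; rewrite !normrM; apply: lerD.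
  by rewrite -[leRHS]mulr1 ler_wpM2l// cos_max.
by rewrite -[leRHS]mulr1 ler_wpM2l// sin_max.
Qed.

Lemma integral_1Bcos t : (\int[leb]_(x in `]0%R, +oo[) ((1 - cos (t * x)) * expR (- (be * x)))%:E
  = (t ^+ 2 / (be * (be ^+ 2 + t ^+ 2)))%:E)%E.
Proof.
have dn := den_neq0 t.
pose F x := (- be^-1 + (be / (be ^+ 2 + t ^+ 2) * cos (t * x) +
  (- (t / (be ^+ 2 + t ^+ 2))) * sin (t * x))) * expR (- (be * x)).
transitivity ((- F 0)%:E).
  apply: (@integral_of_decaying_primitive _ F ((`|be^-1| + (`|be / (be ^+ 2 + t ^+ 2)| +
  `|- (t / (be ^+ 2 + t ^+ 2))|)) * (be^-1 ^+ 2 * be))).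
  - by move=> x; apply: is_derive_eq; rewrite /GRing.scale /=; field; rewrite dn.
  - by move=> x; apply: cvgM; [apply: cvgB; [exact: cvg_cst|exact: ccos]|exact: cexpN].
  - by move=> x _; rewrite mulr_ge0 ?expR_ge0// subr_ge0 cos_le1.
  move=> x x0; rewrite normrM [`|expR _|]gtr0_norm ?expR_gt0// -[leRHS]mulrA.
  apply: ler_pM; rewrite ?expR_ge0//; last exact: decay0.
  by apply: le_trans (ler_normD _ _) _; rewrite normrN lerD2l bounded_term.
by rewrite /F !mulr0 oppr0 expR0 cos0 sin0; congr EFin; field; rewrite dn.
Qed.

Lemma integral_1Dsin t : (\int[leb]_(x in `]0%R, +oo[) ((1 + sin (t * x)) * expR (- (be * x)))%:E
  = (be^-1 + t / (be ^+ 2 + t ^+ 2))%:E)%E.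
Proof.
have dn := den_neq0 t.
pose F x := (- be^-1 + ((- (t / (be ^+ 2 + t ^+ 2))) * cos (t * x) +
  (- (be / (be ^+ 2 + t ^+ 2))) * sin (t * x))) * expR (- (be * x)).
transitivity ((- F 0)%:E).
  apply: (@integral_of_decaying_primitive _ F ((`|be^-1| + (`|- (t / (be ^+ 2 + t ^+ 2))| +
  `|- (be / (be ^+ 2 + t ^+ 2))|)) * (be^-1 ^+ 2 * be))).
  - by move=> x; apply: is_derive_eq; rewrite /GRing.scale /=; field; rewrite dn.
  - by move=> x; apply: cvgM; [apply: cvgD; [exact: cvg_cst|exact: csin]|exact: cexpN].
  - by move=> x _; rewrite mulr_ge0 ?expR_ge0// -lerBlDl sub0r sin_geN1.
  move=> x x0; rewrite normrM [`|expR _|]gtr0_norm ?expR_gt0// -[leRHS]mulrA.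
  apply: ler_pM; rewrite ?expR_ge0//; last exact: decay0.
  by apply: le_trans (ler_normD _ _) _; rewrite normrN lerD2l bounded_term.
by rewrite /F !mulr0 oppr0 expR0 cos0 sin0; congr EFin; field; rewrite dn.
Qed.

Lemma integral_idBsin t : 0 <= t ->
  (\int[leb]_(x in `]0%R, +oo[) ((t * x - sin (t * x)) * expR (- (be * x)))%:E
  = (t ^+ 3 / (be ^+ 2 * (be ^+ 2 + t ^+ 2)))%:E)%E.
Proof.
move=> t0; have dn := den_neq0 t.
pose F x := (- (t / be ^+ 2) + (t / (be ^+ 2 + t ^+ 2) * cos (t * x) +
  (be / (be ^+ 2 + t ^+ 2)) * sin (t * x))) * expR (- (be * x)) +
  - (t / be) * (x * expR (- (be * x))).
transitivity ((- F 0)%:E).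
  apply: (@integral_of_decaying_primitive _ F ((`|t / be ^+ 2| + (`|t / (be ^+ 2 + t ^+ 2)| +
  `|be / (be ^+ 2 + t ^+ 2)|)) * (be^-1 ^+ 2 * be) + `|t / be| * (2 / be ^+ 2))).
  - by move=> x; apply: is_derive_eq; rewrite /GRing.scale /=; field; rewrite dn bn0.
  - move=> x; apply: cvgM; last exact: cexpN.
    by apply: cvgB; [apply: cvgM; [exact: cvg_cst|exact: cvg_id]|exact: csin].
  - by move=> x x0; rewrite mulr_ge0 ?expR_ge0// subr_ge0 sin_le_id// mulr_ge0.
  move=> x x0; apply: le_trans (ler_normD _ _) _; rewrite [leRHS]mulrDl; apply: lerD.
    rewrite normrM [`|expR _|]gtr0_norm ?expR_gt0// -[leRHS]mulrA.
    apply: ler_pM; rewrite ?expR_ge0//; last exact: decay0.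
    by apply: le_trans (ler_normD _ _) _; rewrite normrN lerD2l bounded_term.
  rewrite normrM normrN -[leRHS]mulrA ler_wpM2l// ger0_norm ?mulr_ge0 ?expR_ge0 ?(ltW x0)//.
  by have := expRN_decay 1 x0; rewrite expr1.
by rewrite /F !mulr0 !mul0r oppr0 expR0 cos0 sin0; congr EFin; field; rewrite dn bn0.
Qed.

End exponential_integrals.

(** * Hyperexponential Levy processes *)

Section exponential_jumps.
Context (R : realType).
Local Notation leb := (@lebesgue_measure R).

Let forget (x : measurableTypeR R) : R := x.

Let measurable_forget : measurable_fun setT forget.
Proof. exact: (@measurable_id _ _ setT). Qed.

HB.instance Definition _ := isMeasurableFun.Build _ _ _ _ forget measurable_forget.

Variables (be : R) (be0 : 0 < be).

Let exp_prob : probability (measurableTypeR R) R.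
Proof. refine (exponential_prob be : probability _ _); exact: be0. Defined.

Definition exponential_law : probability R R :=
  distribution exp_prob (forget : {mfun _ >-> _}).

Lemma ge0_integral_exponential_law (f : R -> R) : measurable_fun setT f ->
  (forall x, 0 <= f x) ->
  (\int[exponential_law]_x (f x)%:E =
   be%:E * \int[leb]_(x in `]0%R, +oo[) (f x * expR (- (be * x)))%:E)%E.
Proof.
move=> mf f0; have mfE : measurable_fun setT (EFin \o f) by exact/measurable_EFinP.
have f0E x : (0 <= (EFin \o f) x)%E by rewrite lee_fin.
rewrite [LHS](ge0_integral_distribution _ mfE f0E).
have me : measurable_fun setT (fun x : R => f x * expR (- (be * x))).
  apply: measurable_funM => //; apply: (measurableT_comp (f := @expR R)) => //.
  by apply: measurable_funN; exact: measurable_funM.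
rewrite (@ge0_integral_density _ _ _ leb exp_prob (exponential_pdf be)) //; last first.
- by move=> x; apply: exponential_pdf_ge0; exact: ltW.
- exact: measurable_exponential_pdf.
rewrite integral_itv_obnd_cbnd; last by apply: measurable_funTS; exact/measurable_EFinP.
rewrite -ge0_integralZl//; last 3 first.
- by apply: measurable_funTS; exact/measurable_EFinP.
- by move=> x _; rewrite lee_fin mulr_ge0 ?expR_ge0.
- by rewrite lee_fin ltW.
rewrite [RHS]integral_mkcond; apply: eq_integral => x _.
rewrite /patch /exponential_pdf patchE /=; case: ifPn => _; last by rewrite mule0.
by rewrite -!EFinM mulNr; congr EFin; ring.
Qed.

Lemma characteristic_function_exponential_law (u : R) :
  characteristic_function exponential_law u - 1 =
  u *i / (be%:C - u *i).
Proof.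
rewrite characteristic_functionE.
have bn0 : be != 0 by rewrite gt_eqF.
have dn : be ^+ 2 + u ^+ 2 != 0 by rewrite gt_eqF// ltr_pwDl ?sqr_ge0// exprn_gt0.
have cE : (\int[exponential_law]_x cos (u * x) = 1 - u ^+ 2 / (be ^+ 2 + u ^+ 2))%R.
  have := @integral_affine _ exponential_law _ 1 (-1) (cosM_integrable exponential_law u).
  rewrite (ge0_integral_exponential_law (f := fun x => 1 + -1 * cos (u * x))); last 2 first.
  - by apply: measurable_funD => //; apply: measurable_funM => //; exact: measurable_cosM.
  - by move=> x; rewrite mulN1r subr_ge0 cos_le1.
  under eq_integral do rewrite mulN1r.
  rewrite integral_1Bcos// -EFinM mulN1r => -[] E.
  have -> : u ^+ 2 / (be ^+ 2 + u ^+ 2) = be * (u ^+ 2 / (be * (be ^+ 2 + u ^+ 2))).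
    by field; rewrite bn0 dn.
  by rewrite E; ring.
have sE : (\int[exponential_law]_x sin (u * x) = be * u / (be ^+ 2 + u ^+ 2))%R.
  have := @integral_affine _ exponential_law _ 1 1 (sinM_integrable exponential_law u).
  rewrite (ge0_integral_exponential_law (f := fun x => 1 + 1 * sin (u * x))); last 2 first.
  - by apply: measurable_funD => //; apply: measurable_funM => //; exact: measurable_sinM.
  - by move=> x; rewrite mul1r -lerBlDl sub0r sin_geN1.
  under eq_integral do rewrite mul1r.
  rewrite integral_1Dsin// -EFinM mul1r => -[] E.
  have -> : be * u / (be ^+ 2 + u ^+ 2) = be * (be^-1 + u / (be ^+ 2 + u ^+ 2)) - 1.
    by field; rewrite bn0 dn.
  by rewrite E; ring.
have bu : be%:C - u *i != 0 by rewrite eq_complex /= subr0 (negbTE bn0).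
rewrite cE sE; apply: (mulIf bu); rewrite divfK//.
apply/eqP; rewrite eq_complex /=; apply/andP; split; apply/eqP; field; by rewrite dn.
Qed.

End exponential_jumps.

Section hyperexponential_existence.
Context (R : realType).

(** The function [eta] is the exponent of the processes with marginals [m]. *)
Definition has_exponent (m : R -> probability R R) (eta : R -> R[i]) : Prop :=
  convolution_semigroup m /\ forall u, characteristic_function (m 1) u = cexp (eta u).

Lemma has_exponentD m m' eta eta' : has_exponent m eta -> has_exponent m' eta' ->
  has_exponent (fun t => convolution (m t) (m' t)) (fun u => eta u + eta' u).
Proof.
move=> [sg mE] [sg' mE']; split; first exact: convolution_semigroup_product.
by move=> u; rewrite characteristic_function_convolution mE mE' cexpD.
Qed.

Lemma has_exponent_drift (b : R) :
  has_exponent (fun t => \d_(b * t) : probability R R) (fun u => (u * b) *i).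
Proof.
split; first exact: dirac_semigroup.
by move=> u; rewrite (characteristic_function_dirac (b * 1) u) mulr1.
Qed.

Lemma has_exponent_exponential_jumps (c be : R) : 0 <= c -> 0 < be ->
  exists m, has_exponent m (fun u => c%:C * (u *i / (be%:C * (be%:C - u *i)))).
Proof.
move=> c0 be0; have cb : 0 <= c / be by rewrite divr_ge0// ltW.
exists (compound_poisson (exponential_law be0) (c / be)); split.
  exact: compound_poisson_semigroup.
move=> u; rewrite characteristic_function_compound_poisson//; congr cexp.
rewrite characteristic_function_exponential_law rmorphM fmorphV /= invfM.
by move: (_^-1) (_^-1) => p q; ring.
Qed.

Lemma has_exponent_sum n (eta : 'I_n -> R -> R[i]) :
  (forall i, exists m, has_exponent m (eta i)) ->
  exists m, has_exponent m (fun u => \sum_(i < n) eta i u).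
Proof.
elim: n eta => [|n IH] eta H.
  exists (fun t : R => \d_((0 : R) * t) : probability R R); have [sg E] := has_exponent_drift 0.
  by split=> // u; rewrite E mulr0 big_ord0.
have [m hm] := IH _ (fun i => H (widen_ord (leqnSn n) i)).
have [m' hm'] := H ord_max; exists (fun t => convolution (m t) (m' t)).
have [sg E] := has_exponentD hm hm'; split=> // u.
by rewrite E big_ord_recr.
Qed.

Lemma levy_process_of_exponent m eta : has_exponent m eta ->
  exists (d : measure_display) (Omega : measurableType d)
    (P : probability Omega R) (X : R -> {RV P >-> R}), levy_process X /\
    forall u : R, cintegral P (fun w => cexp (u *i * (X 1 w)%:C)) = cexp (eta u).
Proof.
move=> [sg mE]; have [d [TT [P [X [levyX lawX]]]]] := levy_process_existence sg.
exists d, TT, P, X; split=> // u; rewrite -mE.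
have E : forall B, measurable B -> distribution P (X 1) B = m 1 B by exact: lawX.
rewrite -(eq_characteristic_function u E) characteristic_functionE /cintegral /Rintegral.
have mX : measurable_fun setT (X 1) by exact: measurable_funPT.
congr (fine _ +i* fine _).
- rewrite integral_distribution//; last 2 first.
  + by apply/measurable_EFinP; exact: measurable_cosM.
  + apply: (@bounded_integrable _ _ _ P _ 1) => [|x]; last exact: cos_max.
    exact: (measurableT_comp (measurable_cosM u) mX).
  by apply: eq_integral => w _; rewrite mul_imaginary_real cexp_imaginary.
- rewrite integral_distribution//; last 2 first.
  + by apply/measurable_EFinP; exact: measurable_sinM.
  + apply: (@bounded_integrable _ _ _ P _ 1) => [|x]; last exact: sin_max.
    exact: (measurableT_comp (measurable_sinM u) mX).
  by apply: eq_integral => w _; rewrite mul_imaginary_real cexp_imaginary.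
Qed.

(** The convolution of a drift, a Brownian part and one compound Poisson process for
    each exponential. *)
Lemma hyperexponential_levy_process n (b s2 : R) (c be : 'I_n -> R) : 0 <= s2 ->
  (forall i, 0 <= c i) -> (forall i, 0 < be i) ->
  exists (d : measure_display) (Omega : measurableType d)
    (P : probability Omega R) (X : R -> {RV P >-> R}), levy_process X /\
    forall u : R, cintegral P (fun w => cexp (u *i * (X 1 w)%:C)) =
      cexp ((u * b) *i - (s2 * u ^+ 2 / 2)%:C +
        \sum_(i < n) (c i)%:C * (u *i / ((be i)%:C * ((be i)%:C - u *i)))).
Proof.
move=> s20 c0 be0.
have gauss : has_exponent (gauss_marginal s2) (fun u => - (s2 * u ^+ 2 / 2)%:C).
  split; first exact: gauss_marginal_semigroup.
  by move=> u; rewrite characteristic_function_gauss// rmorphN.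
have [m hm] := has_exponent_sum (fun i => has_exponent_exponential_jumps (c0 i) (be0 i)).
exact: levy_process_of_exponent (has_exponentD (has_exponentD (has_exponent_drift b) gauss) hm).
Qed.

End hyperexponential_existence.

(** * The representing measure and its image *)

Section representing_measure.
Context (R : realType) (mu : {measure set R -> \bar R}).
Local Notation leb := (@lebesgue_measure R).
Hypothesis mu_compact : forall K : set R, compact K -> ~ K 0 -> (mu K < +oo)%E.

Let mD : measurable (`]0, +oo[%classic : set R). Proof. by []. Qed.

Let mu_pos : set R -> \bar R := mrestr mu mD.

HB.instance Definition _ := Measure.copy mu_pos (mrestr mu mD).

Let mu_pos_sigma_finite : sigma_finite setT mu_pos.
Proof.
exists (fun n => `]-oo, 0]%classic `|` `[n.+1%:R^-1, n.+1%:R]%classic).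
  apply/seteqP; split=> // x _.
  have [x0|x0] := leP x 0; first by exists 0%N => //; left; rewrite /= in_itv.
  exists (maxn (Num.truncn x) (Num.truncn x^-1)) => //; right; rewrite /= in_itv /=.
  apply/andP; split.
    rewrite -[leRHS]invrK lef_pV2 ?posrE ?invr_gt0 ?ltr0n//.
    apply: ltW; apply: lt_le_trans (truncnS_gt _) _.
    by rewrite ler_nat ltnS leq_maxr.
  by apply: ltW; apply: lt_le_trans (truncnS_gt _) _; rewrite ler_nat ltnS leq_maxl.
move=> n; split; first exact: measurableU.
have -> : mu_pos (`]-oo, 0]%classic `|` `[n.+1%:R^-1, n.+1%:R]%classic) =
    mu `[n.+1%:R^-1, n.+1%:R]%classic.
  rewrite /mu_pos /mrestr; congr (mu _); apply/seteqP; split=> x /=; rewrite !in_itv /= andbT.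
    by move=> [[x0|//] x1]; move: (le_lt_trans x0 x1); rewrite ltxx.
  by move=> /[dup] /andP[x0 _] ->; split; [right|apply: lt_le_trans x0; rewrite invr_gt0 ltr0n].
apply: mu_compact; first exact: segment_compact.
by rewrite /= in_itv /= leNgt invr_gt0 ltr0n.
Qed.

HB.instance Definition _ :=
  isSFinite.Build _ _ _ mu_pos (sfinite_measure_sigma_finite mu_pos_sigma_finite).

HB.instance Definition _ := isSigmaFinite.Build _ _ _ mu_pos mu_pos_sigma_finite.

Let ge0_integral_mu_pos (f : R -> \bar R) : measurable_fun setT f -> (forall x, (0 <= f x)%E) ->
  (\int[mu_pos]_u f u = \int[mu]_(u in `]0%R, +oo[) f u)%E.
Proof.
move=> mf f0; rewrite (@ge0_integral_density _ _ _ mu mu_pos (\1_(`]0, +oo[%classic : set R)))//.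
  rewrite [RHS]integral_mkcond; apply: eq_integral => x _; rewrite /patch indicE.
  by case: ifPn => _; rewrite ?mule1 ?mule0.
by move=> A mA; rewrite integral_indic// /mu_pos /mrestr setIC.
Qed.

(** Tonelli. *)
Lemma integral_exponential_mixture (f : R -> R) : measurable_fun setT f ->
  (forall x, 0 < x -> 0 <= f x) ->
  (\int[leb]_(x in `]0%R, +oo[) ((f x)%:E * \int[mu]_(u in `]0%R, +oo[) (expR (- (u * x)))%:E) =
   \int[mu]_(u in `]0%R, +oo[) \int[leb]_(x in `]0%R, +oo[) (f x * expR (- (u * x)))%:E)%E.
Proof.
move=> mf f0.
pose g (x : R) := f x * \1_(`]0, +oo[%classic : set R) x.
have g0 x : 0 <= g x.
  rewrite /g indicE; case: (boolP (x \in _)); last by rewrite mulr0.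
  by rewrite inE /= in_itv /= andbT mulr1; exact: f0.
have mg : measurable_fun setT g by apply: measurable_funM => //; exact: measurable_indic.
pose h (z : measurableTypeR R * R) : \bar R := (g z.1 * expR (- (z.2 * z.1)))%:E.
have mh : measurable_fun setT h.
  apply/measurable_EFinP; apply: measurable_funM.
    exact: (measurableT_comp mg measurable_fst).
  apply: (measurableT_comp (f := @expR R)) => //; apply: measurable_funN.
  by apply: measurable_funM; [exact: measurable_snd|exact: measurable_fst].
have h0 z : (0 <= h z)%E by rewrite lee_fin mulr_ge0 ?expR_ge0.
have F := @fubini_tonelli _ _ _ _ _ leb mu_pos h mh h0.
have me (x : R) : measurable_fun setT (fun u : R => (expR (- (u * x)))%:E).
  apply/measurable_EFinP; apply: (measurableT_comp (f := @expR R)) => //.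
  by apply: measurable_funN; exact: measurable_funM.
have me' (u : R) : measurable_fun setT (fun x : R => (expR (- (u * x)))%:E).
  apply/measurable_EFinP; apply: (measurableT_comp (f := @expR R)) => //.
  by apply: measurable_funN; exact: measurable_funM.
transitivity (\int[leb]_x \int[mu_pos]_u h (x, u))%E.
  rewrite [LHS]integral_mkcond; apply: eq_integral => x _.
  rewrite /h /=; under [RHS]eq_integral do rewrite EFinM.
  rewrite ge0_integralZl//; last by rewrite lee_fin.
  rewrite (ge0_integral_mu_pos (me x)); last by move=> u; rewrite lee_fin expR_ge0.
  by rewrite /patch /g indicE; case: ifPn => _; rewrite ?mulr1// mulr0 mul0e.
rewrite F -ge0_integral_mu_pos.
- apply: eq_integral => u _; rewrite [RHS]integral_mkcond; apply: eq_integral => x _.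
  by rewrite /h /g /patch /= indicE; case: ifPn => _; rewrite ?mulr1// mulr0 mul0r.
- rewrite (_ : (fun u => _) = (fun u => \int[leb]_x h (x, u))%E); first exact: measurable_fun_fubini_tonelli_G.
  apply/funext => u; rewrite [LHS]integral_mkcond; apply: eq_integral => x _.
  by rewrite /h /g /patch /= indicE; case: ifPn => _; rewrite ?mulr1// mulr0 mul0r.
- move=> u; apply: integral_ge0 => x; rewrite /= in_itv /= andbT => x0.
  by rewrite lee_fin mulr_ge0 ?expR_ge0// f0.
Qed.

End representing_measure.

Section cm_jumps_facts.
Context (R : realType) (pi : R -> R) (mu : {measure set R -> \bar R}).
Local Notation leb := (@lebesgue_measure R).
Hypothesis cm : cm_jumps pi mu.

Let null_bigcup (F : nat -> set R) : (forall n, measurable (F n)) ->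
  (forall n, mu (F n) = 0%E) -> mu (\bigcup_n F n) = 0%E.
Proof.
move=> mF F0; apply: measure_negligible; first exact: bigcup_measurable.
by apply: negligible_bigcup => n; apply/negligibleP; [exact: mF|exact: F0].
Qed.

(** An infinite [rho_hat] leaves no mass of [mu] on the negative half-line. *)
Lemma spectrally_positive_density : cm_rho_hat mu = +oo%E ->
  forall x, (pi x)%:E = ((\1_(`]0%R, +oo[%classic : set R) x)%:E *
           \int[mu]_(u in `]0%R, +oo[) (expR (- (u * x)))%:E)%E.
Proof.
have [mu0 mucpt piE] := cm => rho_hat x.
have neg0 : mu `]-oo, 0[%classic = 0%E.
  have null n : mu `](- n%:R), 0[%classic = 0%E.
    have : (n%:R%:E < cm_rho_hat mu)%E by rewrite rho_hat ltry.
    rewrite /cm_rho_hat => /ereal_sup_gt[_ [u [u0 mu0u] <-]]; rewrite lte_fin => nu.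
    apply/eqP; rewrite eq_le measure_ge0 andbT -mu0u; apply: le_measure; rewrite ?inE//.
    by move=> y; rewrite /= !in_itv /= => /andP[yn ->]; rewrite andbT (le_lt_trans _ yn)// lerN2 ltW.
  have -> : `]-oo, 0[%classic = \bigcup_n `](- n%:R), (0 : R)[%classic.
    apply/seteqP; split=> y /=; rewrite in_itv /=.
      move=> y0; exists (Num.truncn (- y)).+1 => //=; rewrite in_itv /= y0 andbT ltrNl.
      exact: truncnS_gt.
    by move=> [n _] /=; rewrite in_itv /= => /andP[].
  exact: null_bigcup.
rewrite piE; set A := (X in (_ + X)%E); suff -> : A = 0%E by rewrite adde0.
rewrite /A [X in (_ * X)%E](_ : _ = 0%E) ?mule0//.
apply/eqP; rewrite eq_le; apply/andP; split; last by apply: integral_ge0 => u _; rewrite lee_fin expR_ge0.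
rewrite le_eqVlt; apply/orP; left; apply/eqP; apply: null_set_integral => //.
apply/measurable_EFinP; apply: measurable_funTS.
apply: (measurableT_comp (f := @expR R)) => //.
by apply: measurable_funN; exact: measurable_funM.
Qed.

Lemma cm_rho_null (y : R) : (y%:E < cm_rho mu)%E -> mu `]0, y[%classic = 0%E.
Proof.
rewrite /cm_rho => /ereal_sup_gt[_ [u [u0 mu0u] <-]]; rewrite lte_fin => yu.
apply/eqP; rewrite eq_le measure_ge0 andbT -mu0u; apply: le_measure; rewrite ?inE//.
by move=> z; rewrite /= !in_itv /= => /andP[-> zy]; rewrite (lt_trans zy).
Qed.

Let expN_measurable (x : R) (D : set R) :
  measurable_fun D (fun u : R => (expR (- (u * x)))%:E).
Proof.
apply/measurable_EFinP; apply: measurable_funTS.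
apply: (measurableT_comp (f := @expR R)) => //.
by apply: measurable_funN; exact: measurable_funM.
Qed.

(** A mixture that decays exponentially charges no small exponent. If it charged no
    exponent at all, the density would vanish and the jumps would have finite variation. *)
Lemma cm_rho_pos_finite : cm_rho_hat mu = +oo%E -> exp_decay pi -> infinite_variation pi ->
  exists2 r : R, 0 < r & cm_rho mu = r%:E /\ mu `]0, r[%classic = 0%E.
Proof.
move=> rho_hat [c [K [M [c0 decay]]]] infvar.
have piE := spectrally_positive_density rho_hat.
have c20 : 0 < c / 2 by rewrite divr_gt0.
have small : mu `]0, (c / 2)[%classic = 0%E.
  apply/eqP; rewrite eq_le measure_ge0 andbT; apply/lee_addgt0Pr => e e0; rewrite add0e.
  (* so large that [pi x], at most [K exp (- c x)], is below [e exp (- c x / 2)] *)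
  pose x := Num.max (Num.max M 1) (2 * `|K| / (c * e)).
  have xM : M <= x by rewrite /x !le_max lexx.
  have x1 : 1 <= x by rewrite /x !le_max lexx orbT.
  have xK : 2 * `|K| / (c * e) <= x by rewrite /x !le_max lexx !orbT.
  have x0 : 0 < x by exact: lt_le_trans x1.
  have := decay x; rewrite ger0_norm ?(ltW x0)// => /(_ xM) pix.
  have low : (mu `]0%R, (c / 2)%R[%classic * (expR (- (c / 2 * x)))%:E <= (pi x)%:E)%E.
    rewrite piE indicE mem_set ?mul1e /= ?in_itv /= ?x0//.
    rewrite muleC -integral_cst//.
    apply: (@le_trans _ _ (\int[mu]_(u in `]0%R, (c / 2)%R[) (expR (- (u * x)))%:E)%E).
      apply: ge0_le_integral => //.
      - by move=> u _; rewrite /cst lee_fin expR_ge0.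
      - move=> u /=; rewrite in_itv /= => /andP[_ uc].
        by rewrite lee_fin ler_expR lerN2 ler_wpM2r// ltW.
    by apply: ge0_subset_integral => // u /=; rewrite !in_itv /= andbT => /andP[].
  rewrite -(@lee_pmul2r _ (expR (- (c / 2 * x)))%:E)//; last by rewrite lte_fin expR_gt0.
  apply: (le_trans low); rewrite -EFinM lee_fin (le_trans pix)//.
  have -> : - (c * x) = - (c / 2 * x) + - (c / 2 * x) by field.
  rewrite expRD mulrA ler_wpM2r ?expR_ge0//.
  apply: (@le_trans _ _ (`|K| * expR (- (c / 2 * x)))); first by rewrite ler_wpM2r ?expR_ge0 ?ler_norm.
  rewrite expRN ler_pdivrMr ?expR_gt0//.
  apply: (@le_trans _ _ (e * (1 + c / 2 * x))); last by rewrite ler_wpM2l ?(ltW e0)// expR_ge1Dx.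
  move: xK; rewrite ler_pdivrMr ?mulr_gt0// => xK.
  have : 2 * `|K| <= e * (c * x) by rewrite (le_trans xK)// le_eqVlt; apply/orP; left; apply/eqP; ring.
  by nra.
have rho_pos : ((c / 2)%:E <= cm_rho mu)%E.
  by apply: ereal_sup_ubound; exists (c / 2) => //; split=> //; exact: ltW.
case E : (cm_rho mu) rho_pos => [r| |] //; rewrite ?lee_fin.
- move=> cr; exists r; first exact: lt_le_trans cr.
  split=> //.
  have -> : `]0, r[%classic = \bigcup_n `](0 : R), (r - n.+1%:R^-1)[%classic.
    apply/seteqP; split=> y /=; rewrite in_itv /=.
      move=> /andP[y0 yr]; exists (Num.truncn (r - y)^-1) => //=; rewrite in_itv /= y0 /=.
      rewrite ltrBrDr -ltrBrDl -[ltRHS]invrK ltf_pV2 ?posrE ?invr_gt0 ?subr_gt0 ?ltr0n//.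
      exact: truncnS_gt.
    by move=> [n _] /=; rewrite in_itv /= => /andP[-> yr]; rewrite (lt_trans yr)// gtrBl invr_gt0.
  apply: null_bigcup => // n; apply: cm_rho_null; rewrite E lte_fin.
  by rewrite gtrBl invr_gt0.
(* [rho = +oo]: then [mu] does not charge the positive half-line either *)
- move=> _; exfalso; have mu0 : mu `]0, +oo[%classic = 0%E.
    have -> : `]0, +oo[%classic = \bigcup_n `](0 : R), n.+1%:R[%classic.
      apply/seteqP; split=> y /=; rewrite in_itv /= ?andbT.
        by move=> y0; exists (Num.truncn y) => //=; rewrite in_itv /= y0 truncnS_gt.
      by move=> [n _] /=; rewrite in_itv /= => /andP[].
    by apply: null_bigcup => // n; apply: cm_rho_null; rewrite E ltry.
  move: infvar; rewrite /infinite_variation integral0_eq// => x _.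
  rewrite EFinM piE null_set_integral ?mule0//.
Qed.

End cm_jumps_facts.

Section node_measure.
Context (R : realType) (mu : {measure set R -> \bar R}) (r : R) (r0 : 0 < r).
Hypothesis mu0r : mu `]0, r[%classic = 0%E.

Lemma node_intervalE : node_interval (r%:E) = `]0, r^-1]%classic.
Proof.
apply/seteqP; split=> v; rewrite /node_interval /= in_itv /=.
  by move=> [-> ]; rewrite inver gt_eqF// lee_fin => ->.
by move=> /andP[-> vr]; rewrite inver gt_eqF// lee_fin.
Qed.

(** The substitution [v = 1 / u]; as [mu] charges nothing below [r], the integral over
    [u >= r] is one over all [u > 0]. *)
Lemma integral_weighted_mu_star p (f : R -> \bar R) : measurable_fun setT f ->
  (forall v, 0 < v -> (0 <= f v)%E) ->
  (\int[weighted_mu_star mu r%:E p]_(v in `]0%R, (r^-1)%R]) f v =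
   \int[mu]_(u in `]0%R, +oo[) (f (u^-1)%R * ((u^-1)%R ^+ p)%:E))%E.
Proof.
move=> mf f0.
pose g (v : R) := v ^+ p * \1_(node_interval r%:E) v.
have mni : measurable (node_interval r%:E) by rewrite node_intervalE.
have mg : measurable_fun setT g.
  by apply: measurable_funM; [exact: exprn_measurable|exact: measurable_indic].
have g0 v : 0 <= g v.
  rewrite /g indicE; case: (boolP (v \in _)); last by rewrite mulr0.
  by rewrite inE => -[/ltW v0 _]; rewrite mulr1 exprn_ge0.
rewrite (@ge0_integral_density_in _ _ _ (mu_star mu) (weighted_mu_star mu r%:E p) g mg g0)//; last first.
- by move=> v; rewrite /= in_itv /= => /andP[v0 _]; exact: f0.
- exact: measurable_funTS.
have mfg : measurable_fun setT (fun v => f v * (g v)%:E)%E.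
  by apply: emeasurable_funM => //; exact/measurable_EFinP.
rewrite (ge0_integral_pushforward (@measurable_fun_invr R) mu); last 3 first.
- by [].
- exact: measurable_funTS.
- by move=> v; rewrite inE /= in_itv /= => /andP[v0 _]; rewrite mule_ge0 ?f0// lee_fin.
have pre : (fun v : R => v^-1) @^-1` `]0, r^-1] = `[r, +oo[%classic.
  apply/seteqP; split=> u /=; rewrite !in_itv /= andbT.
    by move=> /andP[]; rewrite invr_gt0 => u0; rewrite lef_pV2 ?posrE.
  by move=> ru; have u0 := lt_le_trans r0 ru; rewrite invr_gt0 u0 lef_pV2 ?posrE.
rewrite pre.
have -> : `]0, +oo[%classic = `]0, r[%classic `|` `[r, +oo[%classic :> set R.
  apply/seteqP; split=> u /=; rewrite !in_itv /= !andbT.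
    by move=> u0; have [ru|ur] := leP r u; [right|left; rewrite u0].
  by move=> [/andP[]//|]; exact: lt_le_trans.
have mh : measurable_fun setT (fun u : R => f (u^-1)%R * ((u^-1)%R ^+ p)%:E)%E.
  apply: emeasurable_funM; first exact: (measurableT_comp mf (@measurable_fun_invr R)).
  apply/measurable_EFinP; apply: measurable_funX; exact: measurable_fun_invr.
rewrite ge0_integral_setU//; last 3 first.
- exact: measurable_funTS.
- move=> u [|]; rewrite /= in_itv /= ?andbT.
    by move=> /andP[u0 _]; rewrite mule_ge0 ?f0 ?invr_gt0// lee_fin exprn_ge0// invr_ge0 ltW.
  by move=> ru; have u0 := lt_le_trans r0 ru; rewrite mule_ge0 ?f0 ?invr_gt0// lee_fin exprn_ge0// invr_ge0 ltW.
- rewrite disj_set2E; apply/eqP/seteqP; split=> u //=; rewrite !in_itv /= andbT => -[/andP[_ ur] ru].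
  by move: (lt_le_trans ur ru); rewrite ltxx.
have m0r : measurable (`]0, r[%classic : set R) by [].
have N0 := null_set_integral m0r (measurable_funTS mh) mu0r.
rewrite N0 add0e; apply: eq_integral => u; rewrite inE /= in_itv /= andbT => ru.
have u0 := lt_le_trans r0 ru.
rewrite /g indicE mem_set ?mulr1// node_intervalE /= in_itv /= invr_gt0 u0.
by rewrite lef_pV2 ?posrE.
Qed.

Lemma weighted_mu_starT p : weighted_mu_star mu r%:E p setT =
  (\int[mu]_(u in `]0%R, +oo[) ((u^-1)%R ^+ p)%:E)%E.
Proof.
have E : weighted_mu_star mu r%:E p setT = weighted_mu_star mu r%:E p `]0, r^-1]%classic.
  rewrite /weighted_mu_star -node_intervalE [RHS]integral_mkcond; apply: eq_integral => v _.
  by rewrite /patch indicE; case: (v \in _); rewrite ?mulr0.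
have {}E : weighted_mu_star mu r%:E p setT =
    (\int[weighted_mu_star mu r%:E p]_(v in `]0%R, (r^-1)%R]) cst 1%E v)%E.
  by rewrite E integral_cst// mul1e.
rewrite E integral_weighted_mu_star//.
by under eq_integral do rewrite mul1e.
Qed.

End node_measure.

(** * The Laplace exponent as a Stieltjes transform *)

Lemma Re_lk_integrand (R : realType) (f : R -> R) (t x : R) :
  complex.Re (lk_integrand f id (t *i) x) = - ((1 - cos (t * x)) * f x).
Proof. by rewrite /lk_integrand mul_imaginary_real cexp_imaginary /=; ring. Qed.

Lemma Im_lk_integrand (R : realType) (f : R -> R) (t x : R) :
  complex.Im (lk_integrand f id (t *i) x) = - ((t * x - sin (t * x)) * f x).
Proof. by rewrite /lk_integrand mul_imaginary_real cexp_imaginary /=; ring. Qed.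

Section laplace_exponent_cm.
Context (R : realType) (psi : R[i] -> R[i]) (a : R) (pi : R -> R).
Context (mu : {measure set R -> \bar R}) (r : R) (r0 : 0 < r).
Local Notation leb := (@lebesgue_measure R).
Local Notation N := (weighted_mu_star mu r%:E).
Hypothesis mu0r : mu `]0, r[%classic = 0%E.
Hypothesis mu_compact : forall K : set R, compact K -> ~ K 0 -> (mu K < +oo)%E.
Hypothesis piE : forall x, (pi x)%:E = ((\1_(`]0%R, +oo[%classic : set R) x)%:E *
  \int[mu]_(u in `]0%R, +oo[) (expR (- (u * x)))%:E)%E.
Hypothesis triple : characteristic_triple psi a 0 pi (fun y => y).

Lemma integral_cm_density (f I : R -> R) : measurable_fun setT f ->
  (forall x, 0 < x -> 0 <= f x) ->
  (forall u, 0 < u -> (\int[leb]_(x in `]0%R, +oo[) (f x * expR (- (u * x)))%:E)%E = (I u)%:E) ->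
  (\int[leb]_x (f x * pi x)%:E = \int[mu]_(u in `]0%R, +oo[) (I u)%:E)%E.
Proof.
move=> mf f0 fI; transitivity (\int[leb]_(x in `]0%R, +oo[)
    ((f x)%:E * \int[mu]_(u in `]0%R, +oo[) (expR (- (u * x)))%:E))%E.
  rewrite [RHS]integral_mkcond; apply: eq_integral => x _.
  rewrite EFinM piE /patch indicE; case: ifPn => _; by rewrite ?mul1e ?mul0e ?mule0.
rewrite integral_exponential_mixture//; apply: eq_integral => u.
by rewrite inE /= in_itv /= andbT => /fI.
Qed.

Let mcos (t : R) : measurable_fun setT (fun x : R => 1 - cos (t * x)).
Proof. by apply: measurable_funB => //; exact: measurable_cosM. Qed.

Let msin (t : R) : measurable_fun setT (fun x : R => t * x - sin (t * x)).
Proof. by apply: measurable_funB; [exact: measurable_funM|exact: measurable_sinM]. Qed.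

Lemma integral_1Bcos_cm (t : R) : (\int[leb]_x ((1 - cos (t * x)) * pi x)%:E =
  \int[mu]_(u in `]0%R, +oo[) (t ^+ 2 / (u * (u ^+ 2 + t ^+ 2)))%:E)%E.
Proof.
apply: (integral_cm_density (mcos t)).
  by move=> x _; rewrite subr_ge0 cos_le1.
by move=> u u0; exact: integral_1Bcos.
Qed.

Lemma integral_idBsin_cm (t : R) : 0 <= t -> (\int[leb]_x ((t * x - sin (t * x)) * pi x)%:E =
  \int[mu]_(u in `]0%R, +oo[) (t ^+ 3 / (u ^+ 2 * (u ^+ 2 + t ^+ 2)))%:E)%E.
Proof.
move=> t0; apply: (integral_cm_density (msin t)).
  by move=> x x0; rewrite subr_ge0 sin_le_id// mulr_ge0// ltW.
by move=> u u0; exact: integral_idBsin.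
Qed.

(** Up to sign these are the real and the imaginary part of the Levy-Khintchine integral. *)
Lemma cm_integrals_finite (t : R) :
  ((\int[leb]_x ((1 - cos (t * x)) * pi x)%:E)%E \is a fin_num) /\
  ((\int[leb]_x ((t * x - sin (t * x)) * pi x)%:E)%E \is a fin_num).
Proof.
have [_ _ /(_ t)[iR iI] _] := triple; split.
- have /integrable_fin_num := integrableN iR; move=> /(_ measurableT).
  by under eq_integral do rewrite /comp Re_lk_integrand EFinN oppeK.
- have /integrable_fin_num := integrableN iI; move=> /(_ measurableT).
  by under eq_integral do rewrite /comp Im_lk_integrand EFinN oppeK.
Qed.

(** As [mu] does not charge [(0, r)], the weight [u^-3] is dominated by a multiple of
    [1 / (u (u^2 + 1))], whose integral is a Levy-Khintchine one by [integral_1Bcos_cm]. *)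
Lemma weighted_mu_star3_finite : (N 3 setT < +oo)%E.
Proof.
rewrite weighted_mu_starT//.
have [fin _] := cm_integrals_finite 1; rewrite integral_1Bcos_cm in fin.
pose C := 1 + r^-1 ^+ 2.
have C0 : 0 <= C by rewrite addr_ge0// sqr_ge0.
have mI (D : set R) : measurable_fun D (fun u : R => (1 ^+ 2 / (u * (u ^+ 2 + 1 ^+ 2)))%:E).
  apply/measurable_EFinP; apply: measurable_funTS; apply: measurable_funM => //.
  apply: (measurableT_comp (@measurable_fun_invr R)); apply: measurable_funM => //.
  by apply: measurable_funD => //; exact: exprn_measurable.
have mV (D : set R) : measurable_fun D (fun u : R => ((u^-1)%R ^+ 3)%:E).
  apply/measurable_EFinP; apply: measurable_funTS; apply: measurable_funX.
  exact: measurable_fun_invr.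
have I0 (u : R) : 0 <= u -> 0 <= 1 ^+ 2 / (u * (u ^+ 2 + 1 ^+ 2)).
  by move=> u0; rewrite divr_ge0 ?sqr_ge0// mulr_ge0// addr_ge0 ?sqr_ge0.
have split (f : R -> R) : measurable_fun setT f -> (forall u, 0 < u -> 0 <= f u) ->
    (\int[mu]_(u in `]0%R, +oo[) (f u)%:E = \int[mu]_(u in `[r, +oo[) (f u)%:E)%E.
  move=> mf f0.
  have -> : `]0, +oo[%classic = `]0, r[%classic `|` `[r, +oo[%classic :> set R.
    apply/seteqP; split=> u /=; rewrite !in_itv /= !andbT.
      by move=> u0; have [ru|ur] := leP r u; [right|left; rewrite u0].
    by move=> [/andP[]//|]; exact: lt_le_trans.
  rewrite ge0_integral_setU//; last 3 first.
  - by apply: measurable_funTS; exact/measurable_EFinP.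
  - move=> u [|]; rewrite /= in_itv /= ?andbT lee_fin.
      by move=> /andP[u0 _]; exact: f0.
    by move=> ru; apply: f0; exact: lt_le_trans ru.
  - rewrite disj_set2E; apply/eqP/seteqP; split=> u //=; rewrite !in_itv /= andbT => -[/andP[_ ur] ru].
    by move: (lt_le_trans ur ru); rewrite ltxx.
  have m0r : measurable (`]0, r[%classic : set R) by [].
  have mfE : measurable_fun `]0, r[%classic (EFin \o f).
    by apply: measurable_funTS; exact/measurable_EFinP.
  by rewrite (null_set_integral m0r mfE mu0r) add0e.
apply: (@le_lt_trans _ _ (C%:E * \int[mu]_(u in `]0%R, +oo[) (1 ^+ 2 / (u * (u ^+ 2 + 1 ^+ 2)))%:E)%E); last first.
  by rewrite -(fineK fin) -EFinM ltry.
rewrite -ge0_integralZl//; last first.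
  by move=> u /=; rewrite in_itv /= andbT => u0; rewrite lee_fin I0// ltW.
rewrite split; last 2 first.
- apply: measurable_funX; exact: measurable_fun_invr.
- by move=> u u0; rewrite exprn_ge0// invr_ge0 ltW.
have <- : (\int[mu]_(u in `[r, +oo[) (C * (1 ^+ 2 / (u * (u ^+ 2 + 1 ^+ 2))))%:E =
    \int[mu]_(u in `]0%R, +oo[) (C%:E * (1 ^+ 2 / (u * (u ^+ 2 + 1 ^+ 2)))%:E))%E.
  rewrite -split//; last first.
  - by move=> u u0; rewrite mulr_ge0// I0// ltW.
  - by apply: measurable_funM => //; have /measurable_EFinP := mI setT.
apply: ge0_le_integral => //.
- move=> u; rewrite /= in_itv /= andbT => ru.
  by rewrite lee_fin exprn_ge0// invr_ge0 ltW// (lt_le_trans r0).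
- by apply/measurable_EFinP; apply: measurable_funM => //; have /measurable_EFinP := mI `[r, +oo[%classic.
move=> u; rewrite /= in_itv /= andbT => ru; have u0 := lt_le_trans r0 ru.
rewrite lee_fin expr1n div1r ler_pdivlMr; last first.
  by rewrite mulr_gt0// addr_gt0// exprn_gt0.
have -> : u^-1 ^+ 3 * (u * (u ^+ 2 + 1)) = 1 + u^-1 ^+ 2 by field; rewrite gt_eqF.
by rewrite lerD2l; apply: lerXn2r; rewrite ?nnegrE ?invr_ge0 ?(ltW u0) ?(ltW r0)// lef_pV2 ?posrE.
Qed.

Local Notation b := r^-1.

Let b0 : 0 < b. Proof. by rewrite invr_gt0. Qed.

Let denR (t v : R) : 1 + (t * v) ^+ 2 != 0.
Proof. by rewrite gt_eqF// ltr_pwDl// sqr_ge0. Qed.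

Lemma kernel_imaginary (t v : R) :
  (1 - t *i * v%:C)^-1 = (1 + (t * v) ^+ 2)^-1 +i* (t * v / (1 + (t * v) ^+ 2)).
Proof.
have dn := denR t v; rewrite mul_imaginary_real.
have n0 : 1 - (t * v) *i != 0 by rewrite eq_complex /= subr0 oner_eq0.
apply: (mulIf n0); rewrite mulVf//; apply/eqP; rewrite eq_complex /=.
by apply/andP; split; apply/eqP; field.
Qed.

Let measurable_resolvent (t : R) : measurable_fun setT (fun v : R => (1 + (t * v) ^+ 2)^-1).
Proof.
apply: (measurableT_comp (@measurable_fun_invr R)); apply: measurable_funD => //.
by apply: measurable_funX; exact: measurable_funM.
Qed.

(** Both sides are integrals against [mu]: the left-hand ones by [v = 1 / u], the
    right-hand ones by [integral_cm_density]. *)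
Lemma stieltjes_imaginary (t : R) : 0 <= t ->
  t ^+ 2 * complex.Re (stieltjes b (N 3) (t *i)) = (\int[leb]_x ((1 - cos (t * x)) * pi x))%R /\
  t ^+ 2 * complex.Im (stieltjes b (N 3) (t *i)) = (\int[leb]_x ((t * x - sin (t * x)) * pi x))%R.
Proof.
move=> t0; have mg := measurable_resolvent t.
have ind (f : R -> R) : (\int[N 3]_v (\1_(`]0, b]%classic : set R) v * f v)%:E =
    \int[N 3]_(v in `]0%R, b%R]) (f v)%:E)%E.
  rewrite [RHS]integral_mkcond; apply: eq_integral => v _.
  by rewrite /patch indicE; case: ifPn => _; rewrite ?mul1r ?mul0r.
have N3fin := weighted_mu_star3_finite.
have key (f h : R -> R) : measurable_fun setT f -> (forall v, 0 < v -> 0 <= f v <= 1) ->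
    (forall u, 0 < u -> t ^+ 2 * (f u^-1 * u^-1 ^+ 3) = h u) ->
    t ^+ 2 * (\int[N 3]_v (\1_(`]0, b]%classic : set R) v * f v))%R =
    fine (\int[mu]_(u in `]0%R, +oo[) (h u)%:E)%E.
  move=> mf f01 fh; have f0 v : 0 < v -> 0 <= f v by move=> /f01 /andP[].
  have mfE (D : set R) : measurable_fun D (EFin \o f).
    by apply: measurable_funTS; exact/measurable_EFinP.
  have Jfin : (\int[N 3]_(v in `]0%R, b%R]) (f v)%:E)%E \is a fin_num.
    rewrite ge0_fin_numE; last first.
      by apply: integral_ge0 => v; rewrite /= in_itv /= lee_fin => /andP[/f0].
    apply: (@le_lt_trans _ _ (\int[N 3]_(v in `]0%R, b%R]) (cst 1%E v))%E).
      apply: ge0_le_integral => //.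
      + by move=> v; rewrite /= in_itv /= lee_fin => /andP[/f0].
      + by move=> v; rewrite /= in_itv /= lee_fin => /andP[/f01 /andP[]].
    rewrite integral_cst// mul1e; apply: le_lt_trans N3fin.
    by apply: le_measure; rewrite ?inE.
  rewrite [X in _ * X]/Rintegral ind.
  have -> : t ^+ 2 * fine (\int[N 3]_(v in `]0%R, b%R]) (f v)%:E)%E =
      fine ((t ^+ 2)%:E * \int[N 3]_(v in `]0%R, b%R]) (f v)%:E)%E by rewrite fineM.
  have f0E v : 0 < v -> (0 <= (EFin \o f) v)%E by move=> v0; rewrite lee_fin f0.
  rewrite (integral_weighted_mu_star r0 mu0r 3 (mfE setT) f0E) -ge0_integralZl//; last 3 first.
  - apply: measurable_funTS; apply: emeasurable_funM.
      exact: (measurableT_comp (mfE setT) (@measurable_fun_invr R)).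
    by apply/measurable_EFinP; apply: measurable_funX; exact: measurable_fun_invr.
  - move=> u; rewrite /= in_itv /= andbT => u0.
    by rewrite mule_ge0 ?lee_fin ?f0 ?invr_gt0// exprn_ge0// invr_ge0 ltW.
  - by rewrite lee_fin sqr_ge0.
  congr fine; apply: eq_integral => u; rewrite inE /= in_itv /= andbT => u0.
  by rewrite -!EFinM fh.
rewrite /Rintegral integral_1Bcos_cm integral_idBsin_cm//.
have ReC (p q : R) : complex.Re (p +i* q) = p by [].
have ImC (p q : R) : complex.Im (p +i* q) = q by [].
rewrite /stieltjes /node_integral /cintegral ReC ImC; split.
- rewrite -(key (fun v => (1 + (t * v) ^+ 2)^-1)) //; last 2 first.
  + move=> v v0; rewrite invr_ge0 addr_ge0 ?sqr_ge0//= invf_le1 ?lerDl ?sqr_ge0//.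
    by rewrite ltr_pwDl// sqr_ge0.
  + move=> u u0; have un0 : u != 0 by rewrite gt_eqF.
    have d1 : u ^+ 2 + t ^+ 2 != 0 by rewrite gt_eqF// ltr_pwDl ?sqr_ge0// exprn_gt0.
    have d2 := denR t u^-1; have -> : 1 + (t / u) ^+ 2 = (u ^+ 2 + t ^+ 2) / u ^+ 2 by field.
    by field; rewrite d1 un0.
  congr (_ * _); apply: eq_Rintegral => v _.
  by rewrite kernel_imaginary /= mul0r subr0.
- rewrite -(key (fun v => t * v / (1 + (t * v) ^+ 2))) //; last 3 first.
  + by apply: measurable_funM => //; exact: measurable_funM.
  + move=> v v0; have tv : 0 <= t * v by rewrite mulr_ge0// ltW.
    have d0 : 0 < 1 + (t * v) ^+ 2 by rewrite ltr_pwDl// sqr_ge0.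
    rewrite divr_ge0 ?(ltW d0)//= ler_pdivrMr// mul1r.
    by move: (t * v) tv => y y0; have := sqr_ge0 (y - 1); nra.
  + move=> u u0; have un0 : u != 0 by rewrite gt_eqF.
    have d1 : u ^+ 2 + t ^+ 2 != 0 by rewrite gt_eqF// ltr_pwDl ?sqr_ge0// exprn_gt0.
    have d2 := denR t u^-1; have -> : 1 + (t / u) ^+ 2 = (u ^+ 2 + t ^+ 2) / u ^+ 2 by field.
    by field; rewrite d1 un0.
  congr (_ * _); apply: eq_Rintegral => v _.
  by rewrite kernel_imaginary /= mul0r addr0.
Qed.

Lemma psi_imaginary (t : R) : 0 <= t ->
  psi (t *i) = a%:C * (t *i) + (t *i) ^+ 2 * stieltjes b (N 3) (t *i).
Proof.
move=> t0; have [F1 F2] := stieltjes_imaginary t0.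
have [_ _ /(_ t)[iR iI] ->] := triple; rewrite mul0r mul0r add0r; congr (_ + _).
have neg (f g : R -> R) : leb.-integrable setT (EFin \o f) -> (forall x, f x = - g x) ->
    (\int[leb]_x f x = - \int[leb]_x g x)%R.
  move=> fi fg; have -> : (\int[leb]_x g x = -1 * \int[leb]_x f x)%R.
    by rewrite -RintegralZl//; apply: eq_Rintegral => x _; rewrite fg mulN1r opprK.
  by rewrite mulN1r opprK.
rewrite /cintegral (neg _ _ iR (Re_lk_integrand pi t)) (neg _ _ iI (Im_lk_integrand pi t)) -F1 -F2.
by case: (stieltjes _ _ _) => p q; apply/eqP; rewrite eq_complex /=; apply/andP; split; apply/eqP; ring.
Qed.

Lemma slit_star (z : R[i]) (t : R) : slit_plane r%:E z -> 0 <= t <= 1 ->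
  slit_plane r%:E (t%:C * z).
Proof.
case: z => p q; rewrite /slit_plane /= => nz /andP[t0 t1] [].
rewrite mul0r addr0 mul0r subr0 => /eqP; rewrite mulf_eq0 => /orP[/eqP->|/eqP q0].
  by rewrite mul0r lee_fin leNgt r0.
rewrite lee_fin => rtp; apply: nz; split=> //; rewrite lee_fin (le_trans rtp)//.
have [p0|p0] := leP 0 p; first by rewrite ler_piMl.
by move: rtp; rewrite leNgt (le_lt_trans _ r0)// mulr_ge0_le0// ltW.
Qed.

(** On the imaginary half-axis this is Tonelli for the mixture of exponentials; it
    propagates by analyticity. *)
Lemma psi_stieltjes : analytic_on (slit_plane r%:E) psi ->
  forall z, slit_plane r%:E z -> psi z = a%:C * z + z ^+ 2 * stieltjes b (N 3) z.
Proof.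
move=> psiA z zs; apply/eqP; rewrite -subr_eq0; apply/eqP.
pose f z := psi z - (a%:C * z + z ^+ 2 * stieltjes b (N 3) z).
apply: (@identity_theorem _ (slit_plane r%:E) f); last exact: zs.
- move=> z0 z0s.
  have N3fin := weighted_mu_star3_finite.
  have z0b : slit_plane b^-1%:E z0 by rewrite invrK.
  have FA := analytic_stieltjes b0 N3fin z0b.
  have : analytic_at (fun z => psi z + -1 * (a%:C * (z * 1) + z * (z * stieltjes b (N 3) z))) z0.
    apply: analytic_atD; first exact: psiA.
    apply: analytic_atZ; apply: analytic_atD.
      apply: analytic_atZ; apply: (analytic_atX (f := fun=> 1)); exact: analytic_at_cst.
    by apply: (analytic_atX (f := fun z => z * stieltjes b (N 3) z)); exact: analytic_atX.
  apply: (analytic_at_near ltr01) => y _; rewrite /f mulN1r mulr1 expr2 mulrA.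
  by [].
- exact: slit_star.
- by move=> u u0; rewrite /f psi_imaginary// subrr.
Qed.

End laplace_exponent_cm.

(** * The Stieltjes transform near the origin *)

Section stieltjes_at_zero.
Context (R : realType) (b : R) (b0 : 0 < b).
Variable M : {measure set R -> \bar R}.
Hypothesis Mfin : (M setT < +oo)%E.
Implicit Types (z w : R[i]) (v : R).

Let kernelV_le2 z v : normc z < (2 * b)^-1 -> 0 <= v <= b ->
  (normc (1 - z * v%:C))^-1 <= 2.
Proof.
move=> zb vb; have h := kernel_lower_near_zero b0 zb vb.
have h0 : 0 < normc (1 - z * v%:C) by lra.
have -> : 2 = (1 / 2)^-1 :> R by field.
by rewrite lef_pV2 ?posrE//; lra.
Qed.

Let kernel_cintegrable z : normc z < (2 * b)^-1 ->
  cintegrable M (fun v => (\1_(`]0, b]%classic : set R) v)%:C * (1 - z * v%:C)^-1).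
Proof.
move=> zb; apply: (@node_cintegrable _ b M Mfin _ 2) => //.
  by apply: cmeasurableV; exact: kernel_cmeasurable.
move=> v /andP[/ltW v0 vb]; by rewrite normcV kernelV_le2// v0.
Qed.

Lemma stieltjes_lipschitz z w : normc z < (2 * b)^-1 -> normc w < (2 * b)^-1 ->
  normc (stieltjes b M z - stieltjes b M w) <= 8 * b * fine (M setT) * normc (z - w).
Proof.
move=> zb wb; rewrite /stieltjes -node_integralB; [|exact: kernel_cintegrable|exact: kernel_cintegrable].
have -> : 8 * b * fine (M setT) * normc (z - w) = 2 * (4 * b * normc (z - w)) * fine (M setT) by ring.
apply: normc_node_integral => //.
- apply: cmeasurableD; first by apply: cmeasurableV; exact: kernel_cmeasurable.
  under eq_fun do rewrite -mulN1r; apply: cmeasurableM; first exact: cmeasurable_cst.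
  by apply: cmeasurableV; exact: kernel_cmeasurable.
- by rewrite !mulr_ge0 ?normc_ge0// ltW.
move=> v /andP[/ltW v0 vb]; have vb' : 0 <= v <= b by rewrite v0.
have hz := kernel_lower_near_zero b0 zb vb'; have hw := kernel_lower_near_zero b0 wb vb'.
have h2 : 0 < 1 / 2 :> R by lra.
have nz : 1 - z * v%:C != 0 by rewrite -normc_gt0 (lt_le_trans _ hz).
have nw : 1 - w * v%:C != 0 by rewrite -normc_gt0 (lt_le_trans _ hw).
have -> : (1 - z * v%:C)^-1 - (1 - w * v%:C)^-1 =
    (z - w) * v%:C * (1 - z * v%:C)^-1 * (1 - w * v%:C)^-1 by field; rewrite nw nz.
rewrite !normcM !normcV normc_real ger0_norm//.
have iz := kernelV_le2 zb vb'.
have iw := kernelV_le2 wb vb'.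
have -> : 4 * b * normc (z - w) = normc (z - w) * b * 2 * 2 by ring.
apply: ler_pM => //; rewrite ?mulr_ge0 ?invr_ge0 ?normc_ge0//.
apply: ler_pM => //; rewrite ?mulr_ge0 ?invr_ge0 ?normc_ge0//.
by rewrite ler_wpM2l ?normc_ge0.
Qed.

Lemma node_integral1 : node_integral b M (fun=> 1) = (fine (M `]0, b]%classic))%:C.
Proof.
have ReC (p q : R) : complex.Re (p +i* q) = p by [].
rewrite /node_integral /cintegral.
have -> : (\int[M]_x complex.Re ((\1_(`]0, b]%classic : set R) x)%:C * 1))%R = fine (M `]0, b]%classic).
  under eq_Rintegral do rewrite mulr1 ReC.
  by rewrite /Rintegral integral_indic// setIT.
have -> : (\int[M]_x complex.Im ((\1_(`]0, b]%classic : set R) x)%:C * 1))%R = 0.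
  by under eq_Rintegral do rewrite mulr1 /=; rewrite /Rintegral integral0_eq.
by [].
Qed.

Lemma stieltjes0 : stieltjes b M 0 = (fine (M `]0, b]%classic))%:C.
Proof.
rewrite -node_integral1 /stieltjes /node_integral; apply: eq_cintegral => v.
by rewrite mul0r subr0 invr1.
Qed.

End stieltjes_at_zero.

Section shift_of_weight.
Context (R : realType) (mu : {measure set R -> \bar R}) (r : R) (r0 : 0 < r).
Hypothesis mu0r : mu `]0, r[%classic = 0%E.
Local Notation N := (weighted_mu_star mu r%:E).
Local Notation b := r^-1.
Hypotheses (N3fin : (N 3 setT < +oo)%E) (N4fin : (N 4 setT < +oo)%E).

Let b0 : 0 < b. Proof. by rewrite invr_gt0. Qed.

Lemma ge0_weight_shift p (f : R -> \bar R) : measurable_fun setT f ->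
  (forall v, 0 < v -> (0 <= f v)%E) ->
  (\int[N p.+1]_(v in `]0%R, b%R]) f v = \int[N p]_(v in `]0%R, b%R]) (v%:E * f v))%E.
Proof.
move=> mf f0; rewrite !integral_weighted_mu_star//.
- apply: eq_integral => u _; rewrite exprS EFinM muleA [(_ * f _)%E]muleC.
  by rewrite -!muleA.
- by apply: emeasurable_funM => //; exact/measurable_EFinP.
- by move=> v v0; rewrite mule_ge0 ?f0// lee_fin ltW.
Qed.

Let restrict_Rintegral p (f : R -> R) :
  (\int[N p]_v (\1_(`]0, b]%classic : set R) v * f v) = \int[N p]_(v in `]0%R, b%R]) f v)%R.
Proof.
rewrite /Rintegral [in RHS]integral_mkcond; congr fine; apply: eq_integral => v _.
by rewrite /patch indicE; case: ifPn => _; rewrite ?mul1r ?mul0r.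
Qed.

Let bounded_on p (f : R -> R) (B : R) : (N p setT < +oo)%E -> measurable_fun setT f ->
  (forall v, 0 < v <= b -> `|f v| <= B) -> (N p).-integrable `]0, b]%classic (EFin \o f).
Proof.
move=> fin mf fB; apply: measurable_bounded_integrable => //.
- by apply: le_lt_trans fin; apply: le_measure; rewrite ?inE.
- exact: measurable_funTS.
- exists B; split; first exact: num_real.
  move=> c Bc v; rewrite /= in_itv /= => v0b; exact: le_trans (fB v v0b) (ltW Bc).
Qed.

(** Adding the bound [B] to [f] reduces to nonnegative integrands. *)
Lemma Rintegral_weight_shift (f : R -> R) (B : R) : measurable_fun setT f ->
  (forall v, 0 < v <= b -> `|f v| <= B) ->
  (\int[N 4]_(v in `]0%R, b%R]) f v = \int[N 3]_(v in `]0%R, b%R]) (v * f v))%R.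
Proof.
move=> mf fB.
have B0 : 0 <= B by apply: le_trans (fB b _) => //; rewrite b0 lexx.
pose g v := f v * \1_(`]0, b]%classic : set R) v.
have gf v : v \in `]0, b]%classic -> g v = f v by move=> vD; rewrite /g indicE vD mulr1.
have mg : measurable_fun setT g by apply: measurable_funM => //; exact: measurable_indic.
have gB v : `|g v| <= B.
  rewrite /g indicE; case: (boolP (v \in _)); last by rewrite mulr0 normr0.
  by rewrite inE /= in_itv /= mulr1; exact: fB.
have gD v : 0 < v <= b -> `|g v| <= B by [].
have vgD v : 0 < v <= b -> `|v * g v| <= b * B.
  by move=> /andP[v0 vb]; rewrite normrM gtr0_norm//; apply: ler_pM => //; exact: ltW.
have mvg : measurable_fun setT (fun v : R => v * g v) by exact: measurable_funM.
have E : (\int[N 4]_(v in `]0%R, b%R]) (g v + B) = \int[N 3]_(v in `]0%R, b%R]) (v * (g v + B)))%R.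
  have m1 : measurable_fun setT (fun v : R => (g v + B)%:E).
    by apply/measurable_EFinP; exact: measurable_funD.
  rewrite /Rintegral (ge0_weight_shift 3 m1) //.
  by move=> v _; rewrite lee_fin; have := gB v; rewrite ler_norml => /andP[]; lra.
have E2 : (\int[N 4]_(v in `]0%R, b%R]) B = \int[N 3]_(v in `]0%R, b%R]) (v * B))%R.
  have m2 : measurable_fun setT (fun _ : R => B%:E) by [].
  by rewrite /Rintegral (ge0_weight_shift 3 m2).
have i4g := bounded_on N4fin mg gD; have i3g := bounded_on N3fin mvg vgD.
have i4B : (N 4).-integrable `]0, b]%classic (EFin \o (fun=> B)).
  by apply: (@bounded_on 4 _ B N4fin) => // v _; rewrite ger0_norm.
have i3B : (N 3).-integrable `]0, b]%classic (EFin \o (fun v => v * B)).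
  apply: (@bounded_on 3 _ (b * B) N3fin) => [|v /andP[v0 vb]]; first exact: measurable_funM.
  by rewrite ger0_norm ?mulr_ge0 ?(ltW v0)// ler_wpM2r.
rewrite RintegralD// E2 in E.
have E3 : (\int[N 3]_(v in `]0%R, b%R]) (v * (g v + B)) =
    \int[N 3]_(v in `]0%R, b%R]) (v * g v) + \int[N 3]_(v in `]0%R, b%R]) (v * B))%R.
  by rewrite -RintegralD//; apply: eq_Rintegral => v _; rewrite mulrDr.
rewrite E3 in E; move/addIr : E.
rewrite (eq_Rintegral _ (g := f)); last by move=> v /gf.
by move=> ->; apply: eq_Rintegral => v /gf ->.
Qed.

(** Since [1 / (1 - z v) = 1 + z v / (1 - z v)], and the factor [v] passes to the measure. *)
Lemma stieltjes_shift (z : R[i]) : slit_plane b^-1%:E z ->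
  stieltjes b (N 3) z = (fine (N 3 `]0, b]%classic))%:C + z * stieltjes b (N 4) z.
Proof.
move=> zs; have [e [s [e0 s0 low]]] := slit_kernel_lower b0 zs.
have ez v : 0 < v <= b -> e <= normc (1 - z * v%:C).
  by move=> /andP[/ltW v0 vb]; apply: low; rewrite ?subrr ?normc0// v0.
have nz v : 0 < v <= b -> 1 - z * v%:C != 0.
  by move=> /ez h; rewrite -normc_gt0 (lt_le_trans e0).
have mK : cmeasurable (fun v : R => (1 - z * v%:C)^-1).
  by apply: cmeasurableV; exact: kernel_cmeasurable.
have [mKR mKI] := mK.
have bK v : 0 < v <= b -> normc (1 - z * v%:C)^-1 <= e^-1.
  by move=> /ez h; rewrite normcV lef_pV2 ?posrE// (lt_le_trans e0).
have shift : node_integral b (N 4) (fun v => (1 - z * v%:C)^-1) =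
    node_integral b (N 3) (fun v => v%:C * (1 - z * v%:C)^-1).
  have ReM (p : R) (y : R[i]) : complex.Re (p%:C * y) = p * complex.Re y.
    by case: y => ? ? /=; rewrite mul0r subr0.
  have ImM (p : R) (y : R[i]) : complex.Im (p%:C * y) = p * complex.Im y.
    by case: y => ? ? /=; rewrite mul0r addr0.
  rewrite /node_integral /cintegral.
  under eq_Rintegral do rewrite ReM.
  under [X in _ +i* X = _]eq_Rintegral do rewrite ImM.
  under [X in _ = X +i* _]eq_Rintegral do rewrite !ReM.
  under [X in _ = _ +i* X]eq_Rintegral do rewrite !ImM.
  rewrite !restrict_Rintegral; congr (_ +i* _); apply: (@Rintegral_weight_shift _ e^-1) => //.
    by move=> v /bK; apply: le_trans; exact: Re_le_normc.
  by move=> v /bK; apply: le_trans; exact: Im_le_normc.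
have i1 : cintegrable (N 3) (fun v => (\1_(`]0, b]%classic : set R) v)%:C * 1).
  apply: (@node_cintegrable _ b (N 3) N3fin _ 1).
  - exact: cmeasurable_cst.
  - exact: ler01.
  - by move=> v _; rewrite normc1.
have i2 : cintegrable (N 3) (fun v => (\1_(`]0, b]%classic : set R) v)%:C * (v%:C * (1 - z * v%:C)^-1)).
  apply: (@node_cintegrable _ b (N 3) N3fin _ (b / e)) => //.
  - by apply: cmeasurableM => //; exact: cmeasurable_real.
  - by rewrite divr_ge0// ltW.
  - move=> v v0b; rewrite normcM normc_real; have /andP[v0 vb] := v0b.
    by rewrite gtr0_norm//; apply: ler_pM; rewrite ?normc_ge0 ?(ltW v0)// bK.
rewrite -node_integral1 /stieltjes shift /node_integral -cintegralZ// -cintegralD//; last exact: cintegrableZ.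
apply: eq_cintegral => v; rewrite indicE; case: (boolP (v \in _)); last by rewrite !mul0r mulr0 addr0.
rewrite inE /= in_itv /= => /nz v1; rewrite !mul1r.
by field.
Qed.

End shift_of_weight.

(** * Levy-Khintchine integrals of exponentials *)

Section exponential_mixtures.
Context (R : realType).
Local Notation leb := (@lebesgue_measure R).

Section one_exponential.
Context (be : R) (be0 : 0 < be).

Definition half_line_exponential (x : R) : R := \1_(`]0, +oo[%classic : set R) x * expR (- (be * x)).
Local Notation e := half_line_exponential.

Lemma half_line_exponential_ge0 x : 0 <= e x.
Proof. by rewrite /e mulr_ge0 ?expR_ge0// indicE. Qed.

Lemma measurable_half_line_exponential : measurable_fun setT e.
Proof.
apply: measurable_funM; first exact: measurable_indic.
apply: (measurableT_comp (f := @expR R)) => //.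
by apply: measurable_funN; exact: measurable_funM.
Qed.

Lemma integral_half_line_exponential (f : R -> R) (I : R) : measurable_fun setT f ->
  (forall x, 0 < x -> 0 <= f x) ->
  (\int[leb]_(x in `]0%R, +oo[) (f x * expR (- (be * x)))%:E = I%:E)%E ->
  leb.-integrable setT (fun x => (f x * e x)%:E) /\ (\int[leb]_x (f x * e x))%R = I.
Proof.
move=> mf f0 fI.
have pos x : 0 <= f x * e x.
  rewrite /e indicE; case: (boolP (x \in _)); last by rewrite mul0r mulr0.
  by rewrite inE /= in_itv /= andbT mul1r => x0; rewrite mulr_ge0 ?expR_ge0// f0.
have E : (\int[leb]_x (f x * e x)%:E = I%:E)%E.
  rewrite -fI [RHS]integral_mkcond; apply: eq_integral => x _.
  by rewrite /patch /e indicE; case: ifPn => _; rewrite ?mul1r ?mul0r ?mulr0.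
split; last by rewrite /Rintegral E.
apply/integrableP; split.
  by apply/measurable_EFinP; apply: measurable_funM => //; exact: measurable_half_line_exponential.
by under eq_integral do rewrite abse_EFin ger0_norm//; rewrite E ltry.
Qed.

Let sin_integral t :
  leb.-integrable setT (fun x => ((t * x - sin (t * x)) * e x)%:E) /\
  (\int[leb]_x ((t * x - sin (t * x)) * e x))%R = t ^+ 3 / (be ^+ 2 * (be ^+ 2 + t ^+ 2)).
Proof.
have nneg s : 0 <= s -> leb.-integrable setT (fun x => ((s * x - sin (s * x)) * e x)%:E) /\
    (\int[leb]_x ((s * x - sin (s * x)) * e x))%R = s ^+ 3 / (be ^+ 2 * (be ^+ 2 + s ^+ 2)).
  move=> s0; apply: integral_half_line_exponential; last exact: integral_idBsin.
    by apply: measurable_funB; [exact: measurable_funM|exact: measurable_sinM].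
  by move=> x x0; rewrite subr_ge0 sin_le_id// mulr_ge0// ltW.
have [t0|t0] := leP 0 t; first exact: nneg.
have nt0 : 0 <= - t by rewrite oppr_ge0 ltW.
have [i E] := nneg _ nt0.
have opp x : (t * x - sin (t * x)) * e x = -1 * ((- t * x - sin (- t * x)) * e x).
  by rewrite (mulNr t x) sinN; ring.
split.
  have := integrableZl measurableT (-1) i.
  by apply: eq_integrable => // x _ /=; rewrite -EFinM opp.
under eq_Rintegral do rewrite opp.
by rewrite RintegralZl// E sqrrN; ring.
Qed.

Let cos_integral t :
  leb.-integrable setT (fun x => ((1 - cos (t * x)) * e x)%:E) /\
  (\int[leb]_x ((1 - cos (t * x)) * e x))%R = t ^+ 2 / (be * (be ^+ 2 + t ^+ 2)).
Proof.
apply: integral_half_line_exponential; last exact: integral_1Bcos.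
  by apply: measurable_funB => //; exact: measurable_cosM.
by move=> x x0; rewrite subr_ge0 cos_le1.
Qed.

Lemma cintegrable_lk_exponential t : cintegrable leb (lk_integrand e id (t *i)).
Proof.
have [ic _] := cos_integral t; have [ii _] := sin_integral t; split.
- have := integrableZl measurableT (-1) ic.
  by apply: eq_integrable => // x _; rewrite Re_lk_integrand -EFinM mulN1r.
- have := integrableZl measurableT (-1) ii.
  by apply: eq_integrable => // x _; rewrite Im_lk_integrand -EFinM mulN1r.
Qed.

Lemma cintegral_lk_exponential t : cintegral leb (lk_integrand e id (t *i)) =
  (t *i) ^+ 2 / (be%:C ^+ 2 * (be%:C - t *i)).
Proof.
have [ic Ec] := cos_integral t; have [ii Ei] := sin_integral t.
have dn : be ^+ 2 + t ^+ 2 != 0 by rewrite gt_eqF// ltr_wpDr ?sqr_ge0// exprn_gt0.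
have bn : be != 0 by rewrite gt_eqF.
rewrite /cintegral.
under eq_Rintegral do rewrite Re_lk_integrand -mulN1r.
under [X in _ +i* X]eq_Rintegral do rewrite Im_lk_integrand -mulN1r.
rewrite !RintegralZl// Ec Ei.
have bc : be%:C != 0 by rewrite eq_complex /= negb_and bn.
have btc : be%:C - t *i != 0 by rewrite eq_complex /= negb_and subr0 bn.
apply: (mulIf (mulf_neq0 (expf_neq0 2 bc) btc)); rewrite mulfVK ?mulf_neq0 ?expf_neq0//.
rewrite !expr2; apply/eqP; rewrite eq_complex /=; apply/andP; split; apply/eqP; by field; rewrite dn bn.
Qed.

End one_exponential.

Context (n : nat) (c be : 'I_n -> R) (c0 : forall i, 0 <= c i) (be0 : forall i, 0 < be i).

Definition exponential_mixture (x : R) : R :=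
  \sum_(i < n) c i * half_line_exponential (be i) x.

Let lk_mixtureE z x : lk_integrand exponential_mixture id z x =
  \sum_(i < n) (c i)%:C * lk_integrand (half_line_exponential (be i)) id z x.
Proof.
rewrite /lk_integrand rmorph_sum mulr_sumr; apply: eq_bigr => i _.
by rewrite rmorphM /=; ring.
Qed.

Lemma cintegrable_lk_mixture t : cintegrable leb (lk_integrand exponential_mixture id (t *i)).
Proof.
rewrite (_ : lk_integrand _ _ _ = fun x => \sum_(i < n) (c i)%:C *
    lk_integrand (half_line_exponential (be i)) id (t *i) x); last by apply/funext => x; exact: lk_mixtureE.
by apply: cintegrable_sum => i; apply: cintegrableZ; exact: cintegrable_lk_exponential.
Qed.

Lemma cintegral_lk_mixture t : cintegral leb (lk_integrand exponential_mixture id (t *i)) =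
  \sum_(i < n) (c i)%:C * ((t *i) ^+ 2 / ((be i)%:C ^+ 2 * ((be i)%:C - t *i))).
Proof.
rewrite (eq_cintegral leb (lk_mixtureE (t *i))) cintegral_sum.
  apply: eq_bigr => i _; rewrite cintegralZ; last exact: cintegrable_lk_exponential.
  by rewrite cintegral_lk_exponential.
by move=> i; apply: cintegrableZ; exact: cintegrable_lk_exponential.
Qed.

Lemma levy_density_mixture : levy_density exponential_mixture.
Proof.
have mm : measurable_fun setT exponential_mixture.
  apply: measurable_sum => i; apply: measurable_funM => //.
  exact: measurable_half_line_exponential.
have m0 x : 0 <= exponential_mixture x.
  by apply: sumr_ge0 => i _; rewrite mulr_ge0// half_line_exponential_ge0.
split=> //.
have I i : leb.-integrable setT (fun x => (half_line_exponential (be i) x)%:E).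
  have [+ _] := @integral_half_line_exponential (be i) (fun=> 1) (be i)^-1
    (measurable_cst _) (fun _ _ => ler01)
    (etrans (eq_integral _ _ (fun x _ => congr1 EFin (mul1r _))) (integral_expN (be0 i))).
  by apply: eq_integrable => // x _; rewrite mul1r.
have : leb.-integrable setT (fun x => (exponential_mixture x)%:E).
  have : leb.-integrable setT (fun x => \sum_(i < n) ((c i)%:E * (half_line_exponential (be i) x)%:E))%E.
    by apply: integrable_sum => // i _; exact: integrableZl.
  by apply: eq_integrable => // x _; rewrite /exponential_mixture -sumEFin.
move=> /integrableP[_]; apply: le_lt_trans; apply: ge0_le_integral => //.
- move=> x _; rewrite lee_fin mulr_ge0// le_min ler01 sqr_ge0//.
- apply/measurable_EFinP; apply: measurable_funM => //.
  by apply: measurable_minr => //; exact: exprn_measurable.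
- by apply: measurableT_comp => //; exact/measurable_EFinP.
- move=> x _; rewrite abse_EFin ger0_norm// lee_fin ler_piMl//.
  by rewrite ge_min lexx.
Qed.

Lemma hyperexponential_mixture : (forall i, 0 < c i) -> hyperexponential_density exponential_mixture.
Proof.
move=> cpos; exists n, 0%N, c, be, (fun=> 1), (fun=> -1); split=> //.
move=> x; rewrite big_ord0 mulr0 addr0 mulr_sumr; apply: eq_bigr => i _.
  by rewrite /half_line_exponential mulrCA.
Qed.

End exponential_mixtures.

(** * Realization of rational exponents *)

Section hyperexponential_realization.
Context (R : realType).
Local Notation leb := (@lebesgue_measure R).

Lemma normc_imaginary (u : R) : normc (u *i) = `|u|.
Proof. by rewrite /normc /= expr0n /= add0r sqrtr_sqr. Qed.

Lemma analytic_continuous_imaginary (f : R[i] -> R[i]) : (forall u : R, analytic_at f (u *i)) ->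
  continuous (fun u : R => f (u *i) : R[i]^o).
Proof.
move=> fA u; apply/cvg_normcP => e e0.
have [D [K [s [_ s0 fK]]]] := analytic_derive1 (fA u).
pose C := normc D + `|K| + 1.
have C0 : 0 < C by rewrite ltr_wpDl// addr_ge0// normc_ge0.
pose m := Num.min (Num.min s 1) (e / C).
have m0 : 0 < m by rewrite !lt_min s0 ltr01 divr_gt0.
near=> v.
have hm : normc ((v - u) *i) < m.
  rewrite normc_imaginary distrC; near: v.
  exact: (@cvgr_dist_lt _ R R (nbhs u) _ id u (@cvg_id _ _) m m0).
have hs : normc ((v - u) *i) < s by apply: lt_le_trans hm _; rewrite /m !ge_min lexx.
have h1 : normc ((v - u) *i) <= 1 by apply/ltW/(lt_le_trans hm); rewrite /m !ge_min lexx orbT.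
have he : C * normc ((v - u) *i) < e.
  by rewrite mulrC -ltr_pdivlMr//; apply: lt_le_trans hm _; rewrite /m ge_min lexx orbT.
have hu : (v - u) *i + u *i = v *i by apply/eqP; rewrite eq_complex /= addr0 subrK !eqxx.
have hK := fK _ hs; rewrite hu in hK; set h := (v - u) *i in hK hs h1 he *.
have -> : f (v *i) - f (u *i) = (f (v *i) - f (u *i) - D * h) + D * h by rewrite subrK.
apply: le_lt_trans (normcD_le _ _) _; apply: le_lt_trans he; rewrite normcM.
have : K * normc h ^+ 2 <= `|K| * normc h.
  apply: (@le_trans _ _ (`|K| * normc h ^+ 2)); first by rewrite ler_wpM2r ?sqr_ge0// ler_norm.
  by rewrite ler_wpM2l// expr2 ler_piMl ?normc_ge0.
have := normc_ge0 h; rewrite /C !mulrDl mul1r; lra.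
Unshelve. all: by end_near. Qed.

(** Compensating the jumps with [h x = x] only shifts the drift, because the exponential
    densities have finite means. *)
Lemma hyperexponential_realization n (c be : 'I_n -> R) (a s2 : R) (f : R[i] -> R[i]) :
  (forall i, 0 < c i) -> (forall i, 0 < be i) -> 0 <= s2 ->
  (forall u : R, analytic_at f (u *i)) ->
  (forall u : R, let z := u *i in f z = (s2 / 2)%:C * z ^+ 2 + a%:C * z +
    \sum_(i < n) (c i)%:C * (z ^+ 2 / ((be i)%:C ^+ 2 * ((be i)%:C - z)))) ->
  exists (d : measure_display) (Omega : measurableType d) (P : probability Omega R)
    (X : R -> {RV P >-> R}),
    [/\ hyperexponential_process X, laplace_exponent X f &
        characteristic_triple f a s2 (exponential_mixture c be) (fun y => y)].
Proof.
move=> c0 be0 s20 fA fE.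
have c0' i : 0 <= c i by exact: ltW.
(* the process below does not compensate its jumps, of mean [c i / be i ^+ 2] *)
pose b := a - \sum_(i < n) c i / be i ^+ 2.
have [d [TT [P [X [levX XE]]]]] := hyperexponential_levy_process b s20 c0' be0.
have triple : characteristic_triple f a s2 (exponential_mixture c be) (fun y => y).
  split=> //.
  - exact: levy_density_mixture.
  - exact: cintegrable_lk_mixture.
  - by move=> u; rewrite /= fE; congr (_ + _); rewrite -(cintegral_lk_mixture c be0).
have f0 : f 0 = 0.
  have := fE 0; rewrite (_ : 0 *i = 0) //= => ->.
  by rewrite expr0n /= !mulr0 addr0 add0r big1// => i _; rewrite mul0r mulr0.
have lap : laplace_exponent X f.
  split=> //; first exact: analytic_continuous_imaginary.
  move=> u; rewrite XE fE; congr cexp.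
  have -> : (u * b) *i = b%:C * (u *i).
    by apply/eqP; rewrite eq_complex /= !mul0r !mulr0 subr0 addr0 mulrC !eqxx.
  have -> : - (s2 * u ^+ 2 / 2)%:C = (s2 / 2)%:C * (u *i) ^+ 2.
    rewrite expr2; apply/eqP; rewrite eq_complex /=; apply/andP; split; apply/eqP; by field.
  rewrite addrAC -[RHS]addrA [RHS]addrC; congr (_ + _).
  rewrite /b rmorphB rmorph_sum mulrBl /= -addrA; congr (_ + _).
  rewrite mulr_suml -sumrN -big_split /=; apply: eq_bigr => i _.
  have b0 : (be i)%:C != 0 by rewrite eq_complex /= negb_and gt_eqF.
  have bu : (be i)%:C - u *i != 0 by rewrite eq_complex /= negb_and subr0 gt_eqF.
  by rewrite rmorphM fmorphV rmorphXn /=; field; rewrite bu b0.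
exists d, TT, P, X; split=> //; split=> //.
exists f, a, s2, (exponential_mixture c be); split=> //.
exact: hyperexponential_mixture.
Qed.

Lemma lk_exponential_term (F : fieldType) (y z c : F) k : y != 0 -> 1 - z * y != 0 ->
  c / y ^+ (2 + k) * (z ^+ 2 / (y^-1 ^+ 2 * (y^-1 - z))) =
  z ^+ 2 * c * y / (y ^+ k * (1 - z * y)).
Proof.
move=> y0 zy; have -> : y^-1 - z = (1 - z * y) / y by field.
have yk := expf_neq0 k y0; rewrite exprD; move: (y ^+ k) yk => t t0.
by field; rewrite zy t0 y0.
Qed.

Lemma pade_levy_densityE k n (x w : 'I_n -> R) : pade_levy_density k x w =
  exponential_mixture (fun i => w i * x i ^- (2 + k)) (fun i => (x i)^-1).
Proof.
apply/funext => y; rewrite /pade_levy_density /exponential_mixture mulr_sumr.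
apply: eq_bigr => i _; rewrite /half_line_exponential mulrCA; congr (_ * (_ * expR (- _))).
by rewrite mulrC.
Qed.

End hyperexponential_realization.

(** * A polynomial minorant of the reciprocal *)

Section reciprocal_moment.
Context (R : realType) (b : R) (b0 : 0 < b).
Variable M : {measure set R -> \bar R}.
Hypothesis Mfin : (M setT < +oo)%E.
Variables (n : nat) (x w : 'I_n -> R).
Hypothesis x0b : forall i, 0 < x i <= b.
Hypothesis quad : forall j, (j < 2 * n)%N ->
  (\int[M]_(v in `]0%R, b]) (v ^+ j)%:E)%E = (\sum_(i < n) x i ^+ j * w i)%:E.

(** The polynomial [1 - q(v)^2], where [q] is the product of the [1 - v / x i], is
    divisible by [v]; the quotient touches [1 / v] from below at the nodes. *)
Lemma reciprocal_minorant : exists p : {poly R},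
  [/\ (size p <= 2 * n)%N, (forall i, p.[x i] = (x i)^-1) & forall v, 0 < v -> p.[v] <= v^-1].
Proof.
have xn i : x i != 0 by rewrite gt_eqF//; have /andP[] := x0b i.
pose q : {poly R} := \prod_(i < n) (1 - (x i)^-1 *: 'X).
have qE v : q.[v] = \prod_(i < n) (1 - (x i)^-1 * v).
  by rewrite horner_prod; apply: eq_bigr => i _; rewrite !hornerE.
have sq : (size q <= n.+1)%N.
  apply: leq_trans (size_poly_prod_leq _ _) _ => /=.
  have h : (\sum_(i < n) size (1 - (x i)^-1 *: 'X)%R <= \sum_(i < n) 2)%N.
    apply: leq_sum => i _; apply: leq_trans (size_polyD _ _) _.
    rewrite geq_max size_poly1 size_polyN /=; apply: leq_trans (size_scale_leq _ _) _.
    by rewrite size_polyX.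
  move: h; rewrite sum_nat_const card_ord muln2 -addnn => h.
  by rewrite leq_subLR addnS ltnS.
have root0 : root (1 - q ^+ 2) 0.
  rewrite /root hornerD hornerN horner_exp qE !hornerE big1 ?expr1n ?subrr// => i _.
  by rewrite mulr0 subr0.
have /factor_theorem[p pE] := root0; rewrite subr0 in pE.
have pv v : v != 0 -> p.[v] = (1 - q.[v] ^+ 2) / v.
  by move=> v0; apply: (mulIf v0); rewrite mulfVK// -hornerMX -pE !hornerE.
exists p; split.
- have [->|p0] := eqVneq p 0; first by rewrite size_poly0.
  rewrite -ltnS -size_mulX// -pE; apply: leq_trans (size_polyD _ _) _.
  rewrite geq_max size_poly1 /= size_polyN; apply: leq_trans (size_poly_exp_leq _ _) _.
  by rewrite ltnS mulnC leq_mul2l /= -(leq_add2r 1) !addn1; case: (size q) sq.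
- move=> i; rewrite pv//; have -> : q.[x i] = 0.
    by rewrite qE (bigD1 i)//= mulVf// subrr mul0r.
  by rewrite expr0n subr0 mul1r.
- by move=> v v0; rewrite pv ?gt_eqF// ler_pdivrMr// mulVf ?gt_eqF// gerBl sqr_ge0.
Qed.

(** The quadrature is exact on the minorant. *)
Lemma sum_reciprocal_nodes_le :
  M.-integrable `]0, b]%classic (fun v => (v^-1)%:E) ->
  \sum_(i < n) w i / x i <= (\int[M]_(v in `]0%R, b%R]) v^-1)%R.
Proof.
move=> inv_int; have [p [sp px pv]] := reciprocal_minorant.
pose P := map_poly (real_complex R) p.
have sP : (size P <= 2 * n)%N by rewrite size_map_poly.
have PE (v : R) : P.[v%:C] = (p.[v])%:C by rewrite horner_map.
have ipow j : M.-integrable `]0, b]%classic (fun v => (v ^+ j)%:E).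
  apply: measurable_bounded_integrable => //.
  - by apply: le_lt_trans Mfin; apply: le_measure; rewrite ?inE.
  - exists (b ^+ j); split; first exact: num_real.
    move=> c bc v; rewrite /= in_itv /= => /andP[v0 vb]; apply: le_trans (ltW bc).
    by rewrite normrX gtr0_norm//; apply: lerXn2r; rewrite ?nnegrE// ltW.
have ip : M.-integrable `]0, b]%classic (fun v => (p.[v])%:E).
  have : M.-integrable `]0, b]%classic (fun v => \sum_(k < size p) ((p`_k)%:E * (v ^+ k)%:E))%E.
    by apply: integrable_sum => // k _; exact: integrableZl.
  by apply: eq_integrable => // v _; rewrite horner_coef sumEFin.
have -> : \sum_(i < n) w i / x i = (\int[M]_(v in `]0%R, b%R]) p.[v])%R.
  apply: (@complexI R); rewrite rmorph_sum /=.
  under eq_bigr do rewrite -px rmorphM /= -PE.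
  rewrite -(node_integral_poly b0 Mfin quad sP).
  rewrite /node_integral /cintegral; congr (_ +i* _).
    rewrite /Rintegral [in RHS]integral_mkcond; congr fine; apply: eq_integral => v _.
    by rewrite PE -rmorphM /= /patch indicE; case: ifPn => _; rewrite ?mul1r ?mul0r.
  rewrite /Rintegral integral0_eq// => v _.
  by rewrite PE -rmorphM.
by apply: le_Rintegral => // v; rewrite /= in_itv /= => /andP[v0 _]; exact: pv.
Qed.

End reciprocal_moment.

(** * The weighted measures and their quadratures *)

Section weighted_measures.
Context (R : realType) (mu : {measure set R -> \bar R}) (r : R) (r0 : 0 < r).
Hypothesis mu0r : mu `]0, r[%classic = 0%E.
Local Notation N := (weighted_mu_star mu r%:E).
Local Notation b := r^-1.

Lemma weighted_mu_star_node_interval p : N p setT = N p `]0, b]%classic.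
Proof.
rewrite weighted_mu_starT//; transitivity (\int[N p]_(v in `]0%R, b%R]) cst 1%E v)%E.
  by rewrite integral_weighted_mu_star//; apply: eq_integral => u _; rewrite mul1e.
by rewrite integral_cst// mul1e.
Qed.

Lemma quadrature_finite_mass p n (x w : 'I_n -> R) : (0 < n)%N ->
  gaussian_quadrature (N p) `]0, b]%classic x w -> (N p setT < +oo)%E.
Proof.
move=> n0 [_ _ _ /(_ 0)]; rewrite muln_gt0 n0 => /(_ isT).
under eq_integral do rewrite expr0.
move=> E; rewrite weighted_mu_star_node_interval.
suff -> : N p `]0, b]%classic = (\sum_(i < n) x i ^+ 0 * w i)%:E by rewrite ltry.
rewrite -E; transitivity (\int[N p]_(v in `]0%R, b%R]) cst 1%E v)%E => //.
by rewrite integral_cst// mul1e.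
Qed.

Lemma reciprocal_weight : (N 3 setT < +oo)%E ->
  (N 4).-integrable `]0, b]%classic (fun v => (v^-1)%:E) /\
  (\int[N 4]_(v in `]0%R, b%R]) v^-1)%R = fine (N 3 `]0, b]%classic).
Proof.
move=> N3fin.
have mV : measurable_fun setT (fun v : R => (v^-1)%:E).
  by apply/measurable_EFinP; exact: measurable_fun_invr.
have V0 (v : R) : 0 < v -> (0 <= (v^-1)%:E :> \bar R)%E by move=> v0; rewrite lee_fin invr_ge0 ltW.
have E : (\int[N 4]_(v in `]0%R, b%R]) (v^-1)%:E = N 3 `]0%R, b%R]%classic)%E.
  rewrite (ge0_weight_shift r0 mu0r 3 mV V0).
  transitivity (\int[N 3]_(v in `]0%R, b%R]) cst 1%E v)%E; last by rewrite integral_cst// mul1e.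
  apply: eq_integral => v; rewrite inE /= in_itv /= => /andP[v0 _].
  by rewrite -EFinM divff// gt_eqF.
split; last by rewrite /Rintegral E.
apply/integrableP; split; first exact: measurable_funTS.
rewrite (eq_integral (fun v : R => (v^-1)%:E)) ?E -?weighted_mu_star_node_interval//.
move=> v; rewrite inE /= in_itv /= => /andP[v0 _].
by rewrite /= ger0_norm// invr_ge0 ltW.
Qed.

End weighted_measures.

(** * Pade approximants of the Laplace exponent *)

Theorem theorem4 (R : realType) (d : measure_display)
    (Omega : measurableType d) (P : probability Omega R)
    (X : R -> {RV P >-> R}) (psi : R[i] -> R[i]) (a : R) (pi : R -> R)
    (mu : {measure set R -> \bar R}) (rho : \bar R) (k : nat)
    (x w : forall n : nat, 'I_n -> R)
    (levyX : levy_process X)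
    (CMX : CM pi mu +oo%E rho)
    (posX : spectrally_positive pi)
    (infvarX : infinite_variation pi)
    (psiX : laplace_exponent X psi)
    (psi_analytic : analytic_on (slit_plane rho) psi)
    (tripleX : characteristic_triple psi a 0 pi (fun y => y))
    (k12 : k = 1%N \/ k = 2%N)
    (quad : forall n : nat, (0 < n)%N ->
       gaussian_quadrature (weighted_mu_star mu rho (2 + k)) (node_interval rho)
         (x n) (w n)) :
  let dpsi0 (j : nat) : R[i] :=
    derive1n j (psi : R[i]^o -> R[i]^o) (0 : R[i]^o) in
  [/\ forall n : nat, (0 < n)%N ->
        (exists PQ, is_pade (n + k) n psi PQ) /\
        forall z : R[i], (forall i, z * (x n i)%:C != 1) ->
          pade (n + k) n psi z =
            \sum_(1 <= j < k.+1) dpsi0 j * z ^+ j / (j`!)%:R +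
            z ^+ k.+1 * \sum_(i < n) (w n i)%:C / (1 - z * (x n i)%:C),
      forall n : nat, (0 < n)%N ->
        exists (d' : measure_display) (Omega' : measurableType d')
               (P' : probability Omega' R) (Xn : R -> {RV P' >-> R}),
          [/\ hyperexponential_process Xn,
              laplace_exponent Xn (pade (n + k) n psi),
              analytic_on (slit_plane rho) (pade (n + k) n psi) &
              characteristic_triple (pade (n + k) n psi)
                (complex.Re (dpsi0 1%N))
                (if k == 1%N then 0 else
                   complex.Re (dpsi0 2%N) - 2 * \sum_(i < n) w n i / x n i)
                (pade_levy_density k (x n) (w n)) (fun y => y)]
    & forall A : set R[i], compact (A : set R[i]^o) -> A `<=` slit_plane rho ->
        exists c1 c2 : R, [/\ 0 < c1, 0 < c2 &
          forall (z : R[i]) (n : nat), A z -> (0 < n)%N ->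
            `|pade (n + k) n psi z - psi z| < (c1 * expR (- (c2 * n%:R)))%:C]].
Proof.
move=> dpsi0.
have [dec cm rhat rhoE] := CMX; have [_ mucpt _] := cm.
have [r r0 [rE mu0r]] := cm_rho_pos_finite cm rhat dec infvarX.
move: rE; rewrite rhoE => {}rhoE; subst rho.
have piE := spectrally_positive_density cm rhat.
have b0 : 0 < r^-1 by rewrite invr_gt0.
set b := r^-1 in b0.
have rb : r = b^-1 by rewrite invrK.
have N3fin := weighted_mu_star3_finite r0 mu0r mucpt piE tripleX.
have psiE := psi_stieltjes r0 mu0r mucpt piE tripleX psi_analytic.
(* the second Taylor coefficient [psi''(0) / 2] *)
pose c0 := fine (weighted_mu_star mu r%:E 3 `]0, b]%classic).
have slit_small z : normc z < (2 * b)^-1 -> slit_plane r%:E z.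
  move=> zb; rewrite rb; apply: slit_near_zero; apply: lt_trans zb _.
  by rewrite ltf_pV2 ?posrE ?mulr_gt0//; lra.
have [dpsi1 dpsi2] : dpsi0 1%N = a%:C /\ dpsi0 2%N = 2 * c0%:C.
  rewrite /c0 -stieltjes0.
  apply: (derivatives_of_quadratic_form (s := (2 * b)^-1)
    (L := 8 * b * fine (weighted_mu_star mu r%:E 3 setT))).
  - by rewrite invr_gt0 mulr_gt0.
  - by rewrite !mulr_ge0 ?fine_ge0// ltW.
  - by move=> z1 z2; exact: stieltjes_lipschitz.
  - by move=> z /slit_small; exact: psiE.
  - by move=> z /slit_small; exact: psi_analytic.
have dpsi2Re : complex.Re (dpsi0 2%N) = 2 * c0.
  by rewrite dpsi2 -[2 : R[i]](rmorph_nat (real_complex R)) -rmorphM.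
have quadD n : (0 < n)%N ->
    gaussian_quadrature (weighted_mu_star mu r%:E (2 + k)) `]0, b]%classic (x n) (w n).
  by move=> /quad; rewrite node_intervalE.
(* the case [n = 1] of the quadrature bounds the mass of the weighted measure *)
have Mfin : (weighted_mu_star mu r%:E (2 + k) setT < +oo)%E
  by exact: (quadrature_finite_mass r0 mu0r (ltn0Sn 0) (quadD 1%N _)).
have quad' n : (0 < n)%N -> [/\ forall i, 0 < x n i <= b, injective (x n),
    (forall i, 0 < w n i) & forall j, (j < 2 * n)%N ->
    (\int[weighted_mu_star mu r%:E (2 + k)]_(v in `]0%R, b]) (v ^+ j)%:E)%E = (\sum_(i < n) x n i ^+ j * w n i)%:E].
  move=> /quadD[xD xinj w0 q]; split=> // i; by have := xD i; rewrite /= in_itv.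
(* the Taylor polynomial of degree [k] of [psi] at [0] *)
pose g : {poly R[i]} := a%:C *: 'X + (if k == 1%N then 0 else c0%:C *: 'X^2).
have gE z : g.[z] = \sum_(1 <= j < k.+1) dpsi0 j * z ^+ j / (j`!)%:R.
  rewrite /g; case: k12 => -> /=.
    by rewrite big_nat1 dpsi1 addr0 !hornerE divr1.
  rewrite big_nat_recr//= big_nat1 dpsi1 dpsi2 hornerD !hornerZ hornerX hornerXn divr1 expr1.
  by rewrite (_ : 2`! = 2%N)//; congr (_ + _); field.
have size_g : (size g <= k.+1)%N.
  rewrite /g; case: k12 => -> /=.
    by rewrite addr0 (leq_trans (size_scale_leq _ _))// size_polyX.
  apply: leq_trans (size_polyD _ _) _; rewrite geq_max.
  by rewrite !(leq_trans (size_scale_leq _ _)) ?size_polyX ?size_polyXn.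
have psiM z : slit_plane b^-1%:E z -> psi z = g.[z] +
    z ^+ k.+1 * stieltjes b (weighted_mu_star mu r%:E (2 + k)) z.
  move=> zs; have zs' : slit_plane r%:E z by rewrite rb.
  rewrite psiE// /g; move: Mfin; case: k12 => -> N4fin /=.
    by rewrite addr0 !hornerE.
  rewrite -/b (stieltjes_shift r0 mu0r N3fin N4fin zs) -/c0 hornerD !hornerZ hornerX hornerXn [in RHS]exprS.
  by move: (stieltjes _ _ _) => S; ring.
have paden n := @pade_quadratureE _ b b0 _ Mfin k g psi size_g psiM x w quad' n.
split.
- move=> n n0; split; last by move=> z zx; rewrite -gE; exact: paden.
  eexists; exact: (@pade_quadrature_is_pade _ b b0 _ Mfin k g psi size_g psiM x w quad' n n0).
- move=> n n0; have [xb xinj w0 q] := quad' n n0.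
  have x0 i : 0 < x n i by have /andP[] := xb i.
  have padeA := @pade_quadrature_analytic _ b b0 _ Mfin k g psi size_g psiM x w quad' n n0.
  rewrite rb in padeA *.
  set s2 := (if k == 1%N then 0 else _).
  have slit_im (u : R) : slit_plane b^-1%:E (u *i).
    by move=> [_] /=; rewrite lee_fin leNgt invr_gt0 b0.
  have s20 : 0 <= s2.
    rewrite /s2; move: Mfin q; case: k12 => -> //= N4fin q.
    (* [w i / x i] sums to at most the integral of [1 / v], which is [c0] *)
    have [ri rE] := reciprocal_weight r0 mu0r N3fin.
    have := sum_reciprocal_nodes_le b0 N4fin xb q ri; rewrite rE -/c0 dpsi2Re.
    by rewrite -mulrBr => h; rewrite mulr_ge0// subr_ge0.
  have formula (u : R) : let z := u *i in pade (n + k) n psi z =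
      (s2 / 2)%:C * z ^+ 2 + a%:C * z + \sum_(i < n) (w n i * x n i ^- (2 + k))%:C *
        (z ^+ 2 / ((x n i)^-1%:C ^+ 2 * ((x n i)^-1%:C - z))).
    move=> z.
    have zx i : z * (x n i)%:C != 1 by exact: (slit_node_neq1 b0 quad' n0 (slit_im u)).
    have X0 i : (x n i)%:C != 0 by rewrite eq_complex /= negb_and gt_eqF.
    have D0 i : 1 - z * (x n i)%:C != 0 by rewrite subr_eq0 eq_sym.
    have term i : (w n i * x n i ^- (2 + k))%:C *
        (z ^+ 2 / ((x n i)^-1%:C ^+ 2 * ((x n i)^-1%:C - z))) =
        z ^+ 2 * (w n i)%:C * (x n i)%:C / ((x n i)%:C ^+ k * (1 - z * (x n i)%:C)).
      rewrite rmorphM !fmorphV rmorphXn /=; exact: lk_exponential_term.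
    under eq_bigr do rewrite term.
    rewrite paden// /g /s2 dpsi2Re; case: k12 => ->; [rewrite eqxx|rewrite [2%N == 1%N]/=].
      rewrite mul0r mul0r add0r addr0 !hornerE mulr_sumr; congr (_ + _).
      by apply: eq_bigr => i _; rewrite expr1; field; rewrite X0 D0.
    have -> : (2 * c0 - 2 * \sum_(i < n) w n i / x n i) / 2 = c0 - \sum_(i < n) w n i / x n i by field.
    have -> : z ^+ 3 * (\sum_(i < n) (w n i)%:C / (1 - z * (x n i)%:C)) =
        \sum_(i < n) z ^+ 2 * (w n i)%:C * (x n i)%:C / ((x n i)%:C ^+ 2 * (1 - z * (x n i)%:C)) -
        (\sum_(i < n) w n i / x n i)%:C * z ^+ 2.
      rewrite rmorph_sum mulr_suml mulr_sumr -sumrB; apply: eq_bigr => i _.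
      by rewrite rmorphM fmorphV /=; field; rewrite X0 D0.
    rewrite rmorphB hornerD !hornerZ hornerX hornerXn /=.
    by move: (\sum_(i < n) _ / (_ * _)) => S; ring.
  have c0i i : 0 < w n i * x n i ^- (2 + k) by rewrite divr_gt0// exprn_gt0.
  have be0 i : 0 < (x n i)^-1 by rewrite invr_gt0.
  have [d' [TT [P' [Xn [hX lapX tX]]]]] :=
    hyperexponential_realization c0i be0 s20 (fun u => padeA _ (slit_im u)) formula.
  exists d', TT, P', Xn; split=> //.
  by rewrite dpsi1 pade_levy_densityE.
- move=> A cA; rewrite rb => As.
  exact: (@pade_quadrature_convergence _ b b0 _ Mfin k g psi size_g psiM x w quad' A cA As).
Qed.
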